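(* Let $X$ be a rearrangement-invariant (r.i.) space over $\mathbb{R}^n$ with fundamental function $\varphi_X$. Let $\gamma\in(0,n)$ and assume that $$\inf_{1\le t<\infty}\varphi_X(t)\,t^{-\frac{\gamma}{n}}>0. \tag{A}$$ Define the functional $\sigma$ by $$\sigma(f)=\sup_{h\sim f,\ h\ge0}\left\|\int_t^\infty h(s)s^{\frac{\gamma}{n}-1}\,ds\right\|_{X'(0,\infty)},\qquad f\in\mathcal{M}_+(\mathbb{R}^n),$$ where the supremum is taken over all $h\in\mathcal{M}_+(0,\infty)$ equimeasurable with $f$ (and the norm is taken with respect to $t$). Then $\sigma$ is an r.i. norm and $M_\gamma\colon X\to Y$, where $M_\gamma$ is the fractional maximal operator and $Y=Y(\sigma')$ is the r.i. space determined by the associate norm $\sigma'$ of $\sigma$. Moreover, $Y$ is the optimal (smallest) r.i. space over $\mathbb{R}^n$ for which $M_\gamma\colon X\to Y$ holds, i.e. $Y\hookrightarrow Z$ for every r.i. space $Z$ over $\mathbb{R}^n$ such that $M_\gamma\colon X\to Z$. Conversely, if (A) is not true, then there does not exist an r.i. space $Y$ over $\mathbb{R}^n$ for which $M_\gamma\colon X\to Y$ holds.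
   Context: Let $R$ be $\mathbb{R}^n$ or $(0,\infty)$ with Lebesgue measure $\mu$ (also written $|\cdot|$). $\mathcal{M}(R)$ is the set of measurable functions on $R$ with values in $[-\infty,\infty]$ and $\mathcal{M}_+(R)$ the set of nonnegative ones. For $f\in\mathcal{M}(R)$, $f^*(t)=\inf\{\lambda\in(0,\infty):\mu(\{|f|>\lambda\})\le t\}$. Functions $f,g$ on possibly different measure spaces are equimeasurable, written $f\sim g$, if $f^*=g^*$ on $(0,\infty)$. An r.i. norm on $R$ is a functional $\varrho\colon\mathcal{M}_+(R)\to[0,\infty]$ such that for all $f,g,f_j\in\mathcal{M}_+(R)$ and $\lambda\ge0$: (P1) $\varrho(f)=0$ iff $f=0$ a.e., $\varrho(\lambda f)=\lambda\varrho(f)$, $\varrho(f+g)\le\varrho(f)+\varrho(g)$; (P2) $f\le g$ a.e. implies $\varrho(f)\le\varrho(g)$; (P3) $f_j\nearrow f$ a.e. implies $\varrho(f_j)\nearrow\varrho(f)$; (P4) $\varrho(\chi_E)<\infty$ whenever $\mu(E)<\infty$; (P5) if $\mu(E)<\infty$, then $\int_Ef\,d\mu\le C_E\varrho(f)$ with a constant $C_E$ independent of $f$; (P6) $\varrho(f)=\varrho(g)$ whenever $f^*=g^*$. The r.i. space determined by $\varrho$ is $X(\varrho)=\{f\in\mathcal{M}(R):\varrho(|f|)<\infty\}$, with $\|f\|_{X(\varrho)}=\varrho(|f|)$. Its fundamental function is $\varphi_X(t)=\varrho(\chi_E)$, where $E\subset R$ is any set with $\mu(E)=t$. The associate norm of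 $\varrho$ is $\varrho'(g)=\sup\{\int_Rfg\,d\mu: f\in\mathcal{M}_+(R),\ \varrho(f)\le1\}$, which is again an r.i. norm; for $X=X(\varrho)$ the associate space is $X'=X(\varrho')$, and $X''=X$. For an r.i. space $X$ over $\mathbb{R}^n$, $X(0,\infty)$ denotes its representation space, the unique r.i. space over $(0,\infty)$ with $\|f\|_X=\|f^*\|_{X(0,\infty)}$ for all $f$; $X'(0,\infty)$ is the representation space of $X'$. $T\colon X\to Y$ means there is $C>0$ with $\|Tf\|_Y\le C\|f\|_X$ for all $f\in X$; $X\hookrightarrow Y$ means this for the identity operator. The fractional maximal operator is $M_\gamma f(x)=\sup_{Q\ni x}\frac{1}{|Q|^{1-\gamma/n}}\int_Q|f(y)|\,dy$, $x\in\mathbb{R}^n$, for locally integrable $f$ on $\mathbb{R}^n$, the supremum being over all cubes $Q\subset\mathbb{R}^n$ containing $x$ with edges parallel to the coordinate axes. *)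

(* Defs.v *)
From HB Require Import structures.
From mathcomp Require Import all_boot all_order all_algebra.
From mathcomp Require Import all_classical all_reals all_analysis.
From mathcomp Require Import measurable_realfun.

Set Implicit Arguments.
Unset Strict Implicit.
Unset Printing Implicit Defensive.

Import Order.TTheory GRing.Theory Num.Theory.
Import numFieldNormedType.Exports.

Local Open Scope classical_set_scope.
Local Open Scope ring_scope.
Local Open Scope ereal_scope.

(* The product of a measure on [T] and a measure on [T^n], carried over to
   [T^(n+1)] by [(x, y) |-> x :: y]. *)
Section tuple_product.
Context d (T : measurableType d) (R : realType) (n : nat).
Variables (m1 : {sigma_finite_measure set T -> \bar R})
          (m2 : {sigma_finite_measure set (n.-tuple T) -> \bar R}).

Let cons_pair (p : T * n.-tuple T) : n.+1.-tuple T := [tuple of p.1 :: p.2].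

Let measurable_cons_pair : measurable_fun [set: T * n.-tuple T] cons_pair.
Proof. exact: measurable_cons. Qed.

Definition tuple_product : set (n.+1.-tuple T) -> \bar R :=
  pushforward (m1 \x m2) cons_pair.

Let preim_measurable (A : set (n.+1.-tuple T)) :
  measurable A -> measurable (cons_pair @^-1` A).
Proof. by move=> mA; rewrite -[X in measurable X]setTI; exact: measurable_cons_pair. Qed.

Let tuple_product0 : tuple_product set0 = 0.
Proof. by rewrite /tuple_product /pushforward preimage_set0 measure0. Qed.

Let tuple_product_ge0 A : 0 <= tuple_product A.
Proof. exact: measure_ge0. Qed.

Let tuple_product_sigma_additive : semi_sigma_additive tuple_product.
Proof.
move=> F mF tF mUF; rewrite /tuple_product /pushforward preimage_bigcup.
apply: measure_semi_sigma_additive.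
- by move=> k; exact: preim_measurable.
- apply/trivIsetP => /= i j _ _ ij; rewrite -preimage_setI.
  by move/trivIsetP : tF => /(_ _ _ _ _ ij) ->//; rewrite preimage_set0.
- by rewrite -preimage_bigcup; exact: preim_measurable.
Qed.

HB.instance Definition _ := isMeasure.Build _ _ _ tuple_product
  tuple_product0 tuple_product_ge0 tuple_product_sigma_additive.

Let tuple_product_sigma_finite : sigma_finite setT tuple_product.
Proof.
have [F TF mF] := sigma_finiteT m1.
have [G TG mG] := sigma_finiteT m2.
have /card_esym/ppcard_eqP[e] := card_nat2.
pose H (q : nat * nat) : set (n.+1.-tuple T) :=
  [set t | F q.1 (thead t) /\ G q.2 [tuple of behead t]].
have preH q : cons_pair @^-1` H q = F q.1 `*` G q.2.
  apply/seteqP; split => -[x y]; rewrite /H /cons_pair /= theadE.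
    by move=> [? Gy]; split => //; move: Gy; congr (G _ _); exact/val_inj.
  by move=> [? Gy]; split => //; move: Gy; congr (G _ _); exact/val_inj.
have mH q : measurable (H q).
  have -> : H q = (@tnth _ T ^~ ord0) @^-1` F q.1 `&`
      (fun t : n.+1.-tuple T => [tuple of behead t]) @^-1` G q.2 by [].
  apply: measurableI; rewrite -[X in measurable X]setTI.
    by apply: measurable_tnth => //; exact: (mF _).1.
  by apply: measurable_behead => //; exact: (mG _).1.
exists (H \o e) => [|k].
  apply/seteqP; split => // t _.
  have [i _ Fi] : (\bigcup_i F i) (thead t) by rewrite -TF.
  have [j _ Gj] : (\bigcup_j G j) [tuple of behead t] by rewrite -TG.
  by exists (e^-1%FUN (i, j)) => //=; rewrite invK ?inE.
split; first exact: mH.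
have [? ?] := mF (e k).1; have [? ?] := mG (e k).2.
rewrite /tuple_product /pushforward /= preH product_measure1E//.
by rewrite lte_mul_pinfty// ge0_fin_numE.
Qed.

HB.instance Definition _ := @Measure_isSigmaFinite.Build _ _ _
  tuple_product tuple_product_sigma_finite.

End tuple_product.

Section euclidean_space.
Context (R : realType).

Fixpoint borel_lebesgue (n : nat) :
    {sigma_finite_measure set (n.-tuple (measurableTypeR R)) -> \bar R} :=
  match n with
  | 0 => \d_ ([tuple] : 0.-tuple (measurableTypeR R))
  | m.+1 => tuple_product (@lebesgue_measure R) (borel_lebesgue m)
  end.

(* The line with the sigma-algebra of the Lebesgue measurable sets; it is the
   domain of [completed_lebesgue_measure]. *)
Definition line : measurableType _ :=
  caratheodory_type ((@wlength R idfun)^*)%mu.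

Definition lebesgue_line : {measure set line -> \bar R} :=
  @completed_lebesgue_measure R.

(* Functions on the half-line are functions on the line of which only the
   values on [positives] are taken into account. *)
Definition positives : set line := `]0%R, +oo[%classic.

(* [R^n] with the sigma-algebra of the Lebesgue measurable sets, i.e., those
   that are Caratheodory measurable for the outer measure generated by the
   product measure. *)
Definition Rn (n : nat) : measurableType _ :=
  caratheodory_type ((borel_lebesgue n)^*)%mu.

Definition lebesgue_Rn (n : nat) : {measure set (Rn n) -> \bar R} :=
  @completed_measure_extension _ _ _ (borel_lebesgue n).

End euclidean_space.

Section rearrangement_invariance.
Context d (T : measurableType d) (R : realType).
Variables (mu : {measure set T -> \bar R}) (D : set T).

Definition nonneg_measurable (f : T -> \bar R) : Prop :=
  measurable_fun D f /\ forall x, D x -> 0 <= f x.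

Definition rearrangement (f : T -> \bar R) (t : R) : \bar R :=
  ereal_inf [set l%:E | l in
    [set l : R | (0 < l)%R /\ mu (D `&` [set x | l%:E < `|f x|]) <= t%:E]].

(* A constant factor [0] in front of an infinite value gives [0], here and in
   the library. *)
Record ri_norm (rho : (T -> \bar R) -> \bar R) : Prop := {
  ri_norm_ge0 : forall f, nonneg_measurable f -> 0 <= rho f ;
  ri_norm_eq0 : forall f, nonneg_measurable f ->
    rho f = 0 <-> {ae mu, forall x, D x -> f x = 0} ;
  ri_normZ : forall (l : R) f, (0 <= l)%R -> nonneg_measurable f ->
    rho (fun x => l%:E * f x) = l%:E * rho f ;
  ri_normD : forall f g, nonneg_measurable f -> nonneg_measurable g ->
    rho (fun x => f x + g x) <= rho f + rho g ;
  ri_norm_le : forall f g, nonneg_measurable f -> nonneg_measurable g ->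
    {ae mu, forall x, D x -> f x <= g x} -> rho f <= rho g ;
  ri_norm_fatou : forall (f_ : nat -> T -> \bar R) f,
    (forall j, nonneg_measurable (f_ j)) -> nonneg_measurable f ->
    {ae mu, forall x, D x ->
      nondecreasing_seq (fun j => f_ j x) /\ f_ j x @[j --> \oo] --> f x} ->
    nondecreasing_seq (fun j => rho (f_ j)) /\
    rho (f_ j) @[j --> \oo] --> rho f ;
  ri_norm_indic : forall E, measurable E -> E `<=` D -> mu E < +oo ->
    rho (fun x => (\1_E x)%:E) < +oo ;
  ri_norm_integral : forall E, measurable E -> E `<=` D -> mu E < +oo ->
    exists C : R, forall f, nonneg_measurable f ->
      \int[mu]_(x in E) f x <= C%:E * rho f ;
  ri_norm_rearrangement : forall f g,
    nonneg_measurable f -> nonneg_measurable g ->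
    (forall t : R, (0 < t)%R -> rearrangement f t = rearrangement g t) ->
    rho f = rho g
}.

Definition space_norm (rho : (T -> \bar R) -> \bar R) (f : T -> \bar R) :
  \bar R := rho (fun x => `|f x|).

Definition in_space (rho : (T -> \bar R) -> \bar R) (f : T -> \bar R) : Prop :=
  measurable_fun D f /\ space_norm rho f < +oo.

Definition associate_norm (rho : (T -> \bar R) -> \bar R) (g : T -> \bar R) :
  \bar R :=
  ereal_sup [set \int[mu]_(x in D) (f x * g x) | f in
    [set f | nonneg_measurable f /\ rho f <= 1]].

(* For an r.i. norm the value does not depend on the set that is picked. *)
Definition fundamental_function (rho : (T -> \bar R) -> \bar R) (t : R) :
  \bar R :=
  let E := xget set0 [set E | [/\ measurable E, E `<=` D & mu E = t%:E]] in
  rho (fun x => (\1_E x)%:E).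

Definition bounded_operator (rhoX : (T -> \bar R) -> \bar R)
    (A : (T -> \bar R) -> T -> \bar R) (rhoY : (T -> \bar R) -> \bar R) : Prop :=
  exists2 C : R, (0 < C)%R & forall f, in_space rhoX f ->
    in_space rhoY (A f) /\ space_norm rhoY (A f) <= C%:E * space_norm rhoX f.

Definition embedded (rhoX rhoY : (T -> \bar R) -> \bar R) : Prop :=
  bounded_operator rhoX id rhoY.

End rearrangement_invariance.

Definition equimeasurable d1 d2 (T1 : measurableType d1) (T2 : measurableType d2)
    (R : realType)
    (mu1 : {measure set T1 -> \bar R}) (D1 : set T1) (f : T1 -> \bar R)
    (mu2 : {measure set T2 -> \bar R}) (D2 : set T2) (g : T2 -> \bar R) : Prop :=
  forall t : R, (0 < t)%R ->
    rearrangement mu1 D1 f t = rearrangement mu2 D2 g t.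

Section fractional_maximal_operator.
Context (R : realType) (n : nat).
Local Notation mu := (lebesgue_Rn R n).

Definition ri_norm_Rn : ((Rn R n -> \bar R) -> \bar R) -> Prop :=
  ri_norm mu setT.

Definition ri_norm_positives : ((line R -> \bar R) -> \bar R) -> Prop :=
  ri_norm (lebesgue_line R) (@positives R).

(* Only its values at elements of [M_+(0,oo)] are meaningful (they are uniquely
   determined), and [rho] has to be an r.i. norm for such an object to exist. *)
Definition representation_norm (rho : (Rn R n -> \bar R) -> \bar R) :
    (line R -> \bar R) -> \bar R :=
  xget (fun=> 0) [set rbar | ri_norm_positives rbar /\
    forall f : Rn R n -> \bar R, measurable_fun setT f ->
      space_norm rho f = space_norm rbar (rearrangement mu setT f)].

Definition cube (a : n.-tuple R) (l : R) : set (Rn R n) :=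
  [set y | forall i : 'I_n, (tnth a i <= tnth y i <= tnth a i + l)%R].

Definition fractional_maximal (gamma : R) (f : Rn R n -> \bar R) (x : Rn R n) :
  \bar R :=
  ereal_sup
    [set ((fine (mu Q) `^ (1 - gamma / n%:R))^-1)%:E * \int[mu]_(y in Q) `|f y|
    | Q in [set Q | exists a l, [/\ (0 < l)%R, Q = cube a l & Q x]]].

Definition sigma_norm (gamma : R) (rho : (Rn R n -> \bar R) -> \bar R)
    (f : Rn R n -> \bar R) : \bar R :=
  ereal_sup
    [set space_norm (representation_norm (associate_norm mu setT rho))
       (fun t : line R => \int[lebesgue_line R]_(s in `]t, +oo[%classic)
          (h s * ((s : R) `^ (gamma / n%:R - 1))%:E))
    | h in [set h : line R -> \bar R |
        nonneg_measurable (@positives R) h /\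
        equimeasurable (lebesgue_line R) (@positives R) h mu setT f]].

End fractional_maximal_operator.

(* Main.v *)
Require Import Defs.
From HB Require Import structures.
From mathcomp Require Import all_boot all_order all_algebra fingroup perm.
From mathcomp Require Import all_classical all_reals all_analysis.
From mathcomp Require Import measurable_realfun.
From mathcomp Require Import ring lra.
Import Order.TTheory GRing.Theory Num.Theory.
Import numFieldNormedType.Exports.
Local Open Scope classical_set_scope.
Local Open Scope ring_scope.
Local Open Scope ereal_scope.
Set Implicit Arguments.
Unset Strict Implicit.
Unset Printing Implicit Defensive.

(** Everything is expressed through distribution functions. For distribution
    functions [e1] and [e2] let [pairing e1 e2] be the integral over the
    half-line of the product of the two decreasing rearrangements. On a
    measure space with a coordinate [tau] whose sublevel set at level [s] has
    measure [s] (the half-line, or R^n with [tau x] the volume of the cube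
    centred at the origin through [x]) the Hardy-Littlewood inequality bounds
    the integral of [f g] by the pairing, and resonance says that the bound is
    the supremum over all functions equimeasurable with [f] ([resonance]).
    Hence the supremum of the pairings with a set [W] of distribution
    functions is an r.i. norm as soon as [W] is neither too large nor too
    small ([ri_norm_pairing_norm]).

    Put al = gamma / n and let [hardy al e] be s^(al - 1) times the integral
    of f^* over ]0, s[, [e] being the distribution function of [f]. Tonelli's
    theorem moves the integral operator in the definition of sigma to the
    other factor, and resonance evaluates the supremum over [h]: sigma is the
    norm given by the distribution functions of the [hardy al w], [w] in the
    unit ball of X ([sigma_normE]). Averaging over an initial segment does not
    increase an r.i. norm ([average_le]); therefore the growth of the
    fundamental function bounds these functions by max(1, s^(al - 1)) up to a
    constant, which is integrable at the origin, and sigma is an r.i. norm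
    ([ri_norm_sigma]). Its associate norm is then one as well.

    The maximal function of [f] is equivalent to the Hardy transform in the
    following sense. By a finite Vitali covering, its distribution function is
    at most that of a constant multiple of [hardy al e] ([dist_maximal_le]);
    together with the Hardy-Littlewood inequality this is the boundedness of
    the maximal operator into Y. Conversely, when [f] is a decreasing function
    of the volume of the centred cube, the distribution function of its
    maximal function is at least that of [hardy al e] ([dist_hardy_le]).

    For the optimality suppose that the operator is bounded into Z. If the
    pairing of [k] with every function is at most twice its norm in Z, then
    [dist_hardy_le] shows that sigma k is bounded by a constant; so the
    integral of [f k] is bounded by the norm of [f] in Y, up to this constant.
    It remains to find for [f] such a [k] with the integral of [f k] equal to
    the norm of [f] in Z. For step functions with cells of equal measure this
    is the Hahn-Banach theorem in finite dimension ([norming_step]), and these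
    functions approximate a decreasing function of the coordinate from below.

    Finally, on a cube of volume t the maximal function of the indicator of
    the cube is at least t^al. A bound into any r.i. space thus forces the
    fundamental function of X to grow at least like t^al. *)

(** * Distribution functions and rearrangements *)

Section distribution.
Context (R : realType).
Implicit Types (e : R -> \bar R) (a s t : R).

(** The decreasing rearrangement as a function of the distribution function
    [e], which is all that an r.i. norm sees. The condition [0 < l] is that of
    [rearrangement]. *)
Definition rea e (t : R) : \bar R :=
  ereal_inf [set l%:E | l in [set l : R | (0 < l)%R /\ e l <= t%:E]].

(** Right continuity is stated with finite upper bounds [t%:E], which covers
    the value [+oo] as well. *)
Definition is_dist e := [/\ forall a, (0 <= a)%R -> 0 <= e a,
  forall a b, (0 <= a)%R -> (a <= b)%R -> e b <= e a &
  forall a t, (0 <= a)%R -> (forall b, (a < b)%R -> e b <= t%:E) -> e a <= t%:E].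

(** Right continuity makes [e] and [rea e] generalised inverses of each other;
    this equivalence is the source of all comparisons of a function with its
    rearrangement. *)
Lemma rea_le e a t : is_dist e -> (0 <= a)%R -> (rea e t <= a%:E) = (e a <= t%:E).
Proof.
move=> [e0 eN eR] a0; apply/idP/idP => h.
  apply: eR => // b ab.
  have : rea e t < b%:E by apply: le_lt_trans h _; rewrite lte_fin.
  move=> /ereal_inf_lt[_ [l [l0 el] <-]]; rewrite lte_fin => lb.
  by apply: le_trans el; apply: eN => //; exact: ltW.
apply/lee_addgt0Pr => r r0; apply: ereal_inf_lbound.
exists (a + r)%R => //; split; first by rewrite ltr_wpDl.
by apply: le_trans h; apply: eN => //; rewrite lerDl ltW.
Qed.

Lemma rea_lt e a t : is_dist e -> (0 <= a)%R -> (a%:E < rea e t) = (t%:E < e a).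
Proof. by move=> he a0; rewrite !ltNge rea_le. Qed.

Lemma rea_ge0 e t : 0 <= rea e t.
Proof. by apply: le_ereal_inf_tmp => _ [l [l0 _] <-]; rewrite lee_fin ltW. Qed.

Lemma rea_nincr e s t : (s <= t)%R -> rea e t <= rea e s.
Proof.
move=> st; apply: ereal_inf_le_tmp => _ [l [l0 el] <-]; exists l => //; split => //.
by apply: le_trans el _; rewrite lee_fin.
Qed.

Lemma lte_real_between (x y : \bar R) : 0 <= x -> x < y ->
  exists2 t, (0 < t)%R & x <= t%:E < y.
Proof.
case: x y => [x| |] [y| |]//=.
- rewrite lee_fin !lte_fin => x0 xy; exists ((x + y) / 2)%R; first lra.
  by rewrite lee_fin lte_fin; apply/andP; split; lra.
- rewrite lee_fin => x0 _; exists (x + 1)%R; first lra.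
  by rewrite ltry andbT lee_fin; lra.
Qed.

(** If the values at [a] differ, a positive real [t] lies between them, and
    [rea_lt] separates the rearrangements at [t]. *)
Lemma rea_inj e1 e2 : is_dist e1 -> is_dist e2 ->
  (forall t, (0 < t)%R -> rea e1 t = rea e2 t) -> forall a, (0 <= a)%R -> e1 a = e2 a.
Proof.
have main d1 d2 : is_dist d1 -> is_dist d2 ->
    (forall t, (0 < t)%R -> rea d1 t = rea d2 t) ->
    forall a, (0 <= a)%R -> d1 a <= d2 a.
  move=> h1 h2 E a a0; rewrite leNgt; apply/negP => h.
  have [t t0 /andP[d2t d1t]] := lte_real_between (let: And3 h _ _ := h2 in h a a0) h.
  by move: d1t; rewrite -rea_lt// E// rea_lt// ltNge d2t.
by move=> h1 h2 E a a0; apply/eqP; rewrite eq_le !main// => t t0; rewrite E.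
Qed.

Lemma eq_rea e1 e2 : (forall a, (0 < a)%R -> e1 a = e2 a) -> rea e1 = rea e2.
Proof.
move=> E; apply/funext => t; congr ereal_inf; congr image.
by apply/seteqP; split => l /= [l0]; rewrite ?E// -?E//.
Qed.

Lemma is_dist_ge0 e a : is_dist e -> (0 <= a)%R -> 0 <= e a.
Proof. by case=> h _ _; exact: h. Qed.

Lemma is_dist_nincr e a b : is_dist e -> (0 <= a)%R -> (a <= b)%R -> e b <= e a.
Proof. by case=> _ h _; exact: h. Qed.

End distribution.

Section distribution_of_a_function.
Context d (T : measurableType d) (R : realType).
Variables (mu : {measure set T -> \bar R}) (D : set T).
Implicit Types (f g : T -> \bar R) (a s t : R).

Definition dist f a : \bar R := mu (D `&` [set x | a%:E < f x]).

Lemma rearrangementE f t :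
  rearrangement mu D f t = rea (dist (fun x => `|f x|)) t.
Proof. by []. Qed.

Lemma eq_dist f g a : {in D, f =1 g} -> dist f a = dist g a.
Proof.
move=> fg; congr (mu _); apply/seteqP.
by split => x /= [Dx]; rewrite fg ?inE// => h; split.
Qed.

Lemma ge0_rearrangementE f t : (forall x, D x -> 0 <= f x) ->
  rearrangement mu D f t = rea (dist f) t.
Proof.
move=> f0; rewrite rearrangementE; congr (rea _ _); apply/funext => a.
by apply: eq_dist => x; rewrite inE => Dx; rewrite gee0_abs// f0.
Qed.

Hypothesis mD : measurable D.

Lemma measurable_levelset f a : measurable_fun D f ->
  measurable (D `&` [set x | a%:E < f x]).
Proof. by move=> mf; exact: emeasurable_fun_o_infty. Qed.

Lemma dist_is_dist f : measurable_fun D f -> is_dist (dist f).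
Proof.
move=> mf; split=> [a _|a b _ ab|a t _ h]; first exact: measure_ge0.
  apply: le_measure; rewrite ?inE; try exact: measurable_levelset.
  move=> x [Dx /= h]; split => //=; apply: le_lt_trans h; by rewrite lee_fin.
rewrite /dist.
pose F n := D `&` [set x | (a + n.+1%:R^-1)%:E < f x].
have UF : \bigcup_n F n = D `&` [set x | a%:E < f x].
  apply/seteqP; split => [x [n _ [Dx /=]]|x [Dx /= ax]].
    by move=> h'; split => //=; apply: le_lt_trans h'; rewrite lee_fin lerDl invr_ge0.
  case E : (f x) ax => [r| |]// ax; last first.
    by exists 0%N => //; split => //=; rewrite E ltry.
  rewrite lte_fin in ax.
  have ra0 : (0 < r - a)%R by rewrite subr_gt0.
  have [n] := near_infty_natSinv_lt (PosNum ra0).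
  move=> _ /(_ n (leqnn n)) /= nr.
  by exists n => //; split => //=; rewrite E lte_fin -ltrBrDl.
have mF n : measurable (F n) by exact: measurable_levelset.
have := @nondecreasing_cvg_mu _ _ _ mu F mF.
rewrite UF => /(_ (measurable_levelset a mf)) cF.
have ndF : {homo F : n m / (n <= m)%N >-> (n <= m)%O}.
  move=> n m nm; apply/subsetPset => x [Dx /= h']; split => //=.
  by apply: le_lt_trans h'; rewrite lee_fin lerD2l lef_pV2 ?posrE// ler_nat.
have /cvg_lim <-// := cF ndF.
apply: lime_le; first by apply/cvg_ex; eexists; exact: (cF ndF).
apply: nearW => n /=; apply: h; rewrite ltrDl invr_gt0; exact: ltr0Sn.
Qed.

Lemma le_dist f g : measurable_fun D f -> measurable_fun D g ->
  {ae mu, forall x, D x -> f x <= g x} -> forall a, dist f a <= dist g a.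
Proof.
move=> mf mg [N [mN N0 fgN]] a.
rewrite /dist.
apply: (@le_trans _ _ (mu ((D `&` [set x | a%:E < g x]) `|` N))).
  apply: le_measure; rewrite ?inE; try exact: measurable_levelset.
    by apply: measurableU => //; exact: measurable_levelset.
  move=> x [Dx /= ax]; have [fg|nfg] := leP (f x) (g x).
    by left; split => //=; exact: lt_le_trans fg.
  by right; apply: fgN => /= /(_ Dx); rewrite leNgt nfg.
apply: (le_trans (measureU2 mu (measurable_levelset a mg) mN)).
by rewrite [X in _ + X]N0 adde0.
Qed.

Lemma ae_eq_dist f g : measurable_fun D f -> measurable_fun D g ->
  {ae mu, forall x, D x -> f x = g x} -> forall a, dist f a = dist g a.
Proof.
move=> mf mg fg a; apply/eqP; rewrite eq_le !le_dist//;
  by apply: filterS fg => x h Dx; rewrite h.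
Qed.

End distribution_of_a_function.

Section equimeasurability.
Context d1 (T1 : measurableType d1) d2 (T2 : measurableType d2) (R : realType).
Variables (mu1 : {measure set T1 -> \bar R}) (D1 : set T1).
Variables (mu2 : {measure set T2 -> \bar R}) (D2 : set T2).
Hypotheses (mD1 : measurable D1) (mD2 : measurable D2).

(** The level 0 is included by right continuity. *)
Lemma equimeasurableP f g : nonneg_measurable D1 f -> nonneg_measurable D2 g ->
  equimeasurable mu1 D1 f mu2 D2 g <->
  forall a : R, (0 <= a)%R -> dist mu1 D1 f a = dist mu2 D2 g a.
Proof.
move=> [mf f0] [mg g0]; split => [E|E t t0].
  apply: rea_inj; [exact: dist_is_dist|exact: dist_is_dist|move=> t t0].
  by have := E t t0; rewrite !ge0_rearrangementE.
rewrite !ge0_rearrangementE//; congr (_ t).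
by apply: eq_rea => a a0; apply: E; exact: ltW.
Qed.

End equimeasurability.

(** * The layer cake formula and the Hardy-Littlewood inequality *)

Section staircase.
Context (R : realType).
Implicit Types (e : R -> \bar R) (del : R) (m : nat) (y : \bar R).

(** A lower approximation of [y] by a sum of indicators of upper level sets,
    [m] of them at distance [del]. *)
Definition stair del m y : R :=
  \sum_(i < m) (if ((i.+1%:R * del)%:E < y)%E then del else 0).

Lemma stair_ge0 del m y : (0 < del)%R -> (0 <= stair del m y)%R.
Proof. by move=> d0; apply: sumr_ge0 => i _; case: ifP => // _; exact: ltW. Qed.

Lemma stair_full del m y : (0 < del)%R -> (m%:R * del)%:E < y ->
  stair del m y = (m%:R * del)%R.
Proof.
move=> d0 h; rewrite /stair (eq_bigr (fun=> del)).
  by rewrite sumr_const card_ord mulr_natl.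
move=> i _; rewrite ifT//; apply: le_lt_trans h; rewrite lee_fin.
by rewrite ler_pM2r// ler_nat ltn_ord.
Qed.

Lemma stair_le_max del m y : (0 < del)%R -> (stair del m y <= m%:R * del)%R.
Proof.
move=> d0; apply: (@le_trans _ _ (\sum_(i < m) del)%R).
  by apply: ler_sum => i _; case: ifP => // _; exact: ltW.
by rewrite sumr_const card_ord mulr_natl.
Qed.

Lemma stair_le del m y : (0 < del)%R -> 0 <= y -> (stair del m y)%:E <= y.
Proof.
move=> d0; case: y => [r| |]//; last by move=> _; rewrite leey.
rewrite !lee_fin => r0; elim: m => [|m IH]; first by rewrite /stair big_ord0.
have /= := @stair_le_max del m r%:E d0.
rewrite /stair big_ord_recr /= -/(stair del m r%:E).
case: ifPn => [|_ _]; last by rewrite addr0.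
by rewrite lte_fin -natr1 mulrDl mul1r; lra.
Qed.

Lemma stair_ge del m (r : R) : (0 < del)%R -> (r <= m.+1%:R * del)%R ->
  (r - del <= stair del m r%:E)%R.
Proof.
move=> d0; elim: m => [|m IH].
  by rewrite /stair big_ord0 mul1r subr_le0.
have [rm _|rm rm1] := leP r (m.+1%:R * del)%R.
  rewrite /stair big_ord_recr /= -/(stair del m r%:E).
  by apply: le_trans (IH rm) _; rewrite lerDl; case: ifP => // _; exact: ltW.
rewrite stair_full ?lte_fin//.
by move: rm1; rewrite -natr1 mulrDl mul1r; lra.
Qed.

Let del_ (j : nat) : R := j.+1%:R^-1.
Let m_ (j : nat) : nat := (j.+1 * j.+1)%N.

(** The mesh tends to 0 while the range of the staircase tends to infinity, so
    that [y = +oo] is reached too. *)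
Lemma stair_cvg y : 0 <= y ->
  (stair (del_ j) (m_ j) y)%:E @[j --> \oo] --> y.
Proof.
have d0 j : (0 < del_ j)%R by rewrite invr_gt0.
have md j : ((m_ j)%:R * del_ j = j.+1%:R)%R.
  by rewrite /m_ /del_ natrM mulfK.
case: y => [r r0| |]//; last first.
  move=> _; apply/cvgeyPge => A; near=> j.
  rewrite stair_full ?ltry// md lee_fin.
  apply: (@le_trans _ _ j%:R); last by rewrite ler_nat.
  by near: j; exact: nbhs_infty_ger.
apply: cvg_EFin; first by near=> j.
apply: (@squeeze_cvgr _ _ _ _ (fun j => r - del_ j)%R (cst r)).
- near=> j; apply/andP; split; last by rewrite -lee_fin stair_le.
  apply: stair_ge => //; rewrite -natr1 mulrDl md mul1r.
  apply: (@le_trans _ _ j%:R); first by near: j; exact: nbhs_infty_ger.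
  by rewrite -natr1 -addrA lerDl addr_ge0// ltW.
- rewrite -[X in _ --> X]subr0; apply: cvgB; first exact: cvg_cst.
  exact: cvg_harmonic.
- exact: cvg_cst.
Unshelve. all: by end_near. Qed.

Definition layer_sum del m (F : R -> R -> \bar R) : \bar R :=
  \sum_(i < m) \sum_(k < m) (del * del)%:E * F (i.+1%:R * del)%R (k.+1%:R * del)%R.

(** The double integral over the quadrant of a function that decreases in both
    variables, as a supremum of lower Riemann sums. *)
Definition layers (F : R -> R -> \bar R) : \bar R :=
  ereal_sup [set layer_sum p.1 p.2 F | p in [set p : R * nat | (0 < p.1)%R]].

Lemma layer_sum_le del m F G : (0 < del)%R ->
  (forall s t, (0 < s)%R -> (0 < t)%R -> F s t <= G s t) ->
  layer_sum del m F <= layer_sum del m G.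
Proof.
move=> d0 FG; apply: lee_sum => i _; apply: lee_sum => k _.
apply: lee_wpmul2l; first by rewrite lee_fin mulr_ge0// ltW.
by apply: FG; rewrite mulr_gt0.
Qed.

Lemma layer_sum_le_layers del m F : (0 < del)%R -> layer_sum del m F <= layers F.
Proof. by move=> d0; apply: ereal_sup_ubound; exists (del, m). Qed.

Lemma le_layers F G :
  (forall s t, (0 < s)%R -> (0 < t)%R -> F s t <= G s t) -> layers F <= layers G.
Proof.
move=> FG; apply: ge_ereal_sup => _ [[del m] /= d0 <-].
apply: le_trans (layer_sum_le_layers m G d0); exact: layer_sum_le.
Qed.

Lemma eq_layers F G :
  (forall s t, (0 < s)%R -> (0 < t)%R -> F s t = G s t) -> layers F = layers G.
Proof.
by move=> FG; apply/eqP; rewrite eq_le !le_layers// => s t s0 t0; rewrite FG.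
Qed.

(** The integral over the half-line of the product of two decreasing
    rearrangements, in layer cake form. It depends on the distribution
    functions only and so compares functions on different measure spaces. *)
Definition pairing e1 e2 : \bar R := layers (fun s t => mine (e1 s) (e2 t)).

Lemma le_pairing e1 e2 e1' e2' :
  (forall a, (0 < a)%R -> e1 a <= e1' a) -> (forall a, (0 < a)%R -> e2 a <= e2' a) ->
  pairing e1 e2 <= pairing e1' e2'.
Proof.
move=> h1 h2; apply: le_layers => s t s0 t0; rewrite le_min !ge_min.
by rewrite h1// h2// orbT.
Qed.

Lemma eq_pairing e1 e2 e1' e2' :
  (forall a, (0 < a)%R -> e1 a = e1' a) -> (forall a, (0 < a)%R -> e2 a = e2' a) ->
  pairing e1 e2 = pairing e1' e2'.
Proof. by move=> h1 h2; apply: eq_layers => s t s0 t0; rewrite h1// h2. Qed.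

Lemma pairing_ge0 e1 e2 : 0 <= pairing e1 e2.
Proof.
apply: le_trans (layer_sum_le_layers 0 _ (ltr01 : (0 < (1:R))%R)).
by rewrite /layer_sum big_ord0.
Qed.

Lemma pairingC e1 e2 : pairing e1 e2 = pairing e2 e1.
Proof.
rewrite /pairing /layers; congr ereal_sup; apply: eq_imagel => -[del m] /= _.
rewrite /layer_sum exchange_big /=; apply: eq_bigr => i _; apply: eq_bigr => k _.
by rewrite minC.
Qed.

End staircase.

Section layer_cake.
Context d (T : measurableType d) (R : realType).
Variables (mu : {measure set T -> \bar R}) (D : set T).
Hypothesis mD : measurable D.
Implicit Types (f g : T -> \bar R) (del s t : R).

Lemma measurable_stair del m f : (0 < del)%R -> measurable_fun D f ->
  measurable_fun D (fun x => stair del m (f x)).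
Proof.
move=> d0 mf; rewrite /stair; apply: measurable_sum => i.
apply: (@eq_measurable_fun _ _ _ _ _
  (fun x => \1_(D `&` [set x | ((i.+1%:R * del)%:E < f x)%E]) x * del)%R).
  move=> x; rewrite inE => Dx; rewrite indicE; case: ifPn => h.
    by rewrite mem_set ?mul1r.
  by rewrite memNset ?mul0r// => -[_ /=]; exact/negP.
apply: measurable_funM => //; apply: measurable_indic; exact: measurable_levelset.
Qed.

Lemma stairM_indic del m f g x : D x -> (0 < del)%R ->
  (stair del m (f x) * stair del m (g x))%:E =
  \sum_(i < m) \sum_(k < m) (del * del)%:E *
    (\1_((D `&` [set x | ((i.+1%:R * del)%:E < f x)%E]) `&`
         (D `&` [set x | ((k.+1%:R * del)%:E < g x)%E])) x)%:E.
Proof.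
move=> Dx d0; rewrite /stair mulr_suml -sumEFin; apply: eq_bigr => i _.
rewrite mulr_sumr -sumEFin; apply: eq_bigr => k _.
rewrite -EFinM indicE; congr EFin.
case: ifPn => hi; last first.
  by rewrite mul0r memNset ?mulr0// => -[[_ /= h] _]; rewrite h in hi.
case: ifPn => hk; last first.
  by rewrite mulr0 memNset ?mulr0// => -[_ [_ /= h]]; rewrite h in hk.
by rewrite mem_set ?mulr1.
Qed.

(** Both sides expand into the same combination of measures of intersections
    of level sets. *)
Lemma layer_sum_integral del m f g : (0 < del)%R ->
  measurable_fun D f -> measurable_fun D g ->
  layer_sum del m (fun s t => mu ((D `&` [set x | s%:E < f x]) `&`
                                 (D `&` [set x | t%:E < g x]))) =
  \int[mu]_(x in D) (stair del m (f x) * stair del m (g x))%:E.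
Proof.
move=> d0 mf mg; under [RHS]eq_integral => x Dx.
  rewrite stairM_indic//; last by rewrite inE in Dx.
  over.
have dd0 : (0 <= del * del)%R by rewrite mulr_ge0// ltW.
have mI i k : measurable ((D `&` [set x | ((i.+1%:R * del)%:E < f x)%E]) `&`
         (D `&` [set x | ((k.+1%:R * del)%:E < g x)%E])).
  by apply: measurableI; exact: measurable_levelset.
have mE i k : measurable_fun D (fun x => (del * del)%:E *
    (\1_((D `&` [set x | ((i.+1%:R * del)%:E < f x)%E]) `&`
         (D `&` [set x | ((k.+1%:R * del)%:E < g x)%E])) x)%:E).
  apply: emeasurable_funM => //; apply/measurable_EFinP.
  by apply: measurable_indic; exact: mI.
rewrite ge0_integral_sum//; last first.
- move=> i x _; apply: sume_ge0 => k _.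
  by rewrite -EFinM lee_fin mulr_ge0// indicE.
- by move=> i; apply: emeasurable_sum => k.
apply: eq_bigr => i _; rewrite ge0_integral_sum//; last first.
  by move=> k x _; rewrite -EFinM lee_fin mulr_ge0// indicE.
apply: eq_bigr => k _; rewrite ge0_integralZl//; last first.
- apply/measurable_EFinP; apply: measurable_indic; exact: mI.
rewrite integral_indic//; congr (_ * mu _); apply/esym/setIidl.
by move=> x [[]].
Qed.

(** Products of staircases lie below [f * g], and their integrals are Riemann
    sums; Fatou's lemma gives the converse inequality. *)
Lemma integral_layers f g : nonneg_measurable D f -> nonneg_measurable D g ->
  \int[mu]_(x in D) (f x * g x) =
  layers (fun s t => mu ((D `&` [set x | s%:E < f x]) `&`
                         (D `&` [set x | t%:E < g x]))).
Proof.
move=> [mf f0] [mg g0].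
have mst del m : (0 < del)%R ->
    measurable_fun D (fun x => (stair del m (f x) * stair del m (g x))%:E).
  move=> d0; apply/measurable_EFinP; apply: measurable_funM; exact: measurable_stair.
apply/eqP; rewrite eq_le; apply/andP; split; last first.
  apply: ge_ereal_sup => _ [[del m] /= d0 <-].
  rewrite layer_sum_integral//; apply: ge0_le_integral => //.
  - by move=> x _; rewrite lee_fin mulr_ge0// stair_ge0.
  - exact: mst.
  - exact: emeasurable_funM.
  - move=> x Dx; rewrite EFinM; apply: lee_pmul; rewrite ?lee_fin ?stair_ge0//.
      by apply: stair_le => //; exact: f0.
    by apply: stair_le => //; exact: g0.
pose dl j : R := (j.+1%:R^-1)%R; pose ml j := (j.+1 * j.+1)%N.
have d0 j : (0 < dl j)%R by rewrite invr_gt0.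
pose h j x := (stair (dl j) (ml j) (f x) * stair (dl j) (ml j) (g x))%:E.
have hc x : D x -> h j x @[j --> \oo] --> f x * g x.
  move=> Dx; rewrite /h; under eq_fun do rewrite EFinM.
  have z0 y m del : (0 < del)%R -> y = 0 -> (stair del m y)%:E = 0 :> \bar R.
    move=> dl0 ->; apply/eqP; rewrite eq_le stair_le// lee_fin stair_ge0//.
  (* zeros are treated apart because the product is not continuous at (0, +oo) *)
  have [fx0|fx0] := eqVneq (f x) 0.
    rewrite fx0 mul0e; under eq_fun do rewrite z0// mul0e; exact: cvg_cst.
  have [gx0|gx0] := eqVneq (g x) 0.
    rewrite gx0 mule0; under eq_fun do rewrite (z0 0)// mule0; exact: cvg_cst.
  apply: cvgeM; last 2 first.
  - by apply: stair_cvg; exact: f0.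
  - by apply: stair_cvg; exact: g0.
  by apply: neq0_mule_def; rewrite mule_eq0 negb_or fx0.
rewrite (eq_integral (fun x => limn_einf (h ^~ x))); last first.
  by move=> x; rewrite inE => Dx; rewrite (cvg_limn_einf_sup (hc x Dx)).1.
apply: le_trans (fatou _ mD _ _) _.
- by move=> j; exact: mst.
- by move=> j x _; rewrite lee_fin mulr_ge0// stair_ge0.
rewrite limn_einf_lim; apply: lime_le; first exact: is_cvg_einfs.
apply: nearW => n; apply: le_trans (ereal_inf_lbound _) _; first by exists n => //=.
by rewrite -layer_sum_integral//; exact: layer_sum_le_layers.
Qed.

(** Hardy-Littlewood inequality: an intersection of two level sets has at most
    the measure of either. *)
Lemma integral_le_pairing f g : nonneg_measurable D f -> nonneg_measurable D g ->
  \int[mu]_(x in D) (f x * g x) <= pairing (dist mu D f) (dist mu D g).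
Proof.
move=> hf hg; rewrite integral_layers//; apply: le_layers => s t _ _.
have [mf _] := hf; have [mg _] := hg.
rewrite le_min; apply/andP; split; apply: le_measure; rewrite ?inE;
  do ?[apply: measurableI; exact: measurable_levelset|exact: measurable_levelset].
- exact: subIsetl.
- exact: subIsetr.
Qed.

(** When the level sets are nested, the intersection of two of them is the one
    of smaller measure. *)
Lemma integral_comonotone f g : nonneg_measurable D f -> nonneg_measurable D g ->
  (forall s t : R, (0 < s)%R -> (0 < t)%R ->
    D `&` [set x | s%:E < f x] `<=` [set x | t%:E < g x] \/
    D `&` [set x | t%:E < g x] `<=` [set x | s%:E < f x]) ->
  \int[mu]_(x in D) (f x * g x) = pairing (dist mu D f) (dist mu D g).
Proof.
move=> hf hg fg; rewrite integral_layers//; apply: eq_layers => s t s0 t0.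
have [mf _] := hf; have [mg _] := hg.
have mfs := measurable_levelset mD s mf; have mgt := measurable_levelset mD t mg.
have [h|h] := fg s t s0 t0.
  rewrite setIidl; last by move=> x [Dx /= sx]; split => //; exact: h.
  by rewrite min_l//; apply: le_measure; rewrite ?inE// => x [Dx /= sx]; split => //; exact: h.
rewrite setIidr; last by move=> x [Dx /= sx]; split => //; exact: h.
by rewrite min_r//; apply: le_measure; rewrite ?inE// => x [Dx /= sx]; split => //; exact: h.
Qed.

End layer_cake.

Lemma comonotone_along d (T : measurableType d) (R : realType) (D : set T) (tau : T -> R)
    (f g : T -> \bar R) :
  (forall x y, D x -> D y -> (tau x <= tau y)%R -> f y <= f x) ->
  (forall x y, D x -> D y -> (tau x <= tau y)%R -> g y <= g x) ->
  forall s t : R, (0 < s)%R -> (0 < t)%R ->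
    D `&` [set x | s%:E < f x] `<=` [set x | t%:E < g x] \/
    D `&` [set x | t%:E < g x] `<=` [set x | s%:E < f x].
Proof.
move=> hf hg s t _ _; have [h|h] := pselect (D `&` [set x | s%:E < f x] `<=` [set x | t%:E < g x]).
  by left.
right=> y [Dy /= ty]; apply: contrapT => /negP; rewrite -leNgt => fy; apply: h => x [Dx /= sx].
have [xy|yx] := leP (tau x) (tau y); first exact: lt_le_trans ty (hg _ _ Dx Dy xy).
by move: (le_lt_trans (hf _ _ Dy Dx (ltW yx)) (le_lt_trans fy sx)); rewrite ltxx.
Qed.

(** * Uniform coordinates *)

Lemma nondecreasing_cvgeE (R : realType) (u : (\bar R)^nat) (l : \bar R) :
  nondecreasing_seq u -> u n @[n --> \oo] --> l -> l = ereal_sup (range u).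
Proof.
move=> nu ul; have /cvg_lim <-// := ul.
by apply/cvg_lim => //; exact: ereal_nondecreasing_cvgn.
Qed.

Lemma min_cvg_nondecreasing (R : realType) (c l : \bar R) (b : (\bar R)^nat) :
  nondecreasing_seq b -> b n @[n --> \oo] --> l ->
  mine c (b n) @[n --> \oo] --> mine c l.
Proof.
move=> nb bl.
rewrite (nondecreasing_cvgeE nb bl).
suff -> : mine c (ereal_sup (range b)) = ereal_sup (range (fun n => mine c (b n))).
  apply: ereal_nondecreasing_cvgn => m n mn.
  by rewrite le_min ge_min lexx/= ge_min (nb m n mn) orbT.
apply/eqP; rewrite eq_le; apply/andP; split; last first.
  apply: ge_ereal_sup => _ [n _ <-]; rewrite le_min ge_min lexx/= ge_min.
  by rewrite [X in _ || X]ereal_sup_ubound ?orbT//; exists n.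
rewrite leNgt; apply/negP; rewrite lt_min => /andP[h1 /ereal_sup_gt[_ [n _ <-] h2]].
have : ereal_sup (range (fun n => mine c (b n))) < mine c (b n) by rewrite lt_min h1.
by apply/negP; rewrite -leNgt; apply: ereal_sup_ubound; exists n.
Qed.

Section uniform_coordinate.
Context d (T : measurableType d) (R : realType).
Variables (mu : {measure set T -> \bar R}) (D : set T).
Hypothesis mD : measurable D.
Implicit Types (f g : T -> \bar R) (s t a c r : R) (tau : T -> R) (e : R -> \bar R).

(** The level sets of [tau] are distributed as on the half-line, so that
    functions on [D] can be rearranged into functions of [tau]. *)
Definition ucoord tau := [/\ measurable_fun D tau, forall x, D x -> (0 <= tau x)%R &
  forall s, (0 <= s)%R -> mu (D `&` [set x | (tau x < s)%R]) = s%:E].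

(** The upper level sets of [G] are intervals. *)
Lemma measurable_nincr_comp tau (G : R -> \bar R) : measurable_fun D tau ->
  (forall x, D x -> (0 <= tau x)%R) ->
  (forall s t, (0 <= s)%R -> (s <= t)%R -> G t <= G s) ->
  measurable_fun D (fun x => G (tau x)).
Proof.
move=> mtau tau0 nG.
apply: (measurability _ (ErealGenOInfty.measurableE R)) => _ [_ [a ->] <-].
pose S := [set t | (0 <= t)%R /\ a%:E < G t].
have mS : measurable (S : set R).
  apply: is_interval_measurable => x y [x0 ax] [y0 ay] z /andP[xz zy].
  split; first exact: le_trans xz.
  by apply: lt_le_trans ay _; apply: nG => //; exact: le_trans xz.
suff -> : D `&` (fun x => G (tau x)) @^-1` `]a%:E, +oo[ = D `&` tau @^-1` S.
  exact: mtau.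
apply/seteqP; split => x /= [Dx]; rewrite in_itv/= andbT => h; split => //.
  by split => //; exact: tau0.
by case: h.
Qed.

Section with_coordinate.
Variable tau : T -> R.
Hypothesis htau : ucoord tau.

Let mtau : measurable_fun D tau. Proof. by case: htau. Qed.
Let tau0 x : D x -> (0 <= tau x)%R. Proof. by case: htau => _ + _; exact. Qed.

Lemma measurable_ucoord_lt s : measurable (D `&` [set x | (tau x < s)%R]).
Proof.
rewrite (_ : [set x | _] = tau @^-1` `]-oo, s[%classic); first exact: mtau.
by apply/seteqP; split => x /=; rewrite in_itv.
Qed.

Lemma measurable_ucoord_le s : measurable (D `&` [set x | (tau x <= s)%R]).
Proof.
rewrite (_ : [set x | _] = tau @^-1` `]-oo, s]%classic); first exact: mtau.
by apply/seteqP; split => x /=; rewrite in_itv.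
Qed.

Lemma measurable_ucoord_eq s : measurable (D `&` [set x | tau x = s]).
Proof.
rewrite (_ : [set x | _] = tau @^-1` [set s]); first exact: mtau.
by [].
Qed.

Lemma ucoordE s : (0 <= s)%R -> mu (D `&` [set x | (tau x < s)%R]) = s%:E.
Proof. by case: htau => _ _; exact. Qed.

Lemma ucoord_infinite : mu D = +oo.
Proof.
apply/eqP; rewrite eq_le leey/= leNgt; apply/negP => h.
have [r r0 /andP[h1 _]] := lte_real_between (measure_ge0 mu D) h.
have : mu (D `&` [set x | (tau x < r + 1)%R]) <= mu D.
  apply: le_measure; rewrite ?inE//; exact: measurable_ucoord_lt.
rewrite ucoordE; last by rewrite addr_ge0// ltW.
by move=> /le_trans => /(_ _ h1); rewrite lee_fin gerDl ler10.
Qed.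

Lemma ucoord_lt (y : \bar R) : 0 <= y -> mu (D `&` [set x | (tau x)%:E < y]) = y.
Proof.
case: y => [s| |]//; first by rewrite lee_fin => /ucoordE.
move=> _; rewrite (_ : _ `&` _ = D) ?ucoord_infinite//.
by apply/seteqP; split => x; [case|move=> Dx; split => //=; exact: ltry].
Qed.

Lemma ucoord_le s : (0 <= s)%R -> mu (D `&` [set x | (tau x <= s)%R]) = s%:E.
Proof.
move=> s0; apply/eqP; rewrite eq_le; apply/andP; split.
  apply/lee_addgt0Pr => r r0; rewrite -EFinD -[leRHS]ucoordE; last by rewrite addr_ge0// ltW.
  apply: le_measure; rewrite ?inE;
    [exact: measurable_ucoord_le|exact: measurable_ucoord_lt|].
  by move=> x [Dx /= h]; split => //=; rewrite (le_lt_trans h)// ltrDl.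
rewrite -[leLHS]ucoordE//; apply: le_measure; rewrite ?inE;
    [exact: measurable_ucoord_lt|exact: measurable_ucoord_le|].
by move=> x [Dx /= h]; split => //=; exact: ltW.
Qed.

Lemma ucoord_eq s : mu (D `&` [set x | tau x = s]) = 0.
Proof.
have [s0|s0] := ltP s 0%R.
  rewrite (_ : _ `&` _ = set0) ?measure0//; apply/seteqP; split => // x [Dx /= xs].
  by have := tau0 Dx; rewrite xs leNgt s0.
have := ucoord_le s0.
rewrite (_ : _ `&` _ = (D `&` [set x | (tau x < s)%R]) `|` (D `&` [set x | tau x = s])).
  rewrite measureU//.
  - rewrite [X in X + _ = _]ucoordE// => /(congr1 (fun y => y - s%:E)).
    by rewrite addeAC -EFinB subrr add0e.
  - exact: measurable_ucoord_lt.
  - exact: measurable_ucoord_eq.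
  - by apply/seteqP; split => // x [[_ /= h1] [_ /= h2]]; rewrite h2 ltxx in h1.
apply/seteqP; split => [x [Dx /=]|x [] [Dx /= h]].
- by rewrite le_eqVlt => /predU1P[h|h]; [right|left].
- by split => //=; exact: ltW.
- by split => //=; rewrite h.
Qed.

(** The level set of [rea e \o tau] at [a] is the sublevel set of [tau] at [e
    a]. *)
Lemma dist_rea e : is_dist e -> forall a, (0 <= a)%R ->
  dist mu D (fun x => rea e (tau x)) a = e a.
Proof.
move=> he a a0; rewrite /dist (_ : _ `&` _ = D `&` [set x | (tau x)%:E < e a]).
  by rewrite ucoord_lt//; exact: is_dist_ge0.
by apply/seteqP; split => x [Dx /=]; rewrite rea_lt.
Qed.

Lemma nonneg_measurable_rea e : nonneg_measurable D (fun x => rea e (tau x)).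
Proof.
split; last by move=> x _; exact: rea_ge0.
by apply: measurable_nincr_comp => // s t _; exact: rea_nincr.
Qed.

End with_coordinate.

(** The new coordinate of [x] is the measure of the set where [psi] exceeds
    [psi x]. Since the level sets of [psi] are negligible, its distribution
    function is continuous and takes every value [s], at a level [c] after
    which it is smaller than [s]. *)
Lemma ucoord_of_fun (psi : T -> R) (M : R) : measurable_fun D psi ->
  (forall x, D x -> (0 < psi x <= M)%R) -> mu D = +oo ->
  (forall c, (0 < c)%R -> dist mu D (EFin \o psi) c < +oo) ->
  (forall c, mu (D `&` [set x | psi x = c]) = 0) ->
  ucoord (fun x => fine (dist mu D (EFin \o psi) (psi x))).
Proof.
move=> mpsi psiM muD fpsi npsi.
have mE : measurable_fun D (EFin \o psi) by apply/measurable_EFinP.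
set dd := dist mu D (EFin \o psi).
have ddd : is_dist dd by exact: dist_is_dist.
have [dd0 ddn ddr] := ddd.
have psi0 x : D x -> (0 <= psi x)%R by move=> /psiM/andP[/ltW].
have key s : (0 < s)%R -> exists c, [/\ (0 < c)%R, dd c = s%:E &
    forall c', (c < c')%R -> dd c' < s%:E].
  move=> s0; pose S := [set c | (0 < c)%R /\ dd c < s%:E].
  have Sn0 : S !=set0.
    exists (Num.max M 1%R); split; first by rewrite lt_max ltr01 orbT.
    rewrite /dd /dist (_ : _ `&` _ = set0) ?measure0//.
    apply/seteqP; split => // x [Dx /=]; rewrite lte_fin gt_max => /andP[h _].
    by have /andP[_] := psiM x Dx; rewrite leNgt h.
  have lS : has_lbound S by exists 0%R => c [/ltW].
  have hlt c' : (inf S < c')%R -> dd c' < s%:E.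
    move=> /(inf_lt Sn0)[r [r0 rs] rc]; apply: le_lt_trans rs.
    by apply: ddn; exact: ltW.
  have [n0 dn] : exists n, s%:E <= dd (n.+1%:R^-1)%R.
    pose F n := D `&` [set x | ((n.+1%:R^-1)%:E < (EFin \o psi) x)%E].
    have mF n : measurable (F n) by exact: measurable_levelset.
    have UF : \bigcup_n F n = D.
      apply/seteqP; split => [x [n _ []]//|x Dx].
      have /andP[px _] := psiM x Dx.
      have [n] := near_infty_natSinv_lt (PosNum px).
      by move=> _ /(_ n (leqnn n)) /= h; exists n => //; split => //=; rewrite lte_fin.
    have ndF : {homo F : n m / (n <= m)%N >-> (n <= m)%O}.
      move=> n m nm; apply/subsetPset => x [Dx /= h']; split => //=.
      by apply: le_lt_trans h'; rewrite lee_fin lef_pV2 ?posrE// ler_nat.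
    have := @nondecreasing_cvg_mu _ _ _ mu F mF.
    rewrite UF muD => /(_ mD ndF) /cvgeyPge /(_ s) [n _ /(_ n (leqnn n))] /= h.
    by exists n.
  have inf0 : (0 < inf S)%R.
    apply: (@lt_le_trans _ _ (n0.+1%:R^-1)%R); first by rewrite invr_gt0.
    apply: lb_le_inf => // c [c0 cs]; rewrite leNgt; apply/negP => cn.
    have : dd n0.+1%:R^-1%R <= dd c by apply: ddn; exact: ltW.
    by move=> h; have := le_lt_trans (le_trans dn h) cs; rewrite ltxx.
  (* inf S is the last level at which the distribution function reaches s *)
  exists (inf S); split=> //; apply/eqP; rewrite eq_le; apply/andP; split.
    by apply: ddr; [exact: ltW|move=> b /hlt/ltW].
  set c := inf S in inf0 hlt *.
  have hge c' : (0 < c')%R -> (c' < c)%R -> s%:E <= dd c'.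
    move=> c'0 c'c; rewrite leNgt; apply/negP => h.
    have : (c <= c')%R by apply: ge_inf.
    by rewrite leNgt c'c.
  (* approaching c from below uses that the level set of psi at c is negligible *)
  pose cn n : R := (c * (1 - n.+2%:R^-1))%R.
  have cn0 n : (0 < cn n)%R.
    by rewrite mulr_gt0// subr_gt0 invf_lt1// ltr1n.
  have cnc n : (cn n < c)%R.
    by rewrite /cn gtr_pMr// gtrBl invr_gt0.
  pose F n := D `&` [set x | ((cn n)%:E < (EFin \o psi) x)%E].
  have mF n : measurable (F n) by exact: measurable_levelset.
  have IF : \bigcap_n F n = (D `&` [set x | (c%:E < (EFin \o psi) x)%E]) `|`
      (D `&` [set x | psi x = c]).
    apply/seteqP; split => [x h|x [] [Dx /= h] n _].
    - have [Dx _] := h 0%N I.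
      have : (c <= psi x)%R.
        rewrite leNgt; apply/negP => pc.
        have e0 : (0 < 1 - psi x / c)%R by rewrite subr_gt0 ltr_pdivrMr// mul1r.
        have [n] := near_infty_natSinv_lt (PosNum e0).
        move=> _ /(_ n.+1 (leqnSn n)) /= h1; have [_ /=] := h n I.
        rewrite lte_fin => h2; move: h1; rewrite ltrBrDl -ltrBrDr ltr_pdivrMr//.
        by rewrite mulrC => h1; have := lt_trans h1 h2; rewrite ltxx.
      by rewrite le_eqVlt => /predU1P[h1|h1]; [right|left].
    - by split => //=; apply: lt_trans h; rewrite lte_fin.
    - by split => //=; rewrite h lte_fin.
  have meq : measurable (D `&` [set x | psi x = c]).
    by rewrite (_ : [set x | _] = psi @^-1` [set c])//; exact: mpsi.
  have mIF : measurable (\bigcap_n F n) by exact: bigcapT_measurable.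
  have niF : {homo F : n m / (n <= m)%N >-> (m <= n)%O}.
    move=> n m nm; apply/subsetPset => x [Dx /= h']; split => //=.
    apply: le_lt_trans h'; rewrite lee_fin /cn ler_pM2l// lerB//.
    by rewrite lef_pV2 ?posrE// ler_nat.
  have cF := nonincreasing_cvg_mu (fpsi (cn 0%N) (cn0 0%N)) mF mIF niF.
  have -> : dd c = mu (\bigcap_n F n).
    rewrite IF measureU//.
    - by rewrite [X in _ = _ + X]npsi adde0.
    - exact: measurable_levelset.
    - apply/seteqP; split => // x [[_ /= h1] [_ /= h2]].
      by rewrite lte_fin h2 ltxx in h1.
  have /cvg_lim <-// := cF.
  apply: lime_ge; first by apply/cvg_ex; eexists; exact: cF.
  by apply: nearW => n; exact: hge.
split.
- apply: (measurable_comp measurableT) => //; last exact: measurable_nincr_comp.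
- by move=> x Dx; rewrite fine_ge0// dd0// psi0.
- move=> s; rewrite le_eqVlt => /predU1P[<-|s0].
    rewrite (_ : _ `&` _ = set0) ?measure0//; apply/seteqP; split => // x [Dx /=].
    by apply/negP; rewrite -leNgt fine_ge0// dd0// psi0.
  have [c [c0 dc hc]] := key s s0.
  rewrite -dc; congr (mu _); apply/seteqP; split => x [Dx /=].
    have /andP[px _] := psiM x Dx.
    have fd : dd (psi x) \is a fin_num.
      by rewrite ge0_fin_numE ?fpsi// dd0// ltW.
    rewrite -lte_fin fineK// => h; split => //=; rewrite ltNge; apply/negP.
    rewrite lee_fin => pc; have := ddn _ _ (ltW px) pc.
    by rewrite dc leNgt h.
  have /andP[px _] := psiM x Dx.
  have fd : dd (psi x) \is a fin_num.
    by rewrite ge0_fin_numE ?fpsi// dd0// ltW.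
  by rewrite lte_fin => h; split => //=; rewrite -lte_fin fineK//; exact: hc.
Qed.

End uniform_coordinate.

(** * Resonance *)

Section resonance.
Context d (T : measurableType d) (R : realType).
Variables (mu : {measure set T -> \bar R}) (D : set T).
Hypothesis mD : measurable D.
Variable tau : T -> R.
Hypothesis htau : ucoord mu D tau.
Implicit Types (f phi : T -> \bar R) (s t a c r : R) (e : R -> \bar R).

Let mtau : measurable_fun D tau. Proof. by case: htau. Qed.
Let tau0 x : D x -> (0 <= tau x)%R. Proof. by case: htau => _ + _; exact. Qed.

(** The truncation by [tau x < r] gives the level sets finite measure. *)
Let trunc phi r t := D `&` [set x | t%:E < phi x /\ (tau x < r)%R].

Let measurable_trunc phi r t : measurable_fun D phi -> measurable (trunc phi r t).
Proof.
move=> mphi; rewrite (_ : trunc _ _ _ =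
  (D `&` [set x | t%:E < phi x]) `&` (D `&` [set x | (tau x < r)%R])).
  by apply: measurableI; [exact: measurable_levelset|exact: (measurable_ucoord_lt mD htau)].
by apply/seteqP; split => [x [Dx [h1 h2]]|x [[Dx h1] [_ h2]]].
Qed.

(** Ordering the points by the number [cnt] of truncated level sets that
    contain them makes each of these sets an initial segment. The summand [(1
    + tau x)^-1] breaks the ties, so that [psi] has negligible level sets. *)
Lemma sorting_ucoord phi del m r : measurable_fun D phi -> (0 < del)%R ->
  exists2 theta, ucoord mu D theta &
  forall k, (k < m)%N -> let E := trunc phi r (k.+1%:R * del) in
    D `&` [set x | (theta x)%:E < mu E] `<=` E.
Proof.
move=> mphi d0.
pose above_ (k : nat) x := (((k.+1%:R * del)%:E < phi x) && (tau x < r)%R : bool).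
pose cnt x := (\sum_(k < m) (above_ k x : nat))%N.
pose psi x : R := ((cnt x)%:R + (1 + tau x)^-1)%R.
have above_anti k l x : (k <= l)%N -> above_ l x -> above_ k x.
  move=> kl /andP[h1 h2]; rewrite /above_ h2 andbT (le_lt_trans _ h1)//.
  by rewrite lee_fin ler_pM2r// ler_nat.
have cnt_gt k x : (k < m)%N -> above_ k x -> (k < cnt x)%N.
  move=> km hk; rewrite /cnt -(subnKC km) big_split_ord /= -[(k < _)%N]/(k.+1 <= _)%N.
  apply: leq_trans (leq_addr _ _); rewrite -[leqLHS]muln1 -[k.+1 in leqLHS]card_ord -sum_nat_const.
  by apply: leq_sum => i _; rewrite (@above_anti i k)// -ltnS.
have cnt_le k x : ~~ above_ k x -> (cnt x <= k)%N.
  move=> hk; rewrite /cnt; have [mk|km] := leqP m k.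
    apply: leq_trans mk; rewrite -[leqRHS]muln1 -[m in leqRHS]card_ord -sum_nat_const.
    by apply: leq_sum => i _; exact: leq_b1.
  rewrite -(subnKC (ltnW km)) big_split_ord /= [X in (_ + X)%N]big1 ?addn0.
    rewrite -[leqRHS]muln1 -[k in leqRHS]card_ord -sum_nat_const.
    by apply: leq_sum => i _; exact: leq_b1.
  move=> i _; apply/eqP; rewrite eqb0; apply: contra hk; apply: above_anti.
  exact: leq_addr.
have eta01 x : D x -> (0 < (1 + tau x)^-1 <= 1)%R.
  move=> /tau0 tx; have : (0 < 1 + tau x)%R by rewrite ltr_wpDr.
  by move=> h; rewrite invr_gt0 h/= invf_le1// lerDl.
have mcnt : measurable_fun D (fun x => (cnt x)%:R : R).
  rewrite (_ : (fun x => _) = (fun x => \sum_(k < m) (above_ k x)%:R)%R); last first.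
    by apply/funext => x; rewrite natr_sum.
  apply: measurable_sum => k.
  apply: (@eq_measurable_fun _ _ _ _ _ (fun x => \1_(trunc phi r (k.+1%:R * del)%R) x : R)).
    move=> x; rewrite inE => Dx; rewrite indicE; congr (_%:R); congr nat_of_bool.
    apply/idP/idP => [|/andP[h1 h2]]; last by rewrite inE.
    by rewrite inE => -[_ [h1 h2]]; rewrite /above_ h1 h2.
  by apply: measurable_indic; exact: measurable_trunc.
have mpsi : measurable_fun D psi.
  apply: measurable_funD => //.
  apply/measurable_EFinP.
  apply: (@measurable_nincr_comp _ _ _ D mD tau (fun t => ((1 + t)^-1)%:E)) => //.
  by move=> a b a0 ab; rewrite lee_fin lef_pV2 ?posrE ?lerD2l//; lra.
have psi_bd x : D x -> (0 < psi x <= m.+1%:R)%R.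
  move=> Dx; have /andP[h1 h2] := eta01 x Dx; rewrite /psi ltr_wpDl//=.
  rewrite -natr1 lerD// ler_nat /cnt.
  rewrite -[leqRHS]muln1 -[m in leqRHS]card_ord -sum_nat_const.
  by apply: leq_sum => i _; exact: leq_b1.
have muD : mu D = +oo := ucoord_infinite mD htau.
have mE : measurable_fun D (EFin \o psi) by apply/measurable_EFinP.
have fpsi c : (0 < c)%R -> dist mu D (EFin \o psi) c < +oo.
  move=> c0; have r0 : (0 <= `|r| + c^-1)%R by rewrite addr_ge0// invr_ge0 ltW.
  apply: le_lt_trans (ltry (`|r| + c^-1)%R).
  rewrite -(ucoordE htau r0); apply: le_measure; rewrite ?inE.
  - exact: measurable_levelset.
  - exact: (measurable_ucoord_lt mD htau).
  move=> x [Dx /=]; rewrite lte_fin => cpsi; split => //=.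
  have [tr|rt] := ltP (tau x) r.
    apply: lt_le_trans tr _; rewrite (le_trans (ler_norm r))// lerDl invr_ge0.
    exact: ltW.
  have cnt0 : cnt x = 0%N.
    by apply/eqP; rewrite -leqn0; apply: cnt_le; rewrite /above_ [X in _ && X]ltNge rt andbF.
  move: cpsi; rewrite /psi cnt0 add0r => cpsi.
  have tx := tau0 Dx.
  have h : (1 + tau x < c^-1)%R.
    by rewrite -[ltLHS]invrK ltf_pV2// posrE// invr_gt0; lra.
  by have := normr_ge0 r; lra.
have npsi c : mu (D `&` [set x | psi x = c]) = 0.
  apply: measure_negligible.
    by rewrite (_ : [set x | _] = psi @^-1` [set c])//; exact: mpsi.
  apply: (@negligibleS _ _ _ _
      (\bigcup_j (D `&` [set x | tau x = ((c - j%:R)^-1 - 1)%R]))).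
    move=> x [Dx /= psic]; exists (cnt x) => //; split => //=.
    by rewrite -psic /psi addrAC subrr add0r invrK addrAC subrr add0r.
  apply: negligible_bigcup => j; apply/negligibleP; last exact: (ucoord_eq mD htau).
  exact: (measurable_ucoord_eq mD htau).
have htheta := ucoord_of_fun mD mpsi psi_bd muD fpsi npsi.
exists (fun x => fine (dist mu D (EFin \o psi) (psi x))) => //.
move=> k km /= x [Dx /=].
have [psi0 _] := andP (psi_bd x Dx).
rewrite fineK; last first.
  by rewrite ge0_fin_numE ?fpsi//; exact: measure_ge0.
apply: contraPP => nEx; apply/negP; rewrite -leNgt.
have /negP nx : ~ above_ k x.
  by move=> /andP[h1 h2]; apply: nEx.
have : dist mu D (EFin \o psi) k.+1%:R <= dist mu D (EFin \o psi) (psi x).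
  have [_ nd _] := dist_is_dist mu mD mE; apply: nd; first exact: ltW.
  have /andP[_ h] := eta01 x Dx.
  by rewrite /psi -natr1 lerD// ler_nat cnt_le.
apply: le_trans; apply: le_measure; rewrite ?inE.
- exact: measurable_trunc.
- exact: measurable_levelset.
move=> y [Dy [h1 h2]]; split => //=; rewrite lte_fin /psi.
have /andP[e0 _] := eta01 y Dy.
have : (k < cnt y)%N by apply: cnt_gt => //; rewrite /above_ h1.
by rewrite -(ler_nat R) => h; rewrite (le_lt_trans h)// ltrDl.
Qed.

(** For a given Riemann sum let [h] decrease along a coordinate that sorts the
    level sets of [phi] that occur in the sum: the level sets of [h] and [phi]
    are then nested. The truncation is removed by monotone convergence. *)
Lemma pairing_le_sup e phi : is_dist e -> nonneg_measurable D phi ->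
  pairing e (dist mu D phi) <=
  ereal_sup [set \int[mu]_(x in D) (h x * phi x) | h in
    [set h | nonneg_measurable D h /\
             forall a, (0 <= a)%R -> dist mu D h a = e a]].
Proof.
move=> de [mphi phi0]; apply: ge_ereal_sup => _ [[del m] /= d0 <-].
pose F n s t := mine (e s) (mu (trunc phi n%:R t)).
have FF n : layer_sum del m (F n) <= ereal_sup [set \int[mu]_(x in D) (h x * phi x) | h in
    [set h | nonneg_measurable D h /\
             forall a, (0 <= a)%R -> dist mu D h a = e a]].
  have [theta htheta sub] := sorting_ucoord m n%:R mphi d0.
  pose h x := rea e (theta x).
  have hh : nonneg_measurable D h by exact: (nonneg_measurable_rea mD htheta).
  have he a : (0 <= a)%R -> dist mu D h a = e a by exact: (dist_rea mD htheta).
  have : \int[mu]_(x in D) (h x * phi x) <= ereal_sup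
      [set \int[mu]_(x in D) (h x * phi x) | h in
      [set h | nonneg_measurable D h /\
             forall a, (0 <= a)%R -> dist mu D h a = e a]].
    by apply: ereal_sup_ubound; exists h.
  apply: le_trans; rewrite integral_layers//.
  apply: le_trans (layer_sum_le_layers m _ d0).
  apply: lee_sum => i _; apply: lee_sum => k _.
  apply: lee_wpmul2l; first by rewrite lee_fin mulr_ge0// ltW.
  have s0 : (0 <= i.+1%:R * del)%R by rewrite mulr_ge0// ltW.
  rewrite /F -[leLHS](ucoord_lt mD htheta); last first.
    by rewrite le_min measure_ge0 andbT; exact: is_dist_ge0.
  have [mh _] := hh.
  apply: le_measure; rewrite ?inE.
  - rewrite (_ : [set x | _] = theta @^-1` [set r | r%:E <
        mine (e (i.+1%:R * del)%R) (mu (trunc phi n%:R (k.+1%:R * del)))])//.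
    have [mtheta _ _] := htheta; apply: mtheta => //.
    apply: is_interval_measurable => x y /= _ hy z /andP[_ zy].
    by apply: le_lt_trans hy; rewrite lee_fin.
  - by apply: measurableI; exact: measurable_levelset.
  move=> x [Dx /=]; rewrite lt_min => /andP[h1 h2]; split.
    by split => //=; rewrite rea_lt.
  by have [_ []] := sub k (ltn_ord k) x (conj Dx h2).
have cF : layer_sum del m (F n) @[n --> \oo] -->
    layer_sum del m (fun s t => mine (e s) (dist mu D phi t)).
  have F0 n i k : 0 <= (del * del)%:E * F n (i.+1%:R * del)%R (k.+1%:R * del)%R.
    rewrite mule_ge0//; first by rewrite lee_fin mulr_ge0// ltW.
    rewrite le_min measure_ge0 andbT; apply: is_dist_ge0 => //.
    by rewrite mulr_ge0// ltW.
  apply: cvg_nnesum => i _.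
    by apply: nearW => n; apply: sume_ge0.
  apply: cvg_nnesum => k _; first by apply: nearW.
  apply: cvgeZl => //; apply: min_cvg_nondecreasing.
    move=> n n' nn'; apply: le_measure; rewrite ?inE; try exact: measurable_trunc.
    move=> x [Dx [h1 h2]]; split => //; split => //; apply: lt_le_trans h2 _.
    by rewrite ler_nat.
  set t := (k.+1%:R * del)%R.
  have UE : \bigcup_n trunc phi n%:R t = D `&` [set x | t%:E < phi x].
    apply/seteqP; split => [x [n _ [Dx [h1 _]]]//|x [Dx /= h]].
    exists (Num.bound (tau x)) => //; split => //; split => //=.
    by apply: archi_boundP; exact: tau0.
  rewrite /dist -UE; apply: nondecreasing_cvg_mu.
  - by move=> n; exact: measurable_trunc.
  - by rewrite UE; exact: measurable_levelset.
  - move=> n n' nn'; apply/subsetPset => x [Dx [h1 h2]]; split => //; split => //.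
    by apply: lt_le_trans h2 _; rewrite ler_nat.
have /cvg_lim <-// := cF; apply: lime_le; first by apply/cvg_ex; eexists; exact: cF.
exact: nearW.
Qed.

(** The Hardy-Littlewood bound is the best one for all functions
    equimeasurable with a given one, even when it is not attained. *)
Lemma resonance e phi : is_dist e -> nonneg_measurable D phi ->
  ereal_sup [set \int[mu]_(x in D) (h x * phi x) | h in
    [set h | nonneg_measurable D h /\
             forall a, (0 <= a)%R -> dist mu D h a = e a]] =
  pairing e (dist mu D phi).
Proof.
move=> de hphi; apply/eqP; rewrite eq_le pairing_le_sup// andbT.
apply: ge_ereal_sup => _ [h [hh he] <-].
apply: le_trans (integral_le_pairing mu mD hh hphi) _; apply: le_pairing => // a a0.
by rewrite he// ltW.
Qed.

End resonance.

(** * Norms given by a set of distribution functions *)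

Section pairing_norm.
Context d (T : measurableType d) (R : realType).
Variables (mu : {measure set T -> \bar R}) (D : set T).
Hypothesis mD : measurable D.
Variable tau : T -> R.
Hypothesis htau : ucoord mu D tau.
Implicit Types (f g : T -> \bar R) (s t a c r l : R) (e w : R -> \bar R) (m : \bar R).

(** The distribution function of [c] times the indicator of a set of measure
    [m]. *)
Definition box m c : R -> \bar R := fun a => if (a < c)%R then m else 0.

Lemma dist_indic (E : set T) c a : E `<=` D -> (0 <= a)%R ->
  dist mu D (fun x => (c * \1_E x)%:E) a = box (mu E) c a.
Proof.
move=> ED a0; rewrite /box; case: ifPn => ac; last first.
  rewrite /dist (_ : _ `&` _ = set0) ?measure0//.
  apply/seteqP; split => // x [_ /=]; rewrite lte_fin indicE.
  case: (_ \in _); rewrite ?mulr1 ?mulr0 => h; first by rewrite h in ac.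
  by have := lt_le_trans h a0; rewrite ltxx.
congr (mu _); apply/seteqP; split => x /=.
  move=> [_]; rewrite lte_fin indicE; case: (boolP (_ \in _)); first by rewrite inE.
  by rewrite mulr0 => _ /lt_le_trans/(_ a0); rewrite ltxx.
by move=> Ex; split; [exact: ED|rewrite lte_fin indicE mem_set// mulr1].
Qed.

Variable W : set (R -> \bar R).
Hypothesis W_dist : forall w, W w -> is_dist w.

(** Associate norms, representation norms and sigma all have this form. *)
Definition pairing_norm f := ereal_sup [set pairing (dist mu D f) w | w in W].

Definition realizations := [set w' : T -> \bar R | nonneg_measurable D w' /\
  exists2 w, W w & forall a, (0 <= a)%R -> dist mu D w' a = w a].

(** By resonance the norm is a supremum of integrals against fixed functions,
    which gives the triangle inequality and the Fatou property. *)
Lemma pairing_normE f : nonneg_measurable D f ->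
  pairing_norm f = ereal_sup [set \int[mu]_(x in D) (f x * w' x) | w' in realizations].
Proof.
move=> hf; apply/eqP; rewrite eq_le; apply/andP; split.
  apply: ge_ereal_sup => _ [w Ww <-]; rewrite pairingC.
  rewrite -(resonance mD htau (W_dist Ww) hf); apply: ge_ereal_sup => _ [h [hh hw] <-].
  apply: ereal_sup_ubound; exists h; first by split => //; exists w.
  by apply: eq_integral => x _; rewrite muleC.
apply: ge_ereal_sup => _ [w' [hw' [w Ww ww']] <-].
apply: (@le_trans _ _ (pairing (dist mu D f) w)); last first.
  by apply: ereal_sup_ubound; exists w.
apply: le_trans (integral_le_pairing mu mD hf hw') _.
by apply: le_pairing => // a a0; rewrite ww'// ltW.
Qed.

(** The first condition makes norms of indicators of sets of finite measure
    finite; the second one bounds the norm from below, by integrals over such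
    sets. *)
Hypothesis W_bounded : forall m, 0 <= m -> m < +oo ->
  ereal_sup [set pairing (box m 1) w | w in W] < +oo.
Hypothesis W_large : forall m, 0 <= m -> m < +oo ->
  exists2 w, W w & exists2 c, (0 < c)%R & m <= w c.

Lemma pairing_norm_ge0 f : 0 <= pairing_norm f.
Proof.
have [w Ww _] := W_large (lexx 0) (ltry 0).
by apply: le_trans (pairing_ge0 _ _) _; last (apply: ereal_sup_ubound; exists w).
Qed.

Lemma le_pairing_norm f g : (forall a, (0 < a)%R -> dist mu D f a <= dist mu D g a) ->
  pairing_norm f <= pairing_norm g.
Proof.
move=> fg; apply: ge_ereal_sup => _ [w Ww <-].
apply: (@le_trans _ _ (pairing (dist mu D g) w)); first exact: le_pairing.
by apply: ereal_sup_ubound; exists w.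
Qed.

Lemma pairing_norm_eq0 f : nonneg_measurable D f ->
  pairing_norm f = 0 <-> {ae mu, forall x, D x -> f x = 0}.
Proof.
move=> [mf f0]; split => [N0|f0ae].
  have df0 a : (0 < a)%R -> dist mu D f a = 0.
    move=> a0; apply/eqP; rewrite eq_le measure_ge0 andbT leNgt; apply/negP => fa.
    have m0 : 0 < mine (dist mu D f a) 1 by rewrite lt_min fa lte01.
    have [|w Ww [c c0 wc]] := W_large (ltW m0) _; first by rewrite gt_min ltry orbT.
    (* one square of side del already contributes to the Riemann sum *)
    pose del := Num.min a c.
    have d0 : (0 < del)%R by rewrite lt_min a0.
    have : pairing (dist mu D f) w <= 0.
      by rewrite -N0; apply: ereal_sup_ubound; exists w.
    apply/negP; rewrite -ltNge; apply: lt_le_trans (layer_sum_le_layers 1 _ d0).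
    rewrite /layer_sum !big_ord1 mul1r; apply: mule_gt0.
      by rewrite lte_fin mulr_gt0.
    rewrite lt_min (lt_le_trans fa)/=; last first.
      have [_ nd _] := dist_is_dist mu mD mf; apply: nd; first exact: ltW.
      by rewrite ge_min lexx.
    apply: (lt_le_trans m0); apply: (le_trans wc).
    have [_ nd _] := W_dist Ww; apply: nd; first exact: ltW.
    by rewrite ge_min lexx orbT.
  have d00 : dist mu D f 0 = 0.
    apply/eqP; rewrite eq_le measure_ge0 andbT.
    have [_ _ r] := dist_is_dist mu mD mf; apply: r => // b b0.
    by rewrite df0.
  exists (D `&` [set x | 0%:E < f x]); split => //; first exact: measurable_levelset.
  move=> x /= /not_implyP[Dx fx0]; split => //=; rewrite lt_neqAle f0// andbT.
  by apply/eqP => h; apply: fx0.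
apply/eqP; rewrite eq_le pairing_norm_ge0 andbT; apply: ge_ereal_sup => _ [w Ww <-].
apply: ge_ereal_sup => _ [[del m] /= d0 <-].
rewrite /layer_sum big1// => i _; rewrite big1// => k _.
have a0 : (0 <= i.+1%:R * del)%R by rewrite mulr_ge0// ltW.
rewrite (_ : mine _ _ = 0) ?mule0//.
have -> : dist mu D f (i.+1%:R * del)%R = 0.
  rewrite (@ae_eq_dist _ _ _ mu D mD f (cst 0))//.
  rewrite /dist (_ : _ `&` _ = set0) ?measure0//; apply/seteqP; split => // x [_ /=].
  by rewrite lte_fin ltNge a0.
by rewrite min_l//; apply: is_dist_ge0; [exact: W_dist|rewrite mulr_ge0// ltW].
Qed.

Lemma nonneg_measurableZ l f : (0 <= l)%R -> nonneg_measurable D f ->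
  nonneg_measurable D (fun x => l%:E * f x).
Proof.
move=> l0 [mf f0]; split; first exact: emeasurable_funM.
by move=> x Dx; rewrite mule_ge0//; exact: f0.
Qed.

Lemma nonneg_measurableD f g : nonneg_measurable D f -> nonneg_measurable D g ->
  nonneg_measurable D (fun x => f x + g x).
Proof.
move=> [mf f0] [mg g0]; split; first exact: emeasurable_funD.
by move=> x Dx; rewrite adde_ge0//; [exact: f0|exact: g0].
Qed.

Lemma nonneg_measurableM f g : nonneg_measurable D f -> nonneg_measurable D g ->
  nonneg_measurable D (fun x => f x * g x).
Proof.
move=> [mf f0] [mg g0]; split; first exact: emeasurable_funM.
by move=> x Dx; rewrite mule_ge0//; [exact: f0|exact: g0].
Qed.

Lemma le_pairing_normZ l f : (0 <= l)%R -> nonneg_measurable D f ->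
  pairing_norm (fun x => l%:E * f x) <= l%:E * pairing_norm f.
Proof.
move=> l0 hf; rewrite !pairing_normE//; last exact: nonneg_measurableZ.
apply: ge_ereal_sup => _ [w' Ww' <-].
under eq_integral do rewrite -muleA.
have [mfw fw0] := nonneg_measurableM hf Ww'.1.
rewrite ge0_integralZl//; apply: lee_wpmul2l => //.
by apply: ereal_sup_ubound; exists w'.
Qed.

Lemma pairing_normZ l f : (0 <= l)%R -> nonneg_measurable D f ->
  pairing_norm (fun x => l%:E * f x) = l%:E * pairing_norm f.
Proof.
move=> l0 hf; apply/eqP; rewrite eq_le le_pairing_normZ//=.
have [->|ln0] := eqVneq l 0%R; first by rewrite mul0e pairing_norm_ge0.
have {ln0}l0 : (0 < l)%R by rewrite lt_neqAle eq_sym ln0.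
have li0 : (0 <= l^-1)%R by rewrite invr_ge0 ltW.
have := le_pairing_normZ li0 (nonneg_measurableZ (ltW l0) hf).
rewrite (_ : (fun x => _) = f); last first.
  by apply/funext => x; rewrite muleA -EFinM mulVf ?gt_eqF// mul1e.
move=> h; apply: (@le_trans _ _ (l%:E * (l^-1%:E * pairing_norm (fun x => l%:E * f x)))).
  by apply: lee_wpmul2l => //; rewrite lee_fin ltW.
by rewrite muleA -EFinM mulfV ?gt_eqF// mul1e.
Qed.

Lemma pairing_normD f g : nonneg_measurable D f -> nonneg_measurable D g ->
  pairing_norm (fun x => f x + g x) <= pairing_norm f + pairing_norm g.
Proof.
move=> hf hg; rewrite !pairing_normE//; last exact: nonneg_measurableD.
apply: ge_ereal_sup => _ [w' Ww' <-].
have [mfw fw0] := nonneg_measurableM hf Ww'.1.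
have [mgw gw0] := nonneg_measurableM hg Ww'.1.
under eq_integral => x Dx.
  rewrite inE in Dx; rewrite ge0_muleDl; [|exact: hf.2|exact: hg.2].
  over.
rewrite ge0_integralD//; apply: leeD; apply: ereal_sup_ubound; by exists w'.
Qed.

Lemma pairing_norm_fatou (f_ : nat -> T -> \bar R) f :
  (forall j, nonneg_measurable D (f_ j)) -> nonneg_measurable D f ->
  {ae mu, forall x, D x ->
    nondecreasing_seq (fun j => f_ j x) /\ f_ j x @[j --> \oo] --> f x} ->
  nondecreasing_seq (fun j => pairing_norm (f_ j)) /\
  pairing_norm (f_ j) @[j --> \oo] --> pairing_norm f.
Proof.
move=> hf_ hf [N [mN N0 sub]].
have good x : D x -> ~ N x ->
    nondecreasing_seq (fun j => f_ j x) /\ f_ j x @[j --> \oo] --> f x.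
  by move=> Dx Nx; apply: contrapT => h; apply: Nx; apply: sub => /= /(_ Dx).
have nd : nondecreasing_seq (fun j => pairing_norm (f_ j)).
  move=> i j ij; apply: le_pairing_norm => a a0.
  apply: le_dist; [exact: mD|exact: (hf_ _).1|exact: (hf_ _).1|].
  exists N; split => // x /= h; apply: contrapT => Nx; apply: h => Dx.
  by have [h _] := good x Dx Nx; exact: h.
split => //.
suff -> : pairing_norm f = ereal_sup (range (fun j => pairing_norm (f_ j))).
  exact: ereal_nondecreasing_cvgn.
apply/eqP; rewrite eq_le; apply/andP; split; last first.
  apply: ge_ereal_sup => _ [j _ <-]; apply: le_pairing_norm => a a0.
  apply: le_dist; [exact: mD|exact: (hf_ _).1|exact: hf.1|].
  exists N; split => // x /= h; apply: contrapT => Nx; apply: h => Dx.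
  have [h1 h2] := good x Dx Nx.
  by rewrite (nondecreasing_cvgeE h1 h2); apply: ereal_sup_ubound; exists j.
rewrite pairing_normE//; apply: ge_ereal_sup => _ [w' Ww' <-].
have [mfw fw0] := nonneg_measurableM hf Ww'.1.
rewrite (ge0_negligible_integral mN)//.
have mDN : measurable (D `\` N) by exact: measurableD.
have sDN : D `\` N `<=` D by move=> x [].
rewrite (eq_integral (fun x => limn (fun j => f_ j x * w' x))); last first.
  move=> x; rewrite inE => -[Dx Nx]; apply/esym/cvg_lim => //.
  have [h1 h2] := good x Dx Nx.
  have [fx0|fx0] := eqVneq (f x) 0.
    have f_0 j : f_ j x = 0.
      apply/eqP; rewrite eq_le (hf_ j).2// andbT -fx0.
      by rewrite (nondecreasing_cvgeE h1 h2); apply: ereal_sup_ubound; exists j.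
    rewrite fx0 mul0e; under eq_fun do rewrite f_0 mul0e; exact: cvg_cst.
  have [wx0|wx0] := eqVneq (w' x) 0.
    rewrite wx0 mule0; under eq_fun do rewrite mule0; exact: cvg_cst.
  apply: cvgeM => //; last exact: cvg_cst.
  by apply: neq0_mule_def; rewrite mule_eq0 negb_or fx0.
have mfjw j := (nonneg_measurableM (hf_ j) Ww'.1).1.
have fjw0 j := (nonneg_measurableM (hf_ j) Ww'.1).2.
rewrite monotone_convergence//; last 3 first.
- by move=> j; exact: measurable_funS (mfjw j).
- by move=> j x [Dx _]; exact: fjw0.
- move=> x [Dx Nx] i j ij; apply: lee_wpmul2r; first exact: Ww'.1.2.
  by have [h1 _] := good x Dx Nx; exact: h1.
apply: lime_le.
  apply: ereal_nondecreasing_is_cvgn => i j ij; apply: ge0_le_integral => //.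
  - by move=> x [Dx _]; exact: fjw0.
  - exact: measurable_funS (mfjw i).
  - exact: measurable_funS (mfjw j).
  - move=> x [Dx Nx]; apply: lee_wpmul2r; first exact: Ww'.1.2.
    by have [h1 _] := good x Dx Nx; exact: h1.
apply: nearW => j.
rewrite -(ge0_negligible_integral mN mD (mfjw j) (fjw0 j) N0).
apply: (@le_trans _ _ (pairing_norm (f_ j))); last by apply: ereal_sup_ubound; exists j.
by rewrite pairing_normE//; apply: ereal_sup_ubound; exists w'.
Qed.

Lemma pairing_norm_indic (E : set T) : measurable E -> E `<=` D -> mu E < +oo ->
  pairing_norm (fun x => (\1_E x)%:E) < +oo.
Proof.
move=> mE ED Eoo; apply: le_lt_trans (W_bounded (measure_ge0 mu E) Eoo).
apply: ge_ereal_sup => _ [w Ww <-].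
apply: (@le_trans _ _ (pairing (box (mu E) 1) w)).
  apply: le_pairing => // a a0; rewrite -(dist_indic 1 ED (ltW a0)).
  by rewrite (_ : (fun x => (1 * \1_E x)%:E) = fun x => (\1_E x)%:E)//;
    apply/funext => x; rewrite mul1r.
by apply: ereal_sup_ubound; exists w.
Qed.

Lemma integral_le_pairing_norm (E : set T) : measurable E -> E `<=` D -> mu E < +oo ->
  exists C : R, forall f, nonneg_measurable D f ->
    \int[mu]_(x in E) f x <= C%:E * pairing_norm f.
Proof.
move=> mE ED Eoo; have [w Ww [c c0 wc]] := W_large (measure_ge0 mu E) Eoo.
exists (c^-1)%R => f hf.
have ci0 : (0 <= c^-1)%R by rewrite invr_ge0 ltW.
have hE : nonneg_measurable D (fun x => (c * \1_E x)%:E).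
  split; last by move=> x _; rewrite lee_fin mulr_ge0// ltW.
  by apply/measurable_EFinP; apply: measurable_funM => //; exact: measurable_indic.
have [mfE fE0] := nonneg_measurableM hf hE.
rewrite (_ : \int[mu]_(x in E) f x =
    c^-1%:E * \int[mu]_(x in D) (f x * (c * \1_E x)%:E)); last first.
  rewrite -ge0_integralZl//.
  rewrite -[in LHS](setIidr ED) integral_mkcondr; apply: eq_integral => x _.
  rewrite patchE indicE muleCA; case: (x \in E) => /=.
    by rewrite mulr1 -EFinM mulVf ?gt_eqF// mule1.
  by rewrite mulr0 mule0 mule0.
apply: lee_wpmul2l; first by rewrite lee_fin.
apply: le_trans (integral_le_pairing mu mD hf hE) _.
apply: (@le_trans _ _ (pairing (dist mu D f) w)); last first.
  by apply: ereal_sup_ubound; exists w.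
apply: le_pairing => // a a0; rewrite dist_indic ?(ltW a0)// /box.
have [w0 wn _] := W_dist Ww.
case: ifPn => ac; last by apply: w0; exact: ltW.
by apply: (le_trans wc); apply: wn; exact: ltW.
Qed.

Lemma ri_norm_pairing_norm : ri_norm mu D pairing_norm.
Proof.
split.
- by move=> f _; exact: pairing_norm_ge0.
- exact: pairing_norm_eq0.
- exact: pairing_normZ.
- exact: pairing_normD.
- move=> f g [mf _] [mg _] fg; apply: le_pairing_norm => a _; exact: le_dist.
- exact: pairing_norm_fatou.
- exact: pairing_norm_indic.
- exact: integral_le_pairing_norm.
- move=> f g hf hg /(equimeasurableP mu mu mD mD hf hg) fg.
  by apply/eqP; rewrite eq_le !le_pairing_norm// => a a0; rewrite fg// ltW.
Qed.

End pairing_norm.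

(** * The half-line and associate norms *)

Section half_line.
Context (R : realType).
Local Notation D := (@positives R).
Local Notation lam := (lebesgue_line R).

Lemma line_measurable (A : set R) : measurable A ->
  measurable (A : set (line R)).
Proof. by move=> mA; exact: sub_caratheodory. Qed.

Lemma lebesgue_lineE (A : set R) : lam A = lebesgue_measure A.
Proof. by []. Qed.

Lemma measurable_positives : measurable D.
Proof. by apply: line_measurable; exact: measurable_itv. Qed.

Lemma measurable_line_id : measurable_fun D (fun t : line R => t : R).
Proof.
move=> mD A mA; apply: measurableI => //; exact: line_measurable.
Qed.

Lemma ucoord_line : ucoord lam D (fun t : line R => t : R).
Proof.
split; first exact: measurable_line_id.
  by move=> x; rewrite /positives /= in_itv/= andbT => /ltW.
move=> s s0; rewrite (_ : _ `&` _ = `]0%R, s[%classic); last first.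
  by apply/seteqP; split => x; rewrite /positives /= !in_itv/= andbT;
    [move=> [-> ->]|move=> /andP[-> ->]].
rewrite lebesgue_lineE lebesgue_measure_itv/= lte_fin -EFinB subr0.
by case: ifPn => //; rewrite -leNgt => s0'; congr EFin; apply/eqP; rewrite eq_le s0.
Qed.

End half_line.

Section ri_norm_theory.
Context d (T : measurableType d) (R : realType).
Variables (mu : {measure set T -> \bar R}) (D : set T).
Hypothesis mD : measurable D.
Variable tau : T -> R.
Hypothesis htau : ucoord mu D tau.
Variable rho : (T -> \bar R) -> \bar R.
Hypothesis hrho : ri_norm mu D rho.
Implicit Types (f g : T -> \bar R) (s t a c : R) (m : \bar R).

Lemma ri_norm_eq_dist f g : nonneg_measurable D f -> nonneg_measurable D g ->
  (forall a, (0 <= a)%R -> dist mu D f a = dist mu D g a) -> rho f = rho g.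
Proof.
move=> hf hg fg; apply: (ri_norm_rearrangement hrho) => //.
exact/(equimeasurableP mu mu mD mD hf hg).
Qed.

Definition unit_dists : set (R -> \bar R) :=
  [set dist mu D f | f in [set f | nonneg_measurable D f /\ rho f <= 1]].

Lemma unit_dists_is_dist w : unit_dists w -> is_dist w.
Proof. by move=> [f [[mf _] _] <-]; exact: dist_is_dist. Qed.

Lemma nonneg_measurable_indic (E : set T) : measurable E ->
  nonneg_measurable D (fun x => (\1_E x)%:E : \bar R).
Proof.
move=> mE; split; last by move=> x _; rewrite lee_fin indicE.
by apply/measurable_EFinP; exact: measurable_indic.
Qed.

Lemma exists_set_of_measure m : 0 <= m -> m < +oo ->
  exists E, [/\ measurable E, E `<=` D & mu E = m].
Proof.
case: m => [s| |]// s0 _; rewrite lee_fin in s0.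
exists (D `&` [set x | (tau x < s)%R]); split; last exact: (ucoordE htau).
  exact: (measurable_ucoord_lt mD htau).
exact: subIsetl.
Qed.

Lemma ri_norm0 : rho (fun=> 0) = 0.
Proof.
apply/(ri_norm_eq0 hrho); last exact: aeW.
by split => //; exact: measurable_cst.
Qed.

(** The local integrability of the unit ball on one set of measure [m] passes
    by resonance to the pairing. *)
Lemma unit_dists_bounded m : 0 <= m -> m < +oo ->
  ereal_sup [set pairing (box m 1) w | w in unit_dists] < +oo.
Proof.
move=> m0 moo; have [E [mE ED mEm]] := exists_set_of_measure m0 moo.
have [|C hC] := ri_norm_integral hrho mE ED _; first by rewrite mEm.
apply: le_lt_trans (ltry (Num.max C 0%R)).
apply: ge_ereal_sup => _ [_ [f [hf f1] <-] <-].
have hE := nonneg_measurable_indic mE.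
rewrite (_ : pairing _ _ = pairing (dist mu D f) (dist mu D (fun x => (\1_E x)%:E))); last first.
  rewrite pairingC; apply: eq_pairing => // a a0.
  rewrite -mEm -(dist_indic _ 1 ED (ltW a0)).
  by apply: eq_dist => x _; rewrite mul1r.
rewrite -(resonance mD htau (dist_is_dist mu mD hf.1) hE).
apply: ge_ereal_sup => _ [h [hh hf'] <-].
have -> : \int[mu]_(x in D) (h x * (\1_E x)%:E) = \int[mu]_(x in E) h x.
  rewrite -[in RHS](setIidr ED) integral_mkcondr; apply: eq_integral => x _.
  by rewrite patchE indicE; case: (x \in E); rewrite ?mule1 ?mule0.
apply: (le_trans (hC h hh)); rewrite (ri_norm_eq_dist hh hf)//.
apply: (@le_trans _ _ ((Num.max C 0%R)%:E * rho f)).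
  by apply: lee_wpmul2r; [exact: (ri_norm_ge0 hrho)|rewrite lee_fin le_max lexx].
rewrite -[leRHS]mule1; apply: lee_wpmul2l => //.
by rewrite lee_fin le_max lexx orbT.
Qed.

(** A small multiple of the indicator of a set of measure [m] lies in the unit
    ball. *)
Lemma unit_dists_large m : 0 <= m -> m < +oo ->
  exists2 w, unit_dists w & exists2 c, (0 < c)%R & m <= w c.
Proof.
move=> m0 moo; have [E [mE ED mEm]] := exists_set_of_measure m0 moo.
have [b hb] : exists b : R, rho (fun x => (\1_E x)%:E) = b%:E.
  have : rho (fun x => (\1_E x)%:E) < +oo.
    by apply: (ri_norm_indic hrho) => //; rewrite mEm.
  have := ri_norm_ge0 hrho (nonneg_measurable_indic mE).
  by case: (rho _) => // b; exists b.
have b0 : (0 <= b)%R by rewrite -lee_fin -hb; exact/(ri_norm_ge0 hrho)/nonneg_measurable_indic.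
have c0 : (0 < (1 + b)^-1)%R by rewrite invr_gt0 ltr_pwDl.
exists (dist mu D (fun x => (1 + b)^-1%:E * (\1_E x)%:E)).
  exists (fun x => (1 + b)^-1%:E * (\1_E x)%:E) => //; split.
    by apply: nonneg_measurableZ; [exact: ltW|exact: nonneg_measurable_indic].
  rewrite (ri_normZ hrho); [|exact: ltW|exact: nonneg_measurable_indic].
  rewrite hb -EFinM lee_fin mulrC ler_pdivrMr ?ltr_pwDl// mul1r; lra.
exists ((1 + b)^-1 / 2)%R; first by rewrite divr_gt0.
rewrite (@eq_dist _ _ _ _ _ _ (fun x => ((1 + b)^-1 * \1_E x)%:E))//.
rewrite dist_indic// /box ?ifT ?mEm//; first lra.
by rewrite divr_ge0// ltW.
Qed.

(** With a function, the unit ball contains all functions equimeasurable with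
    it. *)
Lemma associate_normE g : nonneg_measurable D g ->
  associate_norm mu D rho g = pairing_norm mu D unit_dists g.
Proof.
move=> hg; rewrite (pairing_normE mD htau unit_dists_is_dist hg).
congr ereal_sup; apply/seteqP; split => _ [f hf <-].
  exists f; last by apply: eq_integral => x _; rewrite muleC.
  split; first exact: hf.1.
  by exists (dist mu D f) => //; exists f.
have [hf0 [_ [g' [hg' g'1] <-] fg']] := hf.
exists f; last by apply: eq_integral => x _; rewrite muleC.
by split => //; rewrite (ri_norm_eq_dist hf0 hg' fg').
Qed.

End ri_norm_theory.

Section eq_ri_norm.
Context d (T : measurableType d) (R : realType).
Variables (mu : {measure set T -> \bar R}) (D : set T).
Hypothesis mD : measurable D.

Lemma eq_ri_norm rho1 rho2 : (forall f, nonneg_measurable D f -> rho1 f = rho2 f) ->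
  ri_norm mu D rho1 -> ri_norm mu D rho2.
Proof.
move=> E h; split.
- by move=> f hf; rewrite -E//; exact: (ri_norm_ge0 h).
- by move=> f hf; rewrite -E//; exact: (ri_norm_eq0 h).
- move=> l f l0 hf; rewrite -!E//; first exact: (ri_normZ h).
  exact: nonneg_measurableZ.
- move=> f g hf hg; rewrite -!E//; first exact: (ri_normD h).
  exact: nonneg_measurableD.
- by move=> f g hf hg fg; rewrite -!E//; exact: (ri_norm_le h).
- move=> f_ f hf_ hf ff; have := ri_norm_fatou h hf_ hf ff; rewrite E//.
  by under [in X in X -> _]eq_fun do rewrite E//.
- move=> F mF FD Foo; rewrite -E; first exact: (ri_norm_indic h).
  exact: nonneg_measurable_indic.
- move=> F mF FD Foo; have [C hC] := ri_norm_integral h mF FD Foo.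
  by exists C => f hf; rewrite -E//; exact: hC.
- by move=> f g hf hg fg; rewrite -!E//; exact: (ri_norm_rearrangement h).
Qed.

Lemma ri_norm_associate tau rho : ucoord mu D tau -> ri_norm mu D rho ->
  ri_norm mu D (associate_norm mu D rho).
Proof.
move=> htau hrho; apply: (@eq_ri_norm (pairing_norm mu D (unit_dists mu D rho))).
  by move=> f hf; rewrite (associate_normE mD htau hrho).
apply: (ri_norm_pairing_norm mD htau).
- exact: (unit_dists_is_dist mD).
- exact: (unit_dists_bounded mD htau hrho).
- exact: (unit_dists_large mD htau hrho).
Qed.

End eq_ri_norm.

(** * The volume of centred cubes as a coordinate of R^n *)

Section euclidean_measure.
Context (R : realType).

(** The sides are indexed by all natural numbers, which allows an induction on
    the dimension. *)
Definition box_set n (A : nat -> set R) : set (n.-tuple (measurableTypeR R)) :=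
  [set x | forall i : 'I_n, A i (tnth x i)].
Arguments box_set n A : clear implicits.

Lemma measurable_box_set n (A : nat -> set R) : (forall i, measurable (A i)) ->
  measurable (box_set n A).
Proof.
move=> mA; rewrite (_ : box_set n A = \bigcap_(i : 'I_n)
    ((@tnth _ _)^~ i @^-1` A i)); last first.
  by apply/seteqP; split => [x h i _|x h i]; [exact: h|exact: (h i I)].
apply: fin_bigcap_measurable => // i _.
rewrite -[X in measurable X]setTI; apply: measurable_tnth => //; exact: mA.
Qed.

Lemma borel_lebesgue_box_set n (A : nat -> set R) : (forall i, measurable (A i)) ->
  borel_lebesgue R n (box_set n A) = \prod_(i < n) lebesgue_measure (A i).
Proof.
elim: n A => [|n IH] A mA.
  by rewrite big_ord0 /= diracE mem_set// => -[].
rewrite big_ord_recl/= /tuple_product /pushforward.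
rewrite (_ : _ @^-1` _ = A 0%N `*` box_set n (fun i => A i.+1)); last first.
  apply/seteqP; split => -[x y] /=.
    move=> h; split; first by have := h ord0; rewrite tnth0.
    move=> i; have := h (lift ord0 i).
    by rewrite tnthS.
  move=> [h1 h2] i; case: (unliftP ord0 i) => [j ->|->]; last by rewrite tnth0.
  by rewrite tnthS; exact: h2.
rewrite product_measure1E; [|exact: mA|exact: measurable_box_set].
by rewrite IH.
Qed.

Lemma measurable_Rn n (A : set (n.-tuple (measurableTypeR R))) :
  measurable A -> measurable (A : set (Rn R n)).
Proof. by move=> mA; exact: caratheodory_measurable_mu_ext. Qed.

Lemma lebesgue_Rn_box_set n (A : nat -> set R) : (forall i, measurable (A i)) ->
  lebesgue_Rn R n (box_set n A) = \prod_(i < n) lebesgue_measure (A i).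
Proof.
move=> mA; rewrite -borel_lebesgue_box_set//.
rewrite /lebesgue_Rn /= /completed_measure_extension.
by rewrite measurable_mu_extE//; exact: measurable_box_set.
Qed.

Lemma lebesgue_Rn_itv n (a : nat -> R) (l : R) b1 b2 : (0 <= l)%R ->
  lebesgue_Rn R n (box_set n (fun i => [set` Interval (BSide b1 (a i)) (BSide b2 (a i + l)%R)])) =
  (l ^+ n)%:E.
Proof.
move=> l0; rewrite lebesgue_Rn_box_set; last by move=> i; exact: measurable_itv.
rewrite (eq_bigr (fun=> l%:E)); last first.
  move=> i _; rewrite lebesgue_measure_itv/= lte_fin ltrDl -EFinB addrAC subrr add0r.
  by case: ifPn => //; rewrite -leNgt => l0'; congr EFin; apply/eqP; rewrite eq_le l0 l0'.
by elim: n {a} => [|m IH]; rewrite ?big_ord0// big_ord_recl IH exprS EFinM.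
Qed.

Lemma cubeE n (a : n.-tuple R) (l : R) :
  cube a l = box_set n (fun i => `[(nth 0 a i)%R, (nth 0 a i + l)%R]%classic).
Proof.
by apply/seteqP; split => x /= h i; have := h i;
  rewrite /= in_itv/= !(tnth_nth 0%R).
Qed.

Lemma measurable_cube n (a : n.-tuple R) (l : R) : measurable (cube a l).
Proof.
rewrite cubeE; apply: measurable_Rn; apply: measurable_box_set => i.
exact: measurable_itv.
Qed.

Lemma lebesgue_Rn_cube n (a : n.-tuple R) (l : R) : (0 <= l)%R ->
  lebesgue_Rn R n (cube a l) = (l ^+ n)%:E.
Proof. by move=> l0; rewrite cubeE (lebesgue_Rn_itv _ (fun i => nth 0%R a i)). Qed.

Definition sup_norm n (x : n.-tuple R) : R := \big[Num.max/0%R]_(i < n) `|tnth x i|%R.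

(** The volume of the centred cube with [x] on its boundary. The sublevel sets
    of this coordinate are cubes, hence admissible for the maximal operator. *)
Definition cube_volume n (x : Rn R n) : R := ((2 * sup_norm x) ^+ n)%R.

Lemma sup_norm_ge0 n (x : n.-tuple R) : (0 <= sup_norm x)%R.
Proof. by apply/bigmax_geP; left. Qed.

Lemma sup_norm_le n (x : n.-tuple R) r : (0 <= r)%R ->
  (sup_norm x <= r)%R <-> forall i : 'I_n, (`|tnth x i| <= r)%R.
Proof.
move=> r0; split => [/bigmax_leP[_ h] i|h]; first exact: h.
by apply/bigmax_leP; split.
Qed.

Lemma sup_norm_lt n (x : n.-tuple R) r : (0 < r)%R ->
  (sup_norm x < r)%R <-> forall i : 'I_n, (`|tnth x i| < r)%R.
Proof.
move=> r0; split => [/bigmax_ltP[_ h] i|h]; first exact: h.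
by apply/bigmax_ltP; split.
Qed.

Variable n : nat.
Hypothesis n0 : (0 < n)%N.

Definition half_side (s : R) : R := ((s `^ n%:R^-1) / 2)%R.

Lemma half_sideK s : (0 <= s)%R -> ((2 * half_side s) ^+ n = s)%R.
Proof.
move=> s0; rewrite /half_side mulrC divfK//.
rewrite -powR_mulrn ?powR_ge0// -powRrM mulVf ?powRr1//.
by rewrite pnatr_eq0 -lt0n.
Qed.

Lemma half_side_ge0 s : (0 <= half_side s)%R.
Proof. by rewrite /half_side divr_ge0// powR_ge0. Qed.

Lemma half_side_gt0 s : (0 < s)%R -> (0 < half_side s)%R.
Proof. by move=> s0; rewrite /half_side divr_gt0// powR_gt0. Qed.

Lemma cube_volume_ge0 (x : Rn R n) : (0 <= cube_volume x)%R.
Proof. by rewrite exprn_ge0// mulr_ge0// sup_norm_ge0. Qed.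

Lemma cube_volume_lt (x : Rn R n) s : (0 <= s)%R ->
  (cube_volume x < s)%R = (sup_norm x < half_side s)%R.
Proof.
move=> s0; rewrite -{1}(half_sideK s0) /cube_volume.
have h1 : (2 * sup_norm x)%R \is Num.nneg by rewrite nnegrE mulr_ge0// sup_norm_ge0.
have h2 : (2 * half_side s)%R \is Num.nneg by rewrite nnegrE mulr_ge0// half_side_ge0.
by rewrite ltr_pXn2r// ltr_pM2l.
Qed.

Lemma cube_volume_le (x : Rn R n) s : (0 <= s)%R ->
  (cube_volume x <= s)%R = (sup_norm x <= half_side s)%R.
Proof.
move=> s0; rewrite -{1}(half_sideK s0) /cube_volume.
have h1 : (2 * sup_norm x)%R \is Num.nneg by rewrite nnegrE mulr_ge0// sup_norm_ge0.
have h2 : (2 * half_side s)%R \is Num.nneg by rewrite nnegrE mulr_ge0// half_side_ge0.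
by rewrite ler_pXn2r// ler_pM2l.
Qed.

Lemma cube_volume_lt_box s : (0 < s)%R -> [set x : Rn R n | (cube_volume x < s)%R] =
  box_set n (fun i => `](- half_side s)%R, (- half_side s + 2 * half_side s)%R[%classic).
Proof.
move=> s0; have h0 := half_side_gt0 s0.
have e : (- half_side s + 2 * half_side s = half_side s)%R by rewrite mulr2n mulrDl mul1r; ring.
apply/seteqP; split => x /=; rewrite cube_volume_lt ?ltW//.
  by move=> /(sup_norm_lt _ h0) h i; have := h i; rewrite /= in_itv/= e ltr_norml.
by move=> h; apply/(sup_norm_lt _ h0) => i; have := h i; rewrite /= in_itv/= e ltr_norml.
Qed.

Lemma cube_volume_le_cube s : (0 <= s)%R -> [set x : Rn R n | (cube_volume x <= s)%R] =
  cube [tuple of nseq n (- half_side s)%R] (2 * half_side s)%R.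
Proof.
move=> s0; have h0 := half_side_ge0 s.
have e : (- half_side s + 2 * half_side s = half_side s)%R by rewrite mulr2n mulrDl mul1r; ring.
apply/seteqP; split => x /=; rewrite cube_volume_le//.
  move=> /(sup_norm_le _ h0) h i; have := h i.
  by rewrite (tnth_nth 0%R [tuple of nseq _ _]) /= nth_nseq ltn_ord e ler_norml.
move=> h; apply/(sup_norm_le _ h0) => i; have := h i.
by rewrite (tnth_nth 0%R [tuple of nseq _ _]) /= nth_nseq ltn_ord e ler_norml.
Qed.

Lemma ucoord_Rn : ucoord (lebesgue_Rn R n) setT (@cube_volume n).
Proof.
have mlt s : measurable [set x : Rn R n | (cube_volume x < s)%R].
  have [s0|s0] := ltP 0%R s.
    rewrite cube_volume_lt_box//; apply: measurable_Rn; apply: measurable_box_set => i.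
    exact: measurable_itv.
  rewrite (_ : [set _ | _] = set0)//; apply/seteqP; split => // x /=.
  by move=> /lt_le_trans/(_ s0); rewrite ltNge cube_volume_ge0.
split.
- apply: (measurability _ (RGenInftyO.measurableE R)) => _ [_ [a ->] <-].
  rewrite setTI (_ : _ @^-1` _ = [set x : Rn R n | (cube_volume x < a)%R]); first exact: mlt.
  by apply/seteqP; split => x /=; rewrite in_itv.
- by move=> x _; exact: cube_volume_ge0.
- move=> s sge0; rewrite setTI; have [s0|s0] := leP s 0%R.
    have -> : s = 0%R by apply/eqP; rewrite eq_le s0.
    rewrite (_ : [set _ | _] = set0) ?measure0//; apply/seteqP; split => // x /=.
    by rewrite ltNge cube_volume_ge0.
  rewrite cube_volume_lt_box// (lebesgue_Rn_itv _ (fun=> (- half_side s)%R)).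
    by rewrite half_sideK// ltW.
  by rewrite mulr_ge0// half_side_ge0.
Qed.

End euclidean_measure.

(** * Hardy operators on the half-line *)

(** A kernel of the form [g t * k s] restricted to a set [L], as needed for
    the adjoint of an integral operator with variable limits. *)
Lemma tonelli_kernel d (T : measurableType d) (R : realType)
    (m : {sigma_finite_measure set T -> \bar R}) (g k : T -> \bar R) (L : set (T * T)) :
  measurable_fun setT g -> measurable_fun setT k ->
  (forall t, 0 <= g t) -> (forall s, 0 <= k s) -> measurable L ->
  \int[m]_t (g t * \int[m]_s (k s * (\1_L (t, s))%:E)) =
  \int[m]_s (k s * \int[m]_t (g t * (\1_L (t, s))%:E)).
Proof.
move=> mg mk g0 k0 mL.
pose F (p : T * T) := g p.1 * k p.2 * (\1_L p)%:E.
have mF : measurable_fun setT F.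
  apply: emeasurable_funM; last by apply/measurable_EFinP; exact: measurable_indic.
  apply: emeasurable_funM.
    exact: measurableT_comp mg measurable_fst.
  exact: measurableT_comp mk measurable_snd.
have F0 p : 0 <= F p by rewrite /F mule_ge0// ?lee_fin ?indicE// mule_ge0.
transitivity (\int[m]_t \int[m]_s F (t, s)).
  apply: eq_integral => t _; rewrite -ge0_integralZl//.
  - by apply: eq_integral => s _; rewrite /F /= muleA.
  - apply: emeasurable_funM => //; apply/measurable_EFinP.
    apply: measurableT_comp; first exact: measurable_indic.
    exact: measurable_pair1.
  - by move=> s _; rewrite mule_ge0// lee_fin indicE.
rewrite (fubini_tonelli F mF F0); apply: eq_integral => s _; rewrite -ge0_integralZl//.
- by apply: eq_integral => t _; rewrite /F /= [g t * _]muleC muleA.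
- apply: emeasurable_funM => //; apply/measurable_EFinP.
  apply: measurableT_comp; first exact: measurable_indic.
  exact: measurable_pair2.
- by move=> t _; rewrite mule_ge0// lee_fin indicE.
Qed.

Section hardy_operators.
Context (R : realType).
Local Notation D := (@positives R).
Local Notation lam := (lebesgue_line R).
Variable al : R.
Implicit Types (e : R -> \bar R) (h : line R -> \bar R) (s t : R).

Let mD : measurable D := @measurable_positives R.

Lemma line_measurable_fun d (T : measurableType d) (f : R -> T) :
  measurable_fun setT f -> measurable_fun setT (f : line R -> T).
Proof.
move=> mf _ A mA; rewrite setTI; apply: line_measurable.
by rewrite -[X in measurable X]setTI; exact: mf.
Qed.

Lemma positivesE t : D t <-> (0 < t)%R.
Proof. by rewrite /positives /= in_itv/= andbT. Qed.

Definition primitive e s : \bar R :=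
  \int[lam]_(t in (`]0%R, s[%classic : set (line R))) rea e t.

(** With [e] the distribution function of [f], this function controls the
    distribution of the fractional maximal function of [f]. *)
Definition hardy e s : \bar R := (s `^ (al - 1))%:E * primitive e s.

(** The integral operator in the definition of sigma. For the integration
    against decreasing functions its adjoint is [hardy]. *)
Definition dual_hardy h t : \bar R :=
  \int[lam]_(s in (`]t, +oo[%classic : set (line R))) (h s * ((s : R) `^ (al - 1))%:E).

Lemma measurable_weight : measurable_fun setT (fun s : line R => ((s : R) `^ (al - 1))%:E).
Proof. by apply/measurable_EFinP; apply: line_measurable_fun; exact: measurable_powR. Qed.

Lemma nonneg_measurable_line_rea e : nonneg_measurable D (fun t : line R => rea e t).
Proof. exact: (nonneg_measurable_rea mD (ucoord_line R)). Qed.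

Lemma subset_positives t (u : itv_bound R) : (0 <= t)%R ->
  [set` Interval (BSide false t) u] `<=` D.
Proof.
move=> t0 x /=; rewrite /positives /= !in_itv/= andbT => /andP[+ _].
exact: le_lt_trans.
Qed.

Lemma primitive_ge0 e s : 0 <= primitive e s.
Proof. by apply: integral_ge0 => t _; exact: rea_ge0. Qed.

Lemma primitive_ndecr e s t : (s <= t)%R -> primitive e s <= primitive e t.
Proof.
move=> st; apply: ge0_subset_integral; try (apply: line_measurable; exact: measurable_itv).
- apply: measurable_funS (nonneg_measurable_line_rea e).1 => //.
  exact: subset_positives.
- by move=> x _; exact: rea_ge0.
- by move=> x /=; rewrite !in_itv/= => /andP[-> /lt_le_trans]; apply.
Qed.

Lemma hardy_ge0 e s : 0 <= hardy e s.
Proof. by rewrite mule_ge0// ?lee_fin ?powR_ge0// primitive_ge0. Qed.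

Lemma measurable_primitive e : measurable_fun D (primitive e : line R -> \bar R).
Proof.
suff : measurable_fun D (fun s : line R => - - primitive e s).
  by apply: eq_measurable_fun => x _; rewrite oppeK.
apply: measurableT_comp; first exact: oppe_measurable.
apply: (measurable_nincr_comp mD (tau := fun t : line R => t : R)
  (G := fun s => - primitive e s)).
- exact: measurable_line_id.
- by move=> x /positivesE/ltW.
- by move=> s t _ st; rewrite leeN2; exact: primitive_ndecr.
Qed.

Lemma nonneg_measurable_hardy e : nonneg_measurable D (hardy e : line R -> \bar R).
Proof.
split; last by move=> x _; exact: hardy_ge0.
apply: emeasurable_funM; last exact: measurable_primitive.
exact: measurable_funTS measurable_weight.
Qed.

Lemma measurable_dual_integrand h : nonneg_measurable D h ->
  measurable_fun D (fun s : line R => h s * ((s : R) `^ (al - 1))%:E).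
Proof.
move=> [mh _]; apply: emeasurable_funM; first exact: mh.
exact: measurable_funTS measurable_weight.
Qed.

Lemma dual_hardy_nincr h s t : nonneg_measurable D h -> (0 <= s)%R -> (s <= t)%R ->
  dual_hardy h t <= dual_hardy h s.
Proof.
move=> hh s0 st; apply: ge0_subset_integral; try (apply: line_measurable; exact: measurable_itv).
- apply: measurable_funS (measurable_dual_integrand hh) => //.
  exact: subset_positives.
- move=> x sx; rewrite mule_ge0// ?lee_fin ?powR_ge0//; apply: hh.2.
  exact: (subset_positives s0 sx).
- by move=> x /=; rewrite !in_itv/= !andbT => /(le_lt_trans st).
Qed.

Lemma nonneg_measurable_dual_hardy h : nonneg_measurable D h ->
  nonneg_measurable D (dual_hardy h : line R -> \bar R).
Proof.
move=> hh; split.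
  apply: (measurable_nincr_comp mD (tau := fun t : line R => t : R)
    (G := dual_hardy h)).
  - exact: measurable_line_id.
  - by move=> x /positivesE/ltW.
  - by move=> s t s0; exact: dual_hardy_nincr.
move=> t /positivesE t0; apply: integral_ge0 => x sx.
rewrite mule_ge0// ?lee_fin ?powR_ge0//; apply: hh.2.
exact: (subset_positives (ltW t0) sx).
Qed.

(** Tonelli's theorem on the set where [t < s]. *)
Lemma integral_dual_hardy e h : nonneg_measurable D h ->
  \int[lam]_(t in D) (dual_hardy h t * rea e t) =
  \int[lam]_(s in D) (h s * hardy e s).
Proof.
move=> hh.
pose g' := (fun t : line R => rea e t) \_ D.
pose k' := (fun s : line R => h s * ((s : R) `^ (al - 1))%:E) \_ D.
have mg' : measurable_fun setT g'.
  by apply/(measurable_restrictT _ mD); exact: (nonneg_measurable_line_rea e).1.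
have mk' : measurable_fun setT k'.
  by apply/(measurable_restrictT _ mD); exact: measurable_dual_integrand.
have g'0 t : 0 <= g' t by apply: erestrict_ge0 => x _; exact: rea_ge0.
have k'0 t : 0 <= k' t.
  by apply: erestrict_ge0 => x Dx; rewrite mule_ge0 ?lee_fin ?powR_ge0//; exact: hh.2.
pose L : set (line R * line R) := [set p | (p.1 : R)%:E < (p.2 : R)%:E].
have mL : measurable L.
  have mid : measurable_fun setT (fun t : line R => (t : R)).
    by apply: line_measurable_fun; exact: measurable_id.
  rewrite -[L]setTI; apply: measurable_lte => //; apply/measurable_EFinP.
    exact: (measurableT_comp mid measurable_fst).
  exact: (measurableT_comp mid measurable_snd).
have := @tonelli_kernel _ (line R) R (@completed_lebesgue_measure R) g' k' L
  mg' mk' g'0 k'0 mL.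
move=> fub; transitivity (\int[lam]_t (g' t * \int[lam]_s (k' s * (\1_L (t, s))%:E))).
  rewrite integral_mkcond; apply: eq_integral => t _.
  rewrite /g' !patchE; case: ifPn => [tD|ntD]; last by rewrite mul0e.
  have t0 : (0 < t)%R by apply/positivesE; rewrite inE in tD.
  rewrite muleC; congr (_ * _); rewrite /dual_hardy integral_mkcond.
  apply: eq_integral => s _; rewrite /k' !patchE indicE.
  have -> : ((t, s) \in L) = (s \in `]t, +oo[%classic).
    by apply/idP/idP; rewrite !inE /L /= in_itv/= andbT lte_fin.
  case: (boolP (s \in `]t, +oo[%classic)) => [ts|_]; last by rewrite mulr0n mule0.
  have -> : s \in D.
    rewrite inE; apply/positivesE; rewrite inE /= in_itv/= andbT in ts.
    exact: lt_trans ts.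
  by rewrite mulr1n mule1.
rewrite [LHS]fub [RHS]integral_mkcond; apply: eq_integral => s _.
rewrite /k' !patchE; case: ifPn => [sD|nsD]; last by rewrite mul0e.
rewrite /hardy muleA; congr (_ * _).
rewrite /primitive [RHS]integral_mkcond; apply: eq_integral => t _.
rewrite /g' !patchE indicE.
case: (boolP (t \in D)) => [tD|tD].
  have t0 : (0 < t)%R by apply/positivesE; rewrite inE in tD.
  have -> : ((t, s) \in L) = (t \in `]0%R, s[%classic).
    by apply/idP/idP; rewrite !inE /L /= in_itv/= t0 lte_fin.
  by case: (t \in _); rewrite ?mulr1n ?mulr0n ?mule1 ?mule0.
have -> : (t \in `]0%R, s[%classic) = false.
  apply/negP; rewrite inE /= in_itv/= => /andP[t0 _].
  by rewrite notin_setE in tD; apply: tD; apply/positivesE.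
exact: mul0e.
Qed.

End hardy_operators.

(** * Step functions along a coordinate *)

Section step_functions.
Context d (T : measurableType d) (R : realType).
Variables (mu : {measure set T -> \bar R}) (D : set T).
Hypothesis mD : measurable D.
Variable tau : T -> R.
Hypothesis htau : ucoord mu D tau.
Implicit Types (f g : T -> \bar R) (s t a c : R).
Variables (del : R) (N : nat).
Hypothesis del0 : (0 < del)%R.
Implicit Types (v w : 'I_N -> R) (i j : 'I_N).

Let mtau : measurable_fun D tau. Proof. by case: htau. Qed.
Let tau0 x : D x -> (0 <= tau x)%R. Proof. by case: htau => _ + _; exact. Qed.

Definition cell (i : nat) : set T :=
  D `&` [set x | (i%:R * del <= tau x < i.+1%:R * del)%R].

(** The cell of [x] is found from the integer part of [tau x / del]; [insub]
    fails past the last cell, where the value is 0. *)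
Definition step v (x : T) : R :=
  oapp v 0%R (insub (Num.truncn (tau x / del)) : option 'I_N).

Lemma mem_cell x i : D x -> cell i x <-> Num.truncn (tau x / del) = i.
Proof.
move=> Dx; have t0 : (0 <= tau x / del)%R by rewrite divr_ge0 ?tau0// ltW.
split=> [[_ /= /andP[h1 h2]]|<-].
  by apply: truncn_def; rewrite ler_pdivlMr// ltr_pdivrMr// h1 h2.
have /andP[h1 h2] := truncn_itv t0; split => //=.
by rewrite -ler_pdivlMr// -ltr_pdivrMr// h1 h2.
Qed.

Lemma step_cell v x i : cell i x -> step v x = v i.
Proof.
move=> ci; have Dx : D x by case: ci.
by move/(mem_cell _ Dx) : ci; rewrite /step => ->; rewrite valK.
Qed.

Lemma step_out v x : D x -> (N%:R * del <= tau x)%R -> step v x = 0%R.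
Proof.
move=> Dx Nx; have t0 : (0 <= tau x / del)%R by rewrite divr_ge0 ?tau0// ltW.
by rewrite /step insubN// -leqNgt truncn_ge_nat// ler_pdivlMr.
Qed.

Lemma cell_exists x : D x -> (tau x < N%:R * del)%R -> exists i : 'I_N, cell i x.
Proof.
move=> Dx xN; have t0 : (0 <= tau x / del)%R by rewrite divr_ge0 ?tau0// ltW.
have h : (Num.truncn (tau x / del) < N)%N by rewrite truncn_lt_nat// ltr_pdivrMr.
by exists (Ordinal h); apply/mem_cell.
Qed.

Lemma stepP v x : D x -> (exists2 i : 'I_N, cell i x & step v x = v i) \/
  (N%:R * del <= tau x)%R /\ step v x = 0%R.
Proof.
move=> Dx; have [xN|xN] := leP (N%:R * del)%R (tau x).
  by right; rewrite step_out.
by left; have [i ci] := cell_exists Dx xN; exists i => //; exact: step_cell.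
Qed.

Lemma measurable_cell i : measurable (cell i).
Proof.
rewrite /cell (_ : [set x | _] = tau @^-1` `[(i%:R * del)%R, (i.+1%:R * del)%R[%classic).
  exact: mtau.
by apply/seteqP; split => x /=; rewrite in_itv.
Qed.

Lemma measure_cell i : mu (cell i) = del%:E.
Proof.
have mlt := measurable_ucoord_lt mD htau.
have e : mu (D `&` [set x | (tau x < i.+1%:R * del)%R]) =
    mu (D `&` [set x | (tau x < i%:R * del)%R]) + mu (cell i).
  rewrite -measureU//.
  - congr (mu _); apply/seteqP; split => [x [Dx /= h]|x [] [Dx /= h]].
    + by have [h'|h'] := ltP (tau x) (i%:R * del)%R; [left|right; split => //=; rewrite h' h].
    + split => //=; apply: lt_le_trans h _; by rewrite ler_pM2r// ler_nat.
    + by split => //=; case/andP: h.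
  - exact: measurable_cell.
  - apply/seteqP; split => // x [[_ /= h] [_ /= /andP[h' _]]].
    by rewrite ltNge h' in h.
move: e; rewrite !(ucoordE htau) ?mulr_ge0 ?(ltW del0)//.
move=> /(congr1 (fun y => y - (i%:R * del)%:E)).
rewrite addeAC -EFinB -EFinB subrr add0e => <-.
by rewrite -mulrBl -natr1 addrAC subrr add0r mul1r.
Qed.

Lemma trivIset_cell : trivIset setT (cell : 'I_N -> set T).
Proof.
apply/trivIsetP => i j _ _ ij; apply/seteqP; split => // x [ci cj].
have Dx : D x by case: ci.
move/(mem_cell _ Dx) : ci; move/(mem_cell _ Dx) : cj => -> /val_inj ji.
by rewrite ji eqxx in ij.
Qed.

Lemma step_indic v x : D x ->
  (step v x)%:E = \sum_(i < N) (v i)%:E * (\1_(cell i) x)%:E.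
Proof.
move=> Dx; have [[i ci ->]|[xN ->]] := stepP v Dx.
  rewrite (bigD1 i)//= big1 ?adde0; first by rewrite indicE mem_set// mule1.
  move=> j ji; rewrite indicE memNset ?mule0// => cj.
  move/(mem_cell _ Dx) : ci; move/(mem_cell _ Dx) : cj => -> /val_inj ij.
  by rewrite ij eqxx in ji.
rewrite big1// => j _; rewrite indicE memNset ?mule0// => -[_ /= /andP[_ h]].
have : (N%:R * del < j.+1%:R * del)%R by exact: le_lt_trans h.
by rewrite ltr_pM2r// ltr_nat ltnNge ltn_ord.
Qed.

Lemma step_ge0 v x : (forall i, 0 <= v i)%R -> (0 <= step v x)%R.
Proof. by move=> v0; rewrite /step; case: insubP => /=. Qed.

Lemma nonneg_measurable_step v : (forall i, 0 <= v i)%R ->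
  nonneg_measurable D (fun x => (step v x)%:E).
Proof.
move=> v0; split; last by move=> x _; rewrite lee_fin step_ge0.
apply: (@eq_measurable_fun _ _ _ _ _
    (fun x => \sum_(i < N) (v i)%:E * (\1_(cell i) x)%:E)).
  by move=> x; rewrite inE => Dx; rewrite step_indic.
apply: emeasurable_sum => i; apply: emeasurable_funM => //.
by apply/measurable_EFinP; apply: measurable_indic; exact: measurable_cell.
Qed.

Lemma integral_stepM v g : (forall i, 0 <= v i)%R -> nonneg_measurable D g ->
  \int[mu]_(x in D) ((step v x)%:E * g x) =
  \sum_(i < N) (v i)%:E * \int[mu]_(x in cell i) g x.
Proof.
move=> v0 hg.
transitivity (\int[mu]_(x in D) (\sum_(i < N) (v i)%:E * ((\1_(cell i) x)%:E * g x))).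
  apply: eq_integral => x; rewrite inE => Dx; rewrite step_indic//.
  rewrite ge0_sume_distrl; first by apply: eq_bigr => i _; rewrite muleA.
  by move=> i _; rewrite -EFinM lee_fin mulr_ge0// indicE.
have hI (i : 'I_N) : nonneg_measurable D (fun x => (\1_(cell i) x)%:E * g x).
  apply: nonneg_measurableM => //; apply: nonneg_measurable_indic; exact: measurable_cell.
rewrite ge0_integral_sum//.
- apply: eq_bigr => i _; have [m0 i0] := hI i; rewrite ge0_integralZl//; last first.
    by rewrite lee_fin.
  congr (_ * _); have sD : cell i `<=` D by move=> x [].
  rewrite -[in RHS](setIidr sD) integral_mkcondr; apply: eq_integral => x _.
  by rewrite patchE indicE; case: (x \in _); rewrite ?mul1e ?mul0e.
- by move=> i; have [m0 _] := hI i; exact: emeasurable_funM.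
- by move=> i x Dx; have [_ i0] := hI i; rewrite mule_ge0 ?lee_fin ?i0.
Qed.

Lemma dist_step v a : (0 <= a)%R ->
  dist mu D (fun x => (step v x)%:E) a = \sum_(i < N | (a < v i)%R) del%:E.
Proof.
move=> a0; rewrite /dist.
rewrite (_ : _ `&` _ = \big[setU/set0]_(i < N | (a < v i)%R) cell i).
  rewrite (measure_bigsetU_ord mu); first by apply: eq_bigr => i _; exact: measure_cell.
  - by move=> i; exact: measurable_cell.
  - exact: trivIset_cell.
rewrite -bigcup_seq_cond; apply/seteqP; split => [x [Dx /=]|x [i /= hi ci]].
  rewrite lte_fin; have [[i ci ->]|[xN ->]] := stepP v Dx.
    by move=> ai; exists i => //=; rewrite mem_index_enum.
  by rewrite ltNge a0.
have Dx : D x by case: ci.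
by split => //=; rewrite lte_fin (step_cell v ci); case/andP: hi.
Qed.

(** The cells have equal measure. *)
Lemma dist_step_perm (p : 'I_N -> 'I_N) v a : injective p -> (0 <= a)%R ->
  dist mu D (fun x => (step (v \o p) x)%:E) a = dist mu D (fun x => (step v x)%:E) a.
Proof. by move=> pinj a0; rewrite !dist_step// [RHS](reindex_inj pinj). Qed.

Lemma integral_step v : (forall i, 0 <= v i)%R ->
  \int[mu]_(x in D) (step v x)%:E = \sum_(i < N) (v i * del)%:E.
Proof.
move=> v0; have := @integral_stepM v (cst 1) v0.
under eq_integral do rewrite mule1.
move=> ->; last by split => // x _; rewrite lee01.
apply: eq_bigr => i _; rewrite integral_cst; last exact: measurable_cell.
by rewrite measure_cell mul1e EFinM.
Qed.

End step_functions.

(** * Averages over initial segments *)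

Section averaging.
Context d (T : measurableType d) (R : realType).
Variables (mu : {measure set T -> \bar R}) (D : set T).
Hypothesis mD : measurable D.
Variable tau : T -> R.
Hypothesis htau : ucoord mu D tau.
Variable rho : (T -> \bar R) -> \bar R.
Hypothesis hrho : ri_norm mu D rho.
Implicit Types (f g : T -> \bar R) (s t a c : R).
Local Notation lam := (lebesgue_line R).

Definition sublevel s : set T := D `&` [set x | (tau x < s)%R].

Definition sublevel_norm s : \bar R := rho (fun x => (\1_(sublevel s) x)%:E).

Lemma measurable_sublevel s : measurable (sublevel s).
Proof. exact: (measurable_ucoord_lt mD htau). Qed.

Lemma measure_sublevel s : (0 <= s)%R -> mu (sublevel s) = s%:E.
Proof. exact: (ucoordE htau). Qed.

Lemma sublevel_norm_ge0 s : 0 <= sublevel_norm s.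
Proof.
apply: (ri_norm_ge0 hrho); apply: nonneg_measurable_indic; exact: measurable_sublevel.
Qed.

Lemma sublevel_norm_fin s : (0 <= s)%R -> sublevel_norm s \is a fin_num.
Proof.
move=> s0; rewrite ge0_fin_numE ?sublevel_norm_ge0//.
apply: (ri_norm_indic hrho); [exact: measurable_sublevel|exact: subIsetl|].
by rewrite measure_sublevel ?ltry.
Qed.

Lemma sublevel_norm_gt0 s : (0 < s)%R -> 0 < sublevel_norm s.
Proof.
move=> s0; rewrite lt_neqAle eq_sym sublevel_norm_ge0 andbT; apply/eqP => h.
have mE := measurable_sublevel s.
have [+ _] := ri_norm_eq0 hrho (nonneg_measurable_indic R D mE).
move=> /(_ h)[A [mA A0 sA]].
have : mu (sublevel s) <= mu A.
  apply: le_measure; rewrite ?inE//; move=> x Ex; apply: sA => /= /(_ Ex.1).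
  by rewrite indicE mem_set//= => /eqP; rewrite eqe oner_eq0.
by rewrite A0 (measure_sublevel (ltW s0)) lee_fin leNgt s0.
Qed.

Lemma ri_norm_sum (I : Type) (r : seq I) (F : I -> T -> \bar R) :
  (forall i, nonneg_measurable D (F i)) ->
  rho (fun x => \sum_(i <- r) F i x) <= \sum_(i <- r) rho (F i).
Proof.
move=> hF; elim: r => [|i r IH].
  rewrite big_nil (_ : (fun x => _) = fun=> 0); last first.
    by apply/funext => x; rewrite big_nil.
  by rewrite (ri_norm0 hrho).
rewrite big_cons (_ : (fun x => _) = fun x => F i x + \sum_(j <- r) F j x); last first.
  by apply/funext => x; rewrite big_cons.
apply: (le_trans (ri_normD hrho (hF i) _)).
  split; first by apply: emeasurable_sum => j; exact: (hF j).1.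
  by move=> x Dx; apply: sume_ge0 => j _; exact: (hF j).2.
exact: leeD.
Qed.

Lemma ri_norm_rea f : nonneg_measurable D f ->
  rho (fun x => rea (dist mu D f) (tau x)) = rho f.
Proof.
move=> hf; apply: (ri_norm_eq_dist mD hrho) => //.
  exact: (nonneg_measurable_rea mD htau).
by move=> a a0; rewrite (dist_rea mD htau)//; exact: dist_is_dist hf.1.
Qed.

(** Otherwise [f] would not be integrable over sets of finite measure. *)
Lemma rea_lty f t : nonneg_measurable D f -> rho f < +oo -> (0 < t)%R ->
  rea (dist mu D f) t < +oo.
Proof.
move=> hf fo t0; rewrite ltey; apply/eqP => foo.
have [|C hC] := ri_norm_integral hrho (measurable_sublevel t) (@subIsetl _ _ _) _.
  by rewrite measure_sublevel ?ltry// ltW.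
have hr := nonneg_measurable_rea mD htau (dist mu D f).
have := hC _ hr; rewrite ri_norm_rea//.
rewrite (_ : \int[mu]_(x in sublevel t) _ = +oo).
  have ff : rho f \is a fin_num by rewrite ge0_fin_numE// (ri_norm_ge0 hrho).
  by rewrite -(fineK ff) -EFinM.
transitivity (\int[mu]_(x in sublevel t) (cst +oo x : \bar R)).
  apply: eq_integral => x; rewrite inE => -[_ /= xt].
  apply/eqP; rewrite eq_le leey -foo; apply: rea_nincr; exact: ltW.
rewrite integral_cst; last exact: measurable_sublevel.
by rewrite measure_sublevel ?ltW// gt0_mulye.
Qed.

(** Let [v] be the step function below the rearrangement. Its [N.+1] cyclic
    shifts have the same distribution, hence norm at most [rho f], and they
    add up to a constant on the segment. *)
Lemma average_step f s N : nonneg_measurable D f -> rho f < +oo -> (0 < s)%R ->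
  sublevel_norm s *
    \int[lam]_(t in (`[(s / N.+1%:R)%R, s[%classic : set (line R))) rea (dist mu D f) t
  <= s%:E * rho f.
Proof.
move=> hf fo s0; set e := dist mu D f; set del := (s / N.+1%:R)%R.
have d0 : (0 < del)%R by rewrite divr_gt0.
have Ndel : (N.+1%:R * del = s)%R by rewrite mulrC divfK.
have de : is_dist e by exact: dist_is_dist hf.1.
have efin t : (0 < t)%R -> rea e t \is a fin_num.
  by move=> t0; rewrite ge0_fin_numE ?rea_ge0//; exact: rea_lty.
pose v (i : 'I_N.+1) := fine (rea e (i.+1%:R * del)%R).
have v0 i : (0 <= v i)%R by rewrite fine_ge0// rea_ge0.
have rv : rho (fun x => (step tau del v x)%:E) <= rho f.
  rewrite -[leRHS]ri_norm_rea//; apply: (ri_norm_le hrho).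
  - exact: (nonneg_measurable_step mD htau d0).
  - exact: (nonneg_measurable_rea mD htau).
  apply: aeW => x Dx; have [[i ci ->]|[_ ->]] := stepP htau d0 v Dx; last exact: rea_ge0.
  rewrite fineK; last by rewrite efin// mulr_gt0.
  by apply: rea_nincr; case: ci => _ /= /andP[_ /ltW].
pose sh (j i : 'I_N.+1) : 'I_N.+1 := (i + j)%R.
have shI j : injective (sh j) by move=> a b /addIr.
pose S := (\sum_i v i)%R.
have S0 : (0 <= S)%R by apply: sumr_ge0 => i _; exact: v0.
have hS : S%:E * sublevel_norm s <= N.+1%:R%:E * rho f.
  rewrite -(ri_normZ hrho)//; last first.
    by apply: nonneg_measurable_indic; exact: measurable_sublevel.
  pose F (j : 'I_N.+1) x := (step tau del (v \o sh j) x)%:E.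
  have hF j : nonneg_measurable D (F j).
    by apply: (nonneg_measurable_step mD htau d0) => i; exact: v0.
  apply: (@le_trans _ _ (rho (fun x => \sum_(j <- index_enum 'I_N.+1) F j x))).
    apply: (ri_norm_le hrho).
    - apply: nonneg_measurableZ => //; apply: nonneg_measurable_indic.
      exact: measurable_sublevel.
    - split; first by apply: emeasurable_sum => j; exact: (hF j).1.
      by move=> x Dx; apply: sume_ge0 => j _; exact: (hF j).2.
    apply: aeW => x Dx; rewrite indicE.
    have [xs|sx] := ltP (tau x) s; last first.
      rewrite memNset ?mule0; last by move=> [_ /=]; rewrite ltNge sx.
      by apply: sume_ge0 => j _; exact: (hF j).2.
    rewrite mem_set ?mule1//.
    have [i ci] : exists i : 'I_N.+1, cell D tau del i x.
      by apply: (cell_exists htau d0 Dx); rewrite Ndel.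
    rewrite /F (eq_bigr (fun j => (v (sh j i))%:E)); last first.
      by move=> j _; rewrite (step_cell htau d0 _ ci).
    rewrite sumEFin lee_fin /S le_eqVlt (reindex_inj (@addrI _ i)).
    by rewrite /sh eqxx.
  apply: (le_trans (ri_norm_sum _ hF)).
  apply: (@le_trans _ _ (\sum_(j < N.+1) rho f)).
    apply: lee_sum => j _; apply: le_trans rv.
    rewrite le_eqVlt; apply/orP; left; apply/eqP.
    apply: (ri_norm_eq_dist mD hrho) => //.
      exact: (nonneg_measurable_step mD htau d0).
    by move=> a a0; rewrite (dist_step_perm mD htau d0).
  have ff : rho f \is a fin_num by rewrite ge0_fin_numE// (ri_norm_ge0 hrho).
  rewrite -(fineK ff) sumEFin sumr_const card_ord -EFinM lee_fin.
  by rewrite mulr_natl.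
have hI : \int[lam]_(t in (`[del, s[%classic : set (line R))) rea e t <= (S * del)%:E.
  (* The upper Riemann sum with the cell at 0 removed: its values are those of v,
     moved one cell to the right. *)
  pose w (i : 'I_N.+1) := if (nat_of_ord i == 0)%N then 0%R else fine (rea e (i%:R * del)%R).
  have w0 i : (0 <= w i)%R by rewrite /w; case: ifP => // _; rewrite fine_ge0// rea_ge0.
  have mP := @measurable_positives R; have hl := ucoord_line R.
  have hw : nonneg_measurable (@positives R)
      (fun t => (step (fun t : line R => t : R) del w t)%:E).
    exact: (nonneg_measurable_step mP hl d0).
  have sub : `[del, s[ `<=` (@positives R).
    by move=> t /=; rewrite in_itv/= => /andP[dt _]; apply/positivesE; exact: lt_le_trans dt.
  apply: (@le_trans _ _ (\int[lam]_(t in @positives R)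
      (step (fun t : line R => t : R) del w t)%:E)).
    apply: (@le_trans _ _ (\int[lam]_(t in (`[del, s[%classic : set (line R)))
      (step (fun t : line R => t : R) del w t)%:E)).
      apply: ge0_le_integral.
      - by apply: line_measurable; exact: measurable_itv.
      - by move=> t _; exact: rea_ge0.
      - exact: measurable_funS (nonneg_measurable_line_rea e).1.
      - exact: measurable_funS hw.1.
      move=> t /[dup] ts /sub Dt; have [[i ci ->]|[h _]] := stepP hl d0 w Dt.
        case: ci => _ /= /andP[h1 h2].
        have i0 : (nat_of_ord i != 0)%N.
          apply/eqP => i0; move: h2; rewrite i0 mul1r ltNge.
          by move: ts; rewrite /= in_itv/= => /andP[->].
        rewrite /w (negbTE i0) fineK; first exact: rea_nincr.
        by rewrite efin// mulr_gt0// ltr0n lt0n.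
      by move: ts; rewrite /= in_itv/= => /andP[_]; rewrite ltNge -Ndel h.
    apply: ge0_subset_integral.
    - by apply: line_measurable; exact: measurable_itv.
    - exact: mP.
    - exact: hw.1.
    - by move=> t; exact: hw.2.
    - exact: sub.
  rewrite (integral_step mP hl d0)// sumEFin lee_fin -mulr_suml ler_pM2r//.
  rewrite big_ord_recl /w /= add0r /S big_ord_recr /= ler_wpDr//.
apply: (@le_trans _ _ (sublevel_norm s * (S * del)%:E)).
  by apply: lee_wpmul2l => //; exact: sublevel_norm_ge0.
rewrite mulrC EFinM muleCA; apply: (@le_trans _ _ (del%:E * (N.+1%:R%:E * rho f))).
  by apply: lee_wpmul2l; [rewrite lee_fin ltW|rewrite muleC].
by rewrite muleA -EFinM mulrC Ndel.
Qed.

(** The function that is equal to the mean of f^* on an initial segment, and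
    to 0 elsewhere, has at most the norm of [f]. *)
Lemma average_le f s : nonneg_measurable D f -> (0 < s)%R ->
  sublevel_norm s * primitive (dist mu D f) s <= s%:E * rho f.
Proof.
move=> hf s0; have [fo|] := ltP (rho f) +oo; last first.
  by rewrite leye_eq => /eqP ->; rewrite gt0_muley ?lte_fin// leey.
set e := dist mu D f.
pose F N : set (line R) := `[(s / N.+1%:R)%R, s[%classic.
have UF : \bigcup_N F N = `]0%R, s[%classic.
  apply/seteqP; split => [t [N _]|t]; rewrite /F /= !in_itv/= => /andP[h1 h2].
    by rewrite h2 andbT (lt_le_trans _ h1)// divr_gt0.
  have e0 : (0 < t / s)%R by rewrite divr_gt0.
  have [N] := near_infty_natSinv_lt (PosNum e0).
  move=> _ /(_ N (leqnn N)) /= h; exists N => //=; rewrite in_itv/= h2 andbT.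
  by rewrite -ler_pdivlMl// ltW// mulrC.
have sub N : F N `<=` @positives R.
  move=> t /=; rewrite /F /= in_itv/= => /andP[h _]; apply/positivesE.
  by apply: lt_le_trans h; rewrite divr_gt0.
have cF : \int[lam]_(t in F N) rea e t @[N --> \oo] --> primitive e s.
  rewrite /primitive -UF; apply: ge0_nondecreasing_set_cvg_integral.
  - move=> N M NM; apply/subsetPset => t /=; rewrite /F /= !in_itv/= => /andP[h ->].
    rewrite andbT (le_trans _ h)// ler_pM2l// lef_pV2 ?posrE//.
    by rewrite ler_nat.
  - by move=> N; apply: line_measurable; exact: measurable_itv.
  - by move=> N; apply: measurable_funS (nonneg_measurable_line_rea e).1 => //;
      exact: measurable_positives.
  - by move=> N t _; exact: rea_ge0.
have /cvg_lim <-// := cvgeZl (sublevel_norm_fin (ltW s0)) cF.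
apply: lime_le.
  by apply/cvg_ex; eexists; exact: (cvgeZl (sublevel_norm_fin (ltW s0)) cF).
by apply: nearW => N; exact: average_step.
Qed.

End averaging.

(** * Integrability of a power at the origin *)

Section power_integral.
Context (R : realType).
Local Notation D := (@positives R).
Local Notation lam := (lebesgue_line R).
Variable al : R.
Hypotheses (al0 : (0 < al)%R) (al1 : (al < 1)%R).

Lemma powR_nincr (s t : R) : (0 < s)%R -> (s <= t)%R -> (t `^ (al - 1) <= s `^ (al - 1))%R.
Proof.
move=> s0 st; have t0 : (0 < t)%R by exact: lt_le_trans st.
rewrite -(opprB 1%R al) !powRN lef_pV2 ?posrE ?powR_gt0//.
by apply: ge0_ler_powR => //; rewrite ?nnegrE ?subr_ge0; exact: ltW.
Qed.

Let weight (s : line R) : \bar R := ((s : R) `^ (al - 1))%:E.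

Let mweight : measurable_fun D weight.
Proof. exact: measurable_funTS (measurable_weight al). Qed.

(** On the dyadic interval from [q ^+ k.+1] to [q ^+ k] the weight is at most
    [u ^+ k.+1], which bounds the integral by a term of a geometric series
    with ratio [r = q `^ al]. *)
Lemma integral_weight_lty :
  \int[lam]_(s in (`]0%R, 1%R[%classic : set (line R))) weight s < +oo.
Proof.
pose q : R := (2^-1)%R; pose u : R := (q `^ (al - 1))%R; pose r : R := (u * q)%R.
have q0 : (0 < q)%R by rewrite invr_gt0.
have qh : (q = 1 - q)%R by rewrite /q; lra.
have rE : r = (q `^ al)%R.
  rewrite /r /u -{2}(powRr1 (ltW q0)) -powRD ?subrK//.
  by apply/implyP => _; rewrite gt_eqF.
have r0 : (0 < r)%R by rewrite rE powR_gt0.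
have r1 : (r < 1)%R.
  have <- : (1 `^ al = 1 :> R)%R by rewrite powR1.
  rewrite rE; apply: gt0_ltr_powR; rewrite ?nnegrE ?(ltW q0)//.
  by rewrite /q invf_lt1// ltr1n.
have u0 : (0 < u)%R by rewrite powR_gt0.
have qn k : (0 < q ^+ k)%R by rewrite exprn_gt0.
have uk k : ((q ^+ k) `^ (al - 1) = u ^+ k)%R.
  elim: k => [|k IH]; first by rewrite !expr0 powR1.
  by rewrite !exprS powRM ?IH// ltW.
pose C : R := (r / (1 - r))%R.
have r1' : (0 < 1 - r)%R by rewrite subr_gt0.
have C0 : (0 <= C)%R by rewrite divr_ge0// ltW.
have sub (a b : R) : (0 < a)%R -> `[a, b[ `<=` D.
  move=> a0 t /=; rewrite in_itv/= => /andP[h _]; apply/positivesE; exact: lt_le_trans h.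
have mi (a b : R) : measurable (`[a, b[%classic : set (line R)).
  by apply: line_measurable; exact: measurable_itv.
have mD := @measurable_positives R.
have w0 t : 0 <= weight t by rewrite lee_fin powR_ge0.
pose F k : set (line R) := `[(q ^+ k)%R, 1%R[%classic.
have piece k : \int[lam]_(s in (`[(q ^+ k.+1)%R, (q ^+ k)%R[%classic : set (line R))) weight s
    <= (r ^+ k.+1)%:E.
  apply: (@le_trans _ _ (\int[lam]_(s in (`[(q ^+ k.+1)%R, (q ^+ k)%R[%classic : set (line R)))
      (cst (u ^+ k.+1)%:E s))).
    apply: ge0_le_integral.
    - exact: mi.
    - by move=> t _; exact: w0.
    - by apply: measurable_funS mweight; [exact: mD|exact: sub].
    - exact: measurable_cst.
    - move=> t /=; rewrite in_itv/= => /andP[h _].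
      by rewrite -uk lee_fin; exact: powR_nincr.
  rewrite integral_cst; last exact: mi.
  rewrite lebesgue_lineE lebesgue_measure_itv/= lte_fin.
  have qk : (q ^+ k.+1 < q ^+ k)%R by rewrite exprS gtr_pMl// /q invf_lt1// ltr1n.
  rewrite qk -EFinB -EFinM lee_fin /r exprMn ler_pM2l ?exprn_gt0//.
  have e : (q ^+ k = q * q ^+ k + q * q ^+ k)%R.
    have q2 : (q + q = 1)%R by move: qh; lra.
    by rewrite -mulrDl q2 mul1r.
  by rewrite exprS; lra.
have bnd k : \int[lam]_(s in F k) weight s <= (C * (1 - r ^+ k))%:E.
  elim: k => [|k IH].
    rewrite /F expr0 set_itvco0 integral_set0 subrr mulr0//.
  rewrite (_ : F k.+1 = `[(q ^+ k.+1)%R, (q ^+ k)%R[%classic `|` F k); last first.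
    rewrite /F; apply/seteqP; split => t; rewrite /= !in_itv/=.
      move=> /andP[h1 h2]; have [h3|h3] := ltP t (q ^+ k)%R.
        by left; rewrite h1.
      by right; rewrite h2.
    have qk : (q ^+ k.+1 <= q ^+ k)%R by rewrite exprS ger_pMl// /q invf_le1// ler1n.
    have qk1 : (q ^+ k <= 1)%R by rewrite exprn_ile1// ltW// /q invf_lt1// ltr1n.
    case=> /andP[h1 h2]; first by rewrite h1 (lt_le_trans h2).
    by rewrite h2 andbT (le_trans qk).
  rewrite ge0_integral_setU.
  - apply: (le_trans (leeD (piece k) IH)); rewrite -EFinD lee_fin.
    have CE : (C * (1 - r) = r)%R by rewrite divfK// gt_eqF.
    rewrite exprS; have e : (r * r ^+ k = C * r ^+ k - C * (r * r ^+ k))%R.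
      by rewrite -{1}CE; ring.
    by rewrite !mulrBr !mulr1; lra.
  - exact: mi.
  - exact: mi.
  - apply: measurable_funS mweight; first exact: mD.
    by move=> t [|]; apply: sub.
  - by move=> t _; exact: w0.
  - apply/disj_setPS => t []; rewrite /F /= !in_itv/= => /andP[_ h1] /andP[h2 _].
    by rewrite ltNge h2 in h1.
have UF : \bigcup_k F k = `]0%R, 1%R[%classic.
  apply/seteqP; split => [t [k _]|t]; rewrite /F /= !in_itv/= => /andP[h1 h2].
    by rewrite h2 andbT (lt_le_trans _ h1).
  have cq : (q ^+ k)%R @[k --> \oo] --> (0 : R)%R.
    by apply: cvg_expr; rewrite ger0_norm ?ltW// /q invf_lt1// ltr1n.
  have [k _ hk] := cvgr_lt _ cq _ h1.
  by exists k => //=; rewrite in_itv/= h2 andbT; apply: ltW; apply: (hk k) => /=.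
apply: (@le_lt_trans _ _ C%:E); last exact: ltry.
have cF : \int[lam]_(s in F k) weight s @[k --> \oo] -->
    \int[lam]_(s in (`]0%R, 1%R[%classic : set (line R))) weight s.
  rewrite -UF; apply: ge0_nondecreasing_set_cvg_integral.
  - move=> k l kl; apply/subsetPset => t; rewrite /F /= !in_itv/= => /andP[h ->].
    by rewrite andbT (le_trans _ h)// ler_wiXn2l// ?(ltW q0)// ltW// /q invf_lt1// ltr1n.
  - by move=> k; exact: mi.
  - by move=> k; apply: measurable_funS mweight; [exact: mD|exact: sub].
  - by move=> k t _; exact: w0.
have /cvg_lim <-// := cF; apply: lime_le; first by apply/cvg_ex; eexists; exact: cF.
apply: nearW => k; apply: le_trans (bnd k) _; rewrite lee_fin ler_piMr//.
by rewrite gerBl exprn_ge0// ltW.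
Qed.

End power_integral.

(** * Sigma as a supremum of pairings *)

Lemma integral_nincr (R : realType) (f g : line R -> \bar R) :
  nonneg_measurable (@positives R) f -> nonneg_measurable (@positives R) g ->
  (forall s t : R, (0 < s)%R -> (s <= t)%R -> f t <= f s) ->
  (forall s t : R, (0 < s)%R -> (s <= t)%R -> g t <= g s) ->
  \int[lebesgue_line R]_(s in @positives R) (f s * g s) =
  pairing (dist (lebesgue_line R) (@positives R) f) (dist (lebesgue_line R) (@positives R) g).
Proof.
move=> hf hg fn gn; apply: (integral_comonotone _ (@measurable_positives R)) => //.
apply: (comonotone_along (tau := fun t : line R => t : R)) => x y /positivesE x0 _ xy.
- exact: fn.
- exact: gn.
Qed.

Lemma nonneg_measurable_abs d (T : measurableType d) (R : realType) (A : set T) (f : T -> \bar R) :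
  measurable_fun A f -> nonneg_measurable A (fun x => `|f x|).
Proof. by move=> mf; split=> [|x _]; [exact: measurableT_comp|exact: abse_ge0]. Qed.

Section representation.
Context (R : realType) (n : nat).
Hypothesis n0 : (0 < n)%N.
Local Notation mu := (lebesgue_Rn R n).
Local Notation D := (@positives R).
Local Notation lam := (lebesgue_line R).
Variable rhoX : (Rn R n -> \bar R) -> \bar R.
Hypothesis hX : ri_norm_Rn rhoX.
Implicit Types (f : Rn R n -> \bar R) (g h : line R -> \bar R) (s t a c : R).

Local Notation W := (unit_dists mu setT rhoX).
Let mT : measurable (setT : set (Rn R n)) := measurableT.
Let hT := ucoord_Rn R n0.
Let mP := @measurable_positives R.
Let hP := ucoord_line R.

Let W_dist w : W w -> is_dist w. Proof. exact: (unit_dists_is_dist mT). Qed.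

Lemma ri_norm_representation : ri_norm_positives (pairing_norm lam D W).
Proof.
apply: (ri_norm_pairing_norm mP hP); first exact: W_dist.
- exact: (unit_dists_bounded mT hT hX).
- exact: (unit_dists_large mT hT hX).
Qed.

(** A witness is the norm over the half-line given by the same distribution
    functions. *)
Lemma representation_norm_spec :
  ri_norm_positives (representation_norm (associate_norm mu setT rhoX)) /\
  forall f, measurable_fun setT f -> space_norm (associate_norm mu setT rhoX) f =
    space_norm (representation_norm (associate_norm mu setT rhoX))
      (rearrangement mu setT f).
Proof.
rewrite /representation_norm.
apply: (@xgetPex _ (fun=> 0) [set rbar | ri_norm_positives rbar /\
    forall f : Rn R n -> \bar R, measurable_fun setT f ->
      space_norm (associate_norm mu setT rhoX) f =
      space_norm rbar (rearrangement mu setT f)]).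
exists (pairing_norm lam D W); split; first exact: ri_norm_representation.
move=> f mf; rewrite /space_norm (associate_normE mT hT hX); last exact: nonneg_measurable_abs.
have df := dist_is_dist mu mT (nonneg_measurable_abs mf).1.
apply/eqP; rewrite eq_le; apply/andP; split; apply: ge_ereal_sup => _ [w Ww <-];
  (apply: le_trans (ereal_sup_ubound _); last by exists w);
  apply: le_pairing => // a a0; rewrite le_eqVlt; apply/orP; left; apply/eqP.
- rewrite -(dist_rea mP hP df (ltW a0)); apply: eq_dist => t _.
  by rewrite rearrangementE gee0_abs// rea_ge0.
- rewrite -(dist_rea mP hP df (ltW a0)); apply: eq_dist => t _.
  by rewrite rearrangementE gee0_abs// rea_ge0.
Qed.

(** The norm of [g] is determined by the norm of a function on R^n that is
    equimeasurable with [g]. *)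
Lemma representation_normE g : nonneg_measurable D g ->
  space_norm (representation_norm (associate_norm mu setT rhoX)) g =
  pairing_norm lam D W g.
Proof.
move=> hg; have [hr hs] := representation_norm_spec.
set rb := representation_norm _ in hr hs *.
have dg := dist_is_dist lam mP hg.1.
pose f x := rea (dist lam D g) (@cube_volume R n x).
have hf : nonneg_measurable setT f by exact: (nonneg_measurable_rea mT hT).
have df a : (0 <= a)%R -> dist mu setT (fun x => `|f x|) a = dist lam D g a.
  move=> a0; rewrite -(dist_rea mT hT dg a0); apply: eq_dist => x _.
  by rewrite gee0_abs// rea_ge0.
have fE : space_norm (associate_norm mu setT rhoX) f = pairing_norm lam D W g.
  rewrite /space_norm (associate_normE mT hT hX); last exact: (nonneg_measurable_abs hf.1).
  apply/eqP; rewrite eq_le; apply/andP; split; apply: ge_ereal_sup => _ [w Ww <-];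
    (apply: le_trans (ereal_sup_ubound _); last by exists w);
    by apply: le_pairing => // a a0; rewrite df// ltW.
rewrite -fE (hs f hf.1) /space_norm.
apply: (ri_norm_eq_dist mP hr).
- exact: (nonneg_measurable_abs hg.1).
- apply: nonneg_measurable_abs.
  rewrite (_ : rearrangement mu setT f = rea (dist mu setT (fun x => `|f x|))) //.
  exact: (nonneg_measurable_line_rea _).1.
- move=> a a0; transitivity (dist lam D g a).
    by apply: eq_dist => t; rewrite inE => Dt; rewrite gee0_abs//; exact: hg.2.
  rewrite -{1}(dist_rea mP hP dg a0); apply: eq_dist => t _.
  rewrite rearrangementE gee0_abs ?rea_ge0//.
  by congr (_ t); apply: eq_rea => b b0; rewrite df// ltW.
Qed.

Variable gamma : R.
Let al := (gamma / n%:R)%R.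

Definition hardy_dists : set (R -> \bar R) := [set dist lam D (hardy al w) | w in W].

Lemma hardy_dists_is_dist w : hardy_dists w -> is_dist w.
Proof.
move=> [e _ <-]; exact: (dist_is_dist lam mP (nonneg_measurable_hardy al e).1).
Qed.

(** [dual_hardy] produces decreasing functions, so that the pairing is an
    integral and the operator moves to the other factor. *)
Lemma pairing_dual_hardy h w : nonneg_measurable D h -> is_dist w ->
  pairing (dist lam D (dual_hardy al h)) w = \int[lam]_(s in D) (h s * hardy al w s).
Proof.
move=> hh dw; rewrite -integral_dual_hardy//.
have hd := nonneg_measurable_dual_hardy al hh.
have hw := nonneg_measurable_line_rea w.
rewrite (integral_nincr hd hw).
- by apply: eq_pairing => // a a0; rewrite (dist_rea mP hP dw (ltW a0)).
- by move=> s t s0; apply: dual_hardy_nincr => //; exact: ltW.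
- by move=> s t _; exact: rea_nincr.
Qed.

(** Once [dual_hardy] has been moved to the other factor, [h] is integrated
    against a fixed function; the supremum over all [h] equimeasurable with
    [f] is then given by resonance. *)
Lemma sigma_normE f : nonneg_measurable setT f ->
  sigma_norm gamma rhoX f = pairing_norm mu setT hardy_dists f.
Proof.
move=> hf; have df := dist_is_dist mu mT hf.1.
apply/eqP; rewrite eq_le; apply/andP; split.
  apply: ge_ereal_sup => _ [h [hh he] <-].
  have {}he := (equimeasurableP lam mu mP mT hh hf).1 he.
  rewrite -/(dual_hardy al h) representation_normE; last first.
    exact: nonneg_measurable_dual_hardy.
  apply: ge_ereal_sup => _ [w Ww <-]; rewrite pairing_dual_hardy//; last exact: W_dist.
  apply: (@le_trans _ _ (pairing (dist mu setT f) (dist lam D (hardy al w)))); last first.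
    by apply: ereal_sup_ubound; exists (dist lam D (hardy al w)) => //; exists w.
  apply: le_trans (integral_le_pairing lam mP hh (nonneg_measurable_hardy al w)) _.
  by apply: le_pairing => // a a0; rewrite he// ltW.
apply: ge_ereal_sup => _ [_ [w Ww <-] <-].
rewrite -(resonance mP hP df (nonneg_measurable_hardy al w)).
apply: ge_ereal_sup => _ [h [hh he] <-].
rewrite -pairing_dual_hardy//; last exact: W_dist.
apply: (@le_trans _ _ (pairing_norm lam D W (dual_hardy al h))).
  by apply: ereal_sup_ubound; exists w.
rewrite -representation_normE; last exact: nonneg_measurable_dual_hardy.
apply: ereal_sup_ubound; exists h => //; split => //.
exact/(equimeasurableP lam mu mP mT hh hf).
Qed.

Hypothesis al1 : (al < 1)%R.

(** The rearrangement of some element of the unit ball is bounded below on ]0,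
    1[, hence its Hardy transform on the interval ]1, m + 1[ of length [m]. *)
Lemma hardy_dists_large (m : \bar R) : 0 <= m -> m < +oo ->
  exists2 w, hardy_dists w & exists2 c, (0 < c)%R & m <= w c.
Proof.
case: m => [m| |]// m0 _; rewrite lee_fin in m0.
have [e We [c c0 ec]] := unit_dists_large mT hT hX lee01 (ltry 1).
have de := W_dist We.
exists (dist lam D (hardy al e)); first by exists e.
have hrea t : (0 < t)%R -> (t < 1)%R -> (c / 2)%:E <= rea e t.
  move=> t0 t1; apply: ltW; rewrite rea_lt//; last by rewrite divr_ge0// ltW.
  apply: lt_le_trans (is_dist_nincr de _ (_ : c / 2 <= c)%R).
  - by apply: lt_le_trans ec; rewrite lte_fin.
  - by rewrite divr_ge0// ltW.
  - by rewrite ler_pdivrMr// ler_peMr ?ler1n// ltW.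
have P1 : (c / 2)%:E <= primitive e 1.
  apply: (@le_trans _ _ (\int[lam]_(t in (`]0%R, 1%R[%classic : set (line R))) (cst (c / 2)%:E t))).
    rewrite integral_cst; last by apply: line_measurable; exact: measurable_itv.
    rewrite lebesgue_lineE lebesgue_measure_itv/= lte_fin ltr01 -EFinB subr0.
    by rewrite mule1.
  apply: ge0_le_integral.
  - by apply: line_measurable; exact: measurable_itv.
  - by move=> t _; rewrite lee_fin divr_ge0// ltW.
  - exact: measurable_cst.
  - apply: measurable_funS (nonneg_measurable_line_rea e).1; first exact: mP.
    exact: subset_positives.
  - by move=> t /=; rewrite in_itv/= => /andP[t0 t1]; exact: hrea.
have m1 : (0 < m + 1)%R by rewrite ltr_wpDl.
pose k : R := ((m + 1) `^ (al - 1) * (c / 2))%R.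
have k0 : (0 < k)%R by rewrite mulr_gt0// ?powR_gt0// divr_gt0.
exists (k / 2)%R; first by rewrite divr_gt0.
have mE : lam `]1%R, (m + 1)%R[%classic = m%:E.
  rewrite lebesgue_lineE lebesgue_measure_itv/= lte_fin ltrDr -EFinB addrK.
  by case: ifPn => //; rewrite -leNgt => m0'; congr EFin; apply/eqP; rewrite eq_le m0.
rewrite -mE; apply: le_measure; rewrite ?inE.
- by apply: line_measurable; exact: measurable_itv.
- by apply: measurable_levelset => //; exact: (nonneg_measurable_hardy al e).1.
move=> s /=; rewrite in_itv/= => /andP[s1 sm]; have s0 : (0 < s)%R by apply: lt_trans s1.
split; first exact/positivesE.
apply: (@lt_le_trans _ _ k%:E).
  by rewrite lte_fin ltr_pdivrMr// ltr_pMr// ltr1n.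
rewrite /k EFinM /hardy; apply: lee_pmul.
- by rewrite lee_fin powR_ge0.
- by rewrite lee_fin divr_ge0// ltW.
- by rewrite lee_fin; apply: (powR_nincr al1 s0); exact: ltW.
- by apply: le_trans P1 _; apply: primitive_ndecr; exact: ltW.
Qed.

End representation.

(** * Sigma is an r.i. norm *)

Section sigma_is_ri_norm.
Context (R : realType) (n : nat).
Hypothesis n0 : (0 < n)%N.
Local Notation mu := (lebesgue_Rn R n).
Local Notation D := (@positives R).
Local Notation lam := (lebesgue_line R).
Local Notation tau := (@cube_volume R n).
Variable rhoX : (Rn R n -> \bar R) -> \bar R.
Hypothesis hX : ri_norm_Rn rhoX.
Implicit Types (f : Rn R n -> \bar R) (g h : line R -> \bar R) (s t a c : R).
Local Notation W := (unit_dists mu setT rhoX).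
Local Notation varphi := (sublevel_norm setT tau rhoX).
Let mT : measurable (setT : set (Rn R n)) := measurableT.
Let hT := ucoord_Rn R n0.
Let mP := @measurable_positives R.
Let hP := ucoord_line R.
Variable gamma : R.
Let al := (gamma / n%:R)%R.

Lemma fundamental_functionE t : (0 <= t)%R ->
  fundamental_function mu setT rhoX t = varphi t.
Proof.
move=> t0; rewrite /fundamental_function.
set P := [set E : set (Rn R n) | _].
have [mE _ tE] : P (xget set0 P).
  apply: (@xgetPex _ set0 P); exists (sublevel setT tau t); split => //.
    exact: (measurable_sublevel mT hT).
  exact: (measure_sublevel hT).
apply: (ri_norm_eq_dist mT hX).
- exact: nonneg_measurable_indic.
- apply: nonneg_measurable_indic; exact: (measurable_sublevel mT hT).
- have eqb (E : set (Rn R n)) a : dist mu setT (fun x => (\1_E x)%:E) a =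
      dist mu setT (fun x => (1 * \1_E x)%:E) a.
    by apply: eq_dist => x _; rewrite mul1r.
  move=> a a0; rewrite !eqb !dist_indic//.
  by rewrite tE (measure_sublevel hT).
Qed.

Hypotheses (al0 : (0 < al)%R) (al1 : (al < 1)%R).
Variable cA : R.
Hypothesis cA0 : (0 < cA)%R.
Hypothesis hA : forall t, (1 <= t)%R -> (cA * t `^ al)%:E <= varphi t.

(** The growth of the fundamental function enters here, through [average_le]. *)
Lemma primitive_le w s : W w -> (1 <= s)%R ->
  primitive w s <= (cA^-1 * s `^ (1 - al))%:E.
Proof.
move=> [f [hf f1] <-] s1; have s0 : (0 < s)%R by exact: lt_le_trans s1.
have h1 := average_le mT hT hX hf s0.
have sa : (0 < s `^ al)%R by rewrite powR_gt0.
have h2 : (cA * s `^ al)%:E * primitive (dist mu setT f) s <= s%:E.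
  apply: (@le_trans _ _ (varphi s * primitive (dist mu setT f) s)).
    by apply: lee_wpmul2r; [exact: primitive_ge0|exact: hA].
  apply: (le_trans h1); rewrite -[leRHS]mule1; apply: lee_wpmul2l => //.
  by rewrite lee_fin ltW.
have ->: (cA^-1 * s `^ (1 - al) = (cA * s `^ al)^-1 * s)%R.
  rewrite powRD; last by apply/implyP => _; rewrite gt_eqF.
  by rewrite powRr1 ?ltW// powRN invfM; ring.
rewrite EFinM; have k0 : (0 < cA * s `^ al)%R by rewrite mulr_gt0.
rewrite -[leLHS]mul1e -(mulVf (lt0r_neq0 k0)) EFinM -muleA.
by apply: lee_wpmul2l => //; rewrite lee_fin invr_ge0 ltW.
Qed.

(** Decreasing and integrable at the origin. *)
Definition hardy_majorant s : \bar R := (cA^-1 * Num.max 1 (s `^ (al - 1)))%:E.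

Lemma hardy_le_majorant w s : W w -> (0 < s)%R -> hardy al w s <= hardy_majorant s.
Proof.
move=> Ww s0; have ci0 : (0 <= cA^-1)%R by rewrite invr_ge0 ltW.
rewrite /hardy /hardy_majorant; have [s1|s1] := leP 1%R s.
  apply: (@le_trans _ _ ((s `^ (al - 1))%:E * (cA^-1 * s `^ (1 - al))%:E)).
    by apply: lee_wpmul2l; [rewrite lee_fin powR_ge0|exact: primitive_le].
  rewrite -EFinM lee_fin mulrCA ler_wpM2l// -powRD; last first.
    by apply/implyP => _; rewrite gt_eqF.
  by rewrite addrA subrK subrr powRr0 le_max lexx.
apply: (@le_trans _ _ ((s `^ (al - 1))%:E * (cA^-1)%:E)).
  apply: lee_wpmul2l; first by rewrite lee_fin powR_ge0.
  apply: (@le_trans _ _ (primitive w 1)); first by apply: primitive_ndecr; exact: ltW.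
  by have := primitive_le Ww (lexx 1%R); rewrite powR1 mulr1.
by rewrite -EFinM lee_fin mulrC ler_wpM2l// le_max lexx orbT.
Qed.

(** The majorant is integrable over ]0, m[. *)
Lemma hardy_dists_bounded (m : \bar R) : 0 <= m -> m < +oo ->
  ereal_sup [set pairing (box m 1) w | w in hardy_dists rhoX gamma] < +oo.
Proof.
case: m => [m| |]// m0 _; rewrite lee_fin in m0.
have ci0 : (0 <= cA^-1)%R by rewrite invr_ge0 ltW.
have mW := measurable_weight al.
have hM : nonneg_measurable D (fun s : line R => hardy_majorant s).
  split; last by move=> s _; rewrite lee_fin mulr_ge0// le_max ler01.
  apply: measurable_funTS; apply: line_measurable_fun.
  apply/measurable_EFinP; apply: measurable_funM => //; apply: measurable_maxr => //.
pose I a b : set (line R) := `]a, b[%classic.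
have mI a b : measurable (I a b) by apply: line_measurable; exact: measurable_itv.
have ID b : I 0%R b `<=` D by exact: subset_positives.
have hI b : nonneg_measurable D (fun s => (\1_(I 0%R b) s : R)%:E).
  exact: nonneg_measurable_indic.
have lI : lam (I 0%R m) = m%:E.
  rewrite lebesgue_lineE lebesgue_measure_itv/= lte_fin -EFinB subr0.
  by case: ifPn => //; rewrite -leNgt => m0'; congr EFin; apply/eqP; rewrite eq_le m0.
(* on ]0, m[ the maximum is at most the power restricted to ]0, 1[, plus 1 *)
pose K : \bar R := cA^-1%:E *
  (\int[lam]_(s in I 0%R 1%R) ((s : R) `^ (al - 1))%:E + m%:E).
have hw01 : nonneg_measurable D
    (fun s : line R => (\1_(I 0%R 1%R) s)%:E * ((s : R) `^ (al - 1))%:E).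
  apply: (nonneg_measurableM (hI 1%R)); split; first exact: (measurable_funTS mW).
  by move=> s _; rewrite lee_fin powR_ge0.
have Koo : K < +oo.
  have := integral_weight_lty al0 al1.
  rewrite -/(I 0%R 1%R) /K.
  have : 0 <= \int[lam]_(s in I 0%R 1%R) ((s : R) `^ (al - 1))%:E.
    by apply: integral_ge0 => s _; rewrite lee_fin powR_ge0.
  by case: (\int[lam]_(s in I 0%R 1%R) _) => // r _ _; rewrite -EFinD -EFinM ltry.
apply: le_lt_trans Koo; apply: ge_ereal_sup => _ [_ [w Ww <-] <-].
apply: (@le_trans _ _ (\int[lam]_(s in D) ((\1_(I 0%R m) s)%:E * hardy_majorant s))).
  rewrite (integral_nincr (hI m) hM).
  - apply: le_pairing => a a0.
      rewrite -lI -(dist_indic lam 1 (ID m) (ltW a0)).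
      rewrite le_eqVlt; apply/orP; left; apply/eqP.
      by apply: eq_dist => s _; rewrite mul1r.
    apply: le_dist.
    + exact: mP.
    + exact: (nonneg_measurable_hardy al w).1.
    + exact: hM.1.
    + by apply: aeW => s /positivesE s0; exact: hardy_le_majorant.
  - move=> s t s0 st; rewrite lee_fin !indicE ler_nat.
    have [|_] := boolP (t \in I 0%R m); last by [].
    rewrite inE /I /= in_itv/= => /andP[_ tm]; rewrite mem_set//= in_itv/= s0.
    exact: le_lt_trans tm.
  - move=> s t s0 st; rewrite lee_fin ler_wpM2l// ge_max le_max lexx/=.
    by rewrite le_max powR_nincr ?orbT.
apply: (@le_trans _ _ (\int[lam]_(s in D) (cA^-1%:E *
    ((\1_(I 0%R 1%R) s)%:E * ((s : R) `^ (al - 1))%:E + (\1_(I 0%R m) s)%:E)))).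
  apply: ge0_le_integral.
  - exact: mP.
  - by move=> s Ds; exact: (nonneg_measurableM (hI m) hM).2.
  - exact: (nonneg_measurableM (hI m) hM).1.
  - exact: (nonneg_measurableZ ci0 (nonneg_measurableD hw01 (hI m))).1.
  move=> s /positivesE s0.
  suff h : (\1_(I 0%R m) s * (cA^-1 * Num.max 1 ((s : R) `^ (al - 1))) <=
      cA^-1 * (\1_(I 0%R 1%R) s * (s : R) `^ (al - 1) + \1_(I 0%R m) s))%R.
    by rewrite -lee_fin in h.
  rewrite mulrCA ler_wpM2l//.
  have p1 : (1 `^ (al - 1) = 1 :> R)%R by rewrite powR1.
  rewrite !indicE; have [s1|s1] := leP 1%R s.
    have : ((s : R) `^ (al - 1) <= 1)%R.
      by rewrite -[leRHS]p1; exact: powR_nincr.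
    move=> h; rewrite max_l// mulr1 lerDr mulr_ge0// powR_ge0.
    by [].
  have -> : (s \in I 0%R 1%R) by rewrite inE /I /= in_itv/= s0.
  rewrite mul1r; have h : (1 <= (s : R) `^ (al - 1))%R.
    by rewrite -[leLHS]p1; apply: powR_nincr => //; exact: ltW.
  rewrite max_r//; case: (s \in _); rewrite ?mul1r ?mul0r; first by rewrite lerDl.
  by rewrite addr0 (le_trans _ h).
rewrite ge0_integralZl; last 4 first.
- exact: mP.
- exact: (nonneg_measurableD hw01 (hI m)).1.
- by move=> s Ds; exact: (nonneg_measurableD hw01 (hI m)).2.
- by rewrite lee_fin.
apply: lee_wpmul2l; first by rewrite lee_fin.
rewrite ge0_integralD; last 5 first.
- exact: mP.
- exact: hw01.2.
- exact: hw01.1.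
- exact: (hI m).2.
- exact: (hI m).1.
rewrite integral_indic//.
rewrite setIidl; last exact: ID.
rewrite lI; apply: leeD => //.
rewrite -[in leRHS](setIidr (ID 1%R)) integral_mkcondr le_eqVlt; apply/orP; left.
apply/eqP; apply: eq_integral => s _; rewrite patchE indicE.
by case: (s \in I 0%R 1%R); rewrite ?mulr1n ?mulr0n ?mul1e ?mul0e.
Qed.

Lemma ri_norm_sigma : ri_norm_Rn (sigma_norm gamma rhoX : (Rn R n -> \bar R) -> \bar R).
Proof.
have E f : nonneg_measurable setT f ->
    pairing_norm mu setT (hardy_dists rhoX gamma) f = sigma_norm gamma rhoX f.
  by move=> hf; rewrite (sigma_normE n0 hX).
apply: (eq_ri_norm E).
apply: (ri_norm_pairing_norm mT hT).
- exact: (hardy_dists_is_dist).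
- exact: hardy_dists_bounded.
- exact: (hardy_dists_large n0 hX).
Qed.

End sigma_is_ri_norm.

(** * The fractional maximal operator *)

Lemma nonneg_measurable_indic1 d (T : measurableType d) (R : realType) (A U : set T) :
  measurable U -> nonneg_measurable A (fun x => (1 * \1_U x : R)%:E).
Proof.
move=> mU; have -> : (fun x => (1 * \1_U x : R)%:E) = (fun x => (\1_U x : R)%:E).
  by apply/funext => x; rewrite mul1r.
exact: nonneg_measurable_indic.
Qed.

Section maximal_operator.
Context (R : realType) (n : nat).
Hypothesis n0 : (0 < n)%N.
Local Notation mu := (lebesgue_Rn R n).
Local Notation D := (@positives R).
Local Notation lam := (lebesgue_line R).
Implicit Types (f : Rn R n -> \bar R) (s t c l r : R) (a : n.-tuple R).
Let mT : measurable (setT : set (Rn R n)) := measurableT.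
Let hT := ucoord_Rn R n0.
Let mP := @measurable_positives R.
Let hP := ucoord_line R.
Variable gamma : R.
Let al := (gamma / n%:R)%R.
Hypotheses (al0 : (0 < al)%R) (al1 : (al < 1)%R).

Definition cube_weight l : R := ((l ^+ n) `^ (1 - al))%R.

Definition cube_mean f a l : \bar R :=
  (cube_weight l)^-1%:E * \int[mu]_(y in cube a l) `|f y|.

Lemma cube_weight_gt0 l : (0 < l)%R -> (0 < cube_weight l)%R.
Proof. by move=> l0; rewrite powR_gt0// exprn_gt0. Qed.

Lemma fractional_maximalE f x : fractional_maximal gamma f x =
  ereal_sup [set cube_mean f q.1 q.2 | q in
    [set q : n.-tuple R * R | (0 < q.2)%R /\ cube q.1 q.2 x]].
Proof.
rewrite /fractional_maximal; congr ereal_sup; apply/seteqP.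
split=> [_ [Q [a [l [l0 -> Qx]]] <-]|_ [[a l] /= [l0 Qx] <-]].
  exists (a, l) => //=.
  by rewrite /cube_mean /cube_weight lebesgue_Rn_cube ?ltW.
exists (cube a l); first by exists a, l.
by rewrite /cube_mean /cube_weight lebesgue_Rn_cube ?ltW.
Qed.

Lemma cube_mean_le_maximal f a l x : (0 < l)%R -> cube a l x ->
  cube_mean f a l <= fractional_maximal gamma f x.
Proof. by move=> l0 Qx; rewrite fractional_maximalE; apply: ereal_sup_ubound; exists (a, l). Qed.

Lemma cube_mean_ge0 f a l : (0 < l)%R -> 0 <= cube_mean f a l.
Proof.
move=> l0; rewrite mule_ge0//; first by rewrite lee_fin invr_ge0 ltW// cube_weight_gt0.
exact: integral_ge0.
Qed.

Lemma fractional_maximal_ge0 f x : 0 <= fractional_maximal gamma f x.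
Proof.
have xx : cube x 1%R x by move=> i; rewrite lexx lerDl ler01.
exact: le_trans (cube_mean_ge0 f x ltr01) (cube_mean_le_maximal f ltr01 xx).
Qed.

Lemma subset_cube a a' l l' : (forall i, tnth a' i <= tnth a i)%R ->
  (forall i, tnth a i + l <= tnth a' i + l')%R -> (cube a l `<=` cube a' l').
Proof.
move=> h1 h2 x h i; have /andP[h3 h4] := h i.
by rewrite (le_trans (h1 i))//= (le_trans h4).
Qed.

Lemma lt_cube_mean f a l c : (0 < l)%R -> measurable_fun setT f ->
  (c%:E < cube_mean f a l) = ((c * cube_weight l)%:E < \int[mu]_(y in cube a l) `|f y|).
Proof.
move=> l0 mf; rewrite /cube_mean; have w0 := cube_weight_gt0 l0.
case: (\int[mu]_(y in _) _) => [r| |].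
- by rewrite -EFinM !lte_fin mulrC ltr_pdivlMr.
- by rewrite gt0_muley ?ltry// lte_fin invr_gt0.
- by rewrite gt0_muleNy ?lte_fin ?invr_gt0.
Qed.

(** The weight is continuous in the side length, so that the mean stays above
    [c] on a slightly larger cube; this leaves room for a rational corner and
    a rational side. *)
Lemma exists_rational_cube f a l c x : measurable_fun setT f -> (0 <= c)%R -> (0 < l)%R ->
  cube a l x -> c%:E < cube_mean f a l ->
  exists q : n.-tuple rat * rat, let a' := map_tuple ratr q.1 in let l' := ratr q.2 in
    [/\ (0 < l')%R, cube a' l' x & c%:E < cube_mean f a' l'].
Proof.
move=> mf c0 l0 Qx; rewrite lt_cube_mean//.
set I := \int[mu]_(y in _) _ => cI.
have [L lL hL] : exists2 L, (l < L)%R & forall l', (l <= l')%R -> (l' < L)%R ->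
    (c * cube_weight l')%:E < I.
  have [c0'|c0'] := leP c 0%R.
    exists (l + 1)%R; first by rewrite ltrDl.
    have -> : c = 0%R by apply/eqP; rewrite eq_le c0'.
    by move=> l' _ _; move: cI; rewrite (_ : c = 0%R) ?mul0r//; apply/eqP; rewrite eq_le c0'.
  have w0 := cube_weight_gt0 l0.
  have [b b0 /andP[h1 h2]] : exists2 b, (c * cube_weight l < b)%R & (0 < b)%R && (b%:E <= I).
    case: I cI => [r| |]//.
      rewrite lte_fin => h; exists r => //; rewrite lexx andbT.
      by apply: lt_trans h; rewrite mulr_gt0.
    move=> _; exists (c * cube_weight l + 1)%R; first by rewrite ltrDl.
    by rewrite leey andbT addr_gt0// mulr_gt0.
  pose b' := (b / c)%R; have b'0 : (0 < b')%R by rewrite divr_gt0.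
  (* the side length with weight b / c *)
  pose L := ((b' `^ (1 - al)^-1) `^ (n%:R)^-1)%R.
  have L0 : (0 < L)%R by rewrite !powR_gt0.
  have al1' : (0 < 1 - al)%R by rewrite subr_gt0.
  have wL : cube_weight L = b'.
    have e1 : (L ^+ n = b' `^ (1 - al)^-1)%R.
      rewrite -powR_mulrn ?(ltW L0)// /L -powRrM mulVf ?powRr1 ?powR_ge0//.
      by rewrite pnatr_eq0 -lt0n.
    by rewrite /cube_weight e1 -powRrM mulVf ?gt_eqF// powRr1// ltW.
  have mono l1 l2 : (0 < l1)%R -> (l1 < l2)%R -> (cube_weight l1 < cube_weight l2)%R.
    move=> l10 l12; have l20 : (0 < l2)%R by exact: lt_trans l12.
    apply: gt0_ltr_powR => //; rewrite ?nnegrE ?exprn_ge0 ?ltW//.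
    by rewrite ltr_pXn2r ?nnegrE ?ltW.
  exists L.
    rewrite ltNge; apply/negP => Ll.
    have : (cube_weight L <= cube_weight l)%R.
      move: Ll; rewrite le_eqVlt => /predU1P[->//|Ll]; by apply: ltW; exact: mono.
    by rewrite wL leNgt ltr_pdivlMr// mulrC b0.
  move=> l' ll' l'L; apply: lt_le_trans h2; rewrite lte_fin mulrC -ltr_pdivlMr//.
  by rewrite -/b' -wL; apply: mono => //; exact: lt_le_trans ll'.
have rat_between (u v : R) : (u < v)%R -> exists q : rat, (u < ratr q < v)%R.
  by move=> uv; have [q] := rat_in_itvoo uv; rewrite in_itv/=; exists q.
have [l' /andP[ll' l'L]] := rat_between _ _ lL.
have ra i : exists q : rat, (tnth a i - (ratr l' - l) < ratr q < tnth a i)%R.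
  by apply: rat_between; rewrite ltrBlDr ltrDl subr_gt0.
pose q i := projT1 (cid (ra i)).
have hq i : (tnth a i - (ratr l' - l) < ratr (q i) < tnth a i)%R.
  by rewrite /q; case: cid.
exists ([tuple q i | i < n], l') => /=.
have l'0 : (0 < ratr l' :> R)%R by exact: lt_trans ll'.
have sub : cube a l `<=` cube (map_tuple ratr [tuple q i | i < n]) (ratr l').
  apply: subset_cube => i; rewrite tnth_map tnth_mktuple; have /andP[h1 h2] := hq i.
    exact: ltW.
  by move: h1; lra.
split => //; first exact: sub.
rewrite lt_cube_mean//; apply: (lt_le_trans (hL _ (ltW ll') l'L)).
apply: (@ge0_subset_integral _ _ _ mu _ _ (measurable_cube _ _) (measurable_cube _ _)
  (fun y => `|f y|) _ _ sub).
- by apply: measurable_funTS; exact: measurableT_comp.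
- by move=> y _; exact: abse_ge0.
Qed.

(** An enumeration of the rational cubes with mean above [c]; they cover the
    level set of the maximal function. *)
Definition maximal_cubes f c (k : nat) : set (Rn R n) :=
  if unpickle k is Some q then
    let a' := map_tuple ratr (q : n.-tuple rat * rat).1 in let l' := ratr q.2 in
    [set x | [/\ (0 < l')%R, cube a' l' x & c%:E < cube_mean f a' l']]
  else set0.

Lemma maximal_levelset f c : measurable_fun setT f -> (0 <= c)%R ->
  [set x | c%:E < fractional_maximal gamma f x] = \bigcup_k maximal_cubes f c k.
Proof.
move=> mf c0; apply/seteqP; split => [x /=|x [k _]].
  rewrite fractional_maximalE => /ereal_sup_gt[_ [[a l] /= [l0 Qx] <-] h].
  have [q hq] := exists_rational_cube mf c0 l0 Qx h.
  by exists (pickle q) => //; rewrite /maximal_cubes pickleK.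
rewrite /maximal_cubes; case: unpickle => // q [l0 Qx h] /=.
exact: lt_le_trans h (cube_mean_le_maximal f l0 Qx).
Qed.

Lemma measurable_maximal_cubes f c k : measurable (maximal_cubes f c k).
Proof.
rewrite /maximal_cubes; case: unpickle => // q.
have [h1|h1] := pselect ((0 < ratr q.2 :> R)%R /\
    c%:E < cube_mean f (map_tuple ratr q.1) (ratr q.2)).
  rewrite (_ : mkset _ = cube (map_tuple ratr q.1) (ratr q.2)); first exact: measurable_cube.
  by apply/seteqP; split => [x []//|x Qx]; case: h1.
rewrite (_ : mkset _ = set0)//.
by apply/seteqP; split => // x [h2 _ h3]; apply: h1.
Qed.

Lemma measurable_fractional_maximal f : measurable_fun setT f ->
  measurable_fun setT (fractional_maximal gamma f).
Proof.
move=> mf; apply: (measurability _ (ErealGenOInfty.measurableE R)) => _ [_ [c ->] <-].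
rewrite setTI; have [c0|c0] := leP 0%R c.
  rewrite (_ : _ @^-1` _ = [set x | c%:E < fractional_maximal gamma f x]).
    rewrite maximal_levelset//; apply: bigcupT_measurable => k.
    exact: measurable_maximal_cubes.
  by apply/seteqP; split => x /=; rewrite in_itv/= andbT.
rewrite (_ : _ @^-1` _ = setT)//; apply/seteqP; split => // x _ /=.
by rewrite in_itv/= andbT; apply: lt_le_trans (fractional_maximal_ge0 f x); rewrite lte_fin.
Qed.

(** Each of the two terms satisfies [z / (x + y) <= (z / (x + y)) `^ b]. *)
Lemma powR_subadditive (b x y : R) : (0 < b)%R -> (b <= 1)%R -> (0 <= x)%R -> (0 <= y)%R ->
  ((x + y) `^ b <= x `^ b + y `^ b)%R.
Proof.
move=> b0 b1 x0 y0.
have [xy0|xy0] := leP (x + y)%R 0%R.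
  have -> : (x + y = 0)%R by apply/eqP; rewrite eq_le xy0 addr_ge0.
  by rewrite powR0 ?gt_eqF// addr_ge0// powR_ge0.
have main z : (0 <= z)%R -> (z <= x + y)%R -> (z / (x + y) * (x + y) `^ b <= z `^ b)%R.
  move=> z0 zxy.
  have u1 : (z / (x + y) <= 1)%R by rewrite ler_pdivrMr// mul1r.
  have u0 : (0 <= z / (x + y))%R by rewrite divr_ge0// ltW.
  rewrite -{2}(divfK (lt0r_neq0 xy0) z) powRM ?(ltW xy0)//.
  rewrite ler_wpM2r ?powR_ge0//.
  rewrite -{1}(powRr1 u0); have [->|un0] := eqVneq (z / (x + y))%R 0%R.
    by rewrite !powR0 ?gt_eqF.
  by apply: ger_powR => //; rewrite lt_neqAle eq_sym un0 u0.
have := lerD (main x x0 _) (main y y0 _); rewrite lerDl lerDr => /(_ y0 x0).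
by rewrite -mulrDl -mulrDl divff ?mul1r// gt_eqF.
Qed.

Definition cubes_union (qs : seq (n.-tuple R * R)) : set (Rn R n) :=
  [set x | exists2 q, q \in qs & cube q.1 q.2 x].

Lemma cubes_union_cons q qs : cubes_union (q :: qs) = cube q.1 q.2 `|` cubes_union qs.
Proof.
apply/seteqP; split => [x [p]|x [Qx|[p pqs px]]].
- by rewrite inE => /predU1P[->|pqs] px; [left|right; exists p].
- by exists q => //; rewrite mem_head.
- by exists p => //; rewrite inE pqs orbT.
Qed.

Lemma measurable_cubes_union qs : measurable (cubes_union qs).
Proof.
elim: qs => [|q qs IH].
  by rewrite (_ : cubes_union _ = set0)//; apply/seteqP; split => // x [].
by rewrite cubes_union_cons; apply: measurableU => //; exact: measurable_cube.
Qed.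

Lemma exists_largest (T : eqType) (g : T -> R) (qs : seq T) : qs != [::] ->
  exists2 q, q \in qs & forall p, p \in qs -> (g p <= g q)%R.
Proof.
elim: qs => // q [|q' qs] IH _.
  by exists q; rewrite ?mem_head// => p; rewrite inE => /eqP ->.
have [//|p pqs hp] := IH _.
have [qp|pq] := leP (g q) (g p).
  exists p; first by rewrite inE pqs orbT.
  by move=> z; rewrite inE => /predU1P[->//|/hp].
exists q; first by rewrite mem_head.
move=> z; rewrite inE => /predU1P[->//|/hp zp]; exact: le_trans zp (ltW pq).
Qed.

Lemma meeting_cube_subset a a' l l' : (l' <= l)%R -> cube a l `&` cube a' l' !=set0 ->
  cube a' l' `<=` cube [tuple (tnth a i - l)%R | i < n] (3 * l)%R.
Proof.
move=> ll' [z [za za']]; apply: subset_cube => i; rewrite tnth_mktuple;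
  have /andP[h1 h2] := za i; have /andP[h3 h4] := za' i; lra.
Qed.

(** Greedy selection: three times a largest cube covers all the cubes that
    meet it, and the remaining ones are treated in the same way. [U] is the
    union of the selected, disjoint cubes; their means combine because [powR]
    is subadditive for the exponent [1 - al]. *)
Lemma vitali_cubes f c (qs : seq (n.-tuple R * R)) : measurable_fun setT f -> (0 <= c)%R ->
  (forall q, q \in qs -> (0 < q.2)%R /\ c%:E < cube_mean f q.1 q.2) ->
  exists t, exists U, [/\ measurable U, (0 <= t)%R /\ mu U = t%:E,
    U `<=` cubes_union qs, mu (cubes_union qs) <= (3 ^+ n * t)%:E &
    (c * t `^ (1 - al))%:E <= \int[mu]_(x in U) `|f x|].
Proof.
move=> mf c0; have [m] := ubnP (size qs); elim: m qs => // m IH qs sm hqs.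
have al1' : (0 < 1 - al)%R by rewrite subr_gt0.
have [->|qs0] := eqVneq qs [::].
  have e0 : cubes_union [::] = set0 by apply/seteqP; split => // x [].
  exists 0%R, set0; split => //.
  - by split => //; exact: measure0.
  - by rewrite e0 measure0 mulr0.
  - by rewrite powR0 ?gt_eqF// mulr0 integral_set0.
have [[a l] aqs amax] := exists_largest (fun q => q.2) qs0.
have l0 : (0 < l)%R := (hqs _ aqs).1.
have ca : c%:E < cube_mean f a l := (hqs _ aqs).2.
pose P (q : n.-tuple R * R) := ~~ `[< cube a l `&` cube q.1 q.2 !=set0 >].
have self : ~~ P (a, l).
  rewrite negbK; apply/asboolP; exists a => /=.
  by split=> i; rewrite lexx lerDl ltW.
have sr : (size (seq.filter P qs) < size qs)%N.
  rewrite size_filter ltn_neqAle count_size andbT -all_count.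
  by apply/negP => /allP /(_ _ aqs); apply/negP.
have [|q|t [U [mU [t0 tU] sU bU cU]]] := IH (seq.filter P qs).
- by apply: leq_trans sr _; rewrite -ltnS.
- by rewrite mem_filter => /andP[_ /hqs].
have mC : measurable (cube a l) by exact: measurable_cube.
have dis : cube a l `&` U = set0.
  apply/seteqP; split => // x [ax /sU [q]]; rewrite mem_filter => /andP[/negP nP _] qx.
  by apply: nP; apply/asboolP; exists x.
exists (l ^+ n + t)%R, (cube a l `|` U); split.
- exact: measurableU.
- split; first by rewrite addr_ge0// exprn_ge0// ltW.
  transitivity (mu (cube a l) + mu U); first exact: measureU.
  by rewrite tU lebesgue_Rn_cube ?ltW// EFinD.
- move=> x [ax|/sU [q]]; first by exists (a, l).
  by rewrite mem_filter => /andP[_ qqs] qx; exists q.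
- pose B := cube [tuple (tnth a i - l)%R | i < n] (3 * l)%R.
  have mB : measurable B by exact: measurable_cube.
  apply: (@le_trans _ _ (mu (B `|` cubes_union (seq.filter P qs)))).
    apply: le_measure; rewrite ?inE.
    + exact: measurable_cubes_union.
    + by apply: measurableU => //; exact: measurable_cubes_union.
    move=> x [q qqs qx]; have [Pq|] := boolP (P q).
      by right; exists q => //; rewrite mem_filter Pq.
    rewrite negbK => /asboolP h; left; apply: meeting_cube_subset h _ qx.
    exact: (amax q).
  apply: (le_trans (measureU2 mu mB (measurable_cubes_union _))).
  rewrite mulrDr EFinD; apply: leeD => //.
  have BE : mu B = ((3 * l) ^+ n)%:E by apply: lebesgue_Rn_cube; rewrite mulr_ge0// ltW.
  by rewrite -exprMn -BE; exact: le_refl.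
- have mfU : measurable_fun (cube a l `|` U) (fun x => `|f x|).
    by apply: measurable_funTS; exact: measurableT_comp.
  have dCU : [disjoint cube a l & U] by apply/disj_setPS; rewrite dis.
  rewrite [leRHS](ge0_integral_setU mu mC mU mfU _ dCU); last by move=> x _; exact: abse_ge0.
  apply: (@le_trans _ _ ((c * cube_weight l)%:E + (c * t `^ (1 - al))%:E)).
    rewrite -EFinD lee_fin -mulrDr ler_wpM2l//; apply: powR_subadditive => //.
    + by rewrite gerBl ltW.
    + by rewrite exprn_ge0// ltW.
  by apply: leeD => //; apply: ltW; rewrite -lt_cube_mean.
Qed.

Lemma primitive_pairing e t : is_dist e -> (0 <= t)%R ->
  primitive e t = pairing e (box t%:E 1).
Proof.
move=> de t0; pose I : set (line R) := `]0%R, t[%classic.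
have mI : measurable I by apply: line_measurable; exact: measurable_itv.
have ID : I `<=` D by exact: subset_positives.
have hI : nonneg_measurable D (fun s => (1 * \1_I s : R)%:E).
  exact: nonneg_measurable_indic1.
have lI : lam I = t%:E.
  rewrite lebesgue_lineE lebesgue_measure_itv/= lte_fin -EFinB subr0.
  by case: ifPn => //; rewrite -leNgt => t0'; congr EFin; apply/eqP; rewrite eq_le t0.
transitivity (\int[lam]_(s in D) (rea e s * (1 * \1_I s)%:E)).
  rewrite /primitive -/I -[in LHS](setIidr ID) integral_mkcondr; apply: eq_integral => s _.
  by rewrite patchE indicE mul1r; case: (s \in I); rewrite ?mulr1n ?mulr0n ?mule1 ?mule0.
rewrite (integral_nincr (nonneg_measurable_line_rea _) hI).
- apply: eq_pairing => b b0; first by rewrite (dist_rea mP hP de (ltW b0)).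
  by rewrite -lI -(dist_indic lam 1 ID (ltW b0)).
- by move=> s u _; exact: rea_nincr.
- move=> s u s0 su; rewrite !mul1r lee_fin !indicE ler_nat.
  have [|_] := boolP (u \in I); last by [].
  rewrite inE /I /= in_itv/= => /andP[_ tm]; rewrite mem_set//= in_itv/= s0.
  exact: le_lt_trans tm.
Qed.

Lemma integral_setE f (U : set (Rn R n)) :
  \int[mu]_(x in U) f x = \int[mu]_x (f x * (1 * \1_U x)%:E).
Proof.
rewrite [LHS]integral_mkcond; apply: eq_integral => x _.
by rewrite patchE indicE mul1r; case: (x \in U); rewrite ?mulr1n ?mulr0n ?mule1 ?mule0.
Qed.

Lemma integral_le_primitive f (U : set (Rn R n)) t : nonneg_measurable setT f ->
  measurable U -> mu U = t%:E -> \int[mu]_(x in U) f x <= primitive (dist mu setT f) t.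
Proof.
move=> hf mU Ut; have t0 : (0 <= t)%R by rewrite -lee_fin -Ut measure_ge0.
rewrite (primitive_pairing (dist_is_dist mu mT hf.1) t0) integral_setE.
apply: (le_trans (integral_le_pairing mu mT hf (nonneg_measurable_indic1 R setT mU))).
by apply: le_pairing => b b0; rewrite ?dist_indic ?Ut// ltW.
Qed.

(** The indicator of a centred cube also decreases along the coordinate. *)
Lemma integral_rea_cube e s : is_dist e -> (0 <= s)%R ->
  \int[mu]_(x in [set x | (cube_volume x <= s)%R]) rea e (cube_volume x) = primitive e s.
Proof.
move=> de s0; rewrite primitive_pairing// integral_setE.
set U := [set x | _].
have UE : U = setT `&` [set x : Rn R n | (cube_volume x <= s)%R] by rewrite setTI.
have mU : measurable U by rewrite UE; exact: (measurable_ucoord_le mT hT).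
have hr := nonneg_measurable_rea mT hT e.
rewrite (integral_comonotone mu mT hr (nonneg_measurable_indic1 R setT mU)).
  apply: eq_pairing => b b0; first by rewrite (dist_rea mT hT de (ltW b0)).
  by rewrite dist_indic ?(ltW b0)// {1}UE (ucoord_le mT hT).
apply: (comonotone_along (tau := @cube_volume R n)) => x y _ _ xy; first exact: rea_nincr.
rewrite !mul1r lee_fin !indicE ler_nat; have [|//] := boolP (y \in U).
by rewrite inE => yU; rewrite mem_set//; exact: le_trans yU.
Qed.

Lemma finite_maximal_cubes f c m : exists qs : seq (n.-tuple R * R),
  \big[setU/set0]_(k < m) maximal_cubes f c k = cubes_union qs /\
  forall q, q \in qs -> (0 < q.2)%R /\ c%:E < cube_mean f q.1 q.2.
Proof.
elim: m => [|m [qs [IH hqs]]].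
  by exists [::]; split => //; rewrite big_ord0; apply/seteqP; split => // x [].
rewrite big_ord_recr/= IH /maximal_cubes; case: unpickle => [q|]; last first.
  by exists qs; rewrite setU0.
have [[h1 h2]|h1] := pselect ((0 < ratr q.2 :> R)%R /\
    c%:E < cube_mean f (map_tuple ratr q.1) (ratr q.2)).
  exists ((map_tuple ratr q.1, ratr q.2) :: qs); split; last first.
    by move=> p; rewrite inE => /predU1P[->|/hqs].
  rewrite cubes_union_cons setUC; congr (_ `|` _).
  by apply/seteqP; split => [x []//|x Qx].
exists qs; split => //; rewrite (_ : mkset _ = set0) ?setU0//.
by apply/seteqP; split => // x [h2 _ h3]; apply: h1.
Qed.

(** The Hardy transform loses at most the factor [(3 ^+ n + 1) `^ (1 - al)]
    between [t] and [(3 ^+ n + 1) * t]; the factor 2 makes an inequality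
    strict. *)
Definition maximal_constant : R := (2 * (3 ^+ n + 1) `^ (1 - al))%R.

Lemma maximal_constant_gt0 : (0 < maximal_constant)%R.
Proof. by rewrite mulr_gt0// powR_gt0// ltr_wpDl// exprn_ge0. Qed.

(** If the selected cubes have measure [t], then [c <= hardy al e t], and up
    to [maximal_constant] this persists on an interval ]t, (3 ^+ n + 1) t[,
    which has at least the measure of all the cubes. *)
Lemma dist_maximal_le f c : measurable_fun setT f -> (0 < c)%R ->
  dist mu setT (fractional_maximal gamma f) c <=
  dist lam D (fun s => maximal_constant%:E * hardy al (dist mu setT (fun x => `|f x|)) s) c.
Proof.
move=> mf c0; set e := dist mu setT (fun x => `|f x|).
have hh := nonneg_measurableZ (ltW maximal_constant_gt0) (nonneg_measurable_hardy al e).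
have habs := nonneg_measurable_abs mf.
set rhs := dist lam D _ c.
have fin m : mu (\big[setU/set0]_(k < m) maximal_cubes f c k) <= rhs.
  have [qs [-> hqs]] := finite_maximal_cubes f c m.
  have [t [U [mU [t0 tU] _ bU cU]]] := vitali_cubes mf (ltW c0) hqs.
  apply: (le_trans bU); move: t0; rewrite le_eqVlt => /predU1P[<-|t0].
    by rewrite mulr0 measure_ge0.
  have {}cU : (c * t `^ (1 - al))%:E <= primitive e t.
    exact: le_trans cU (integral_le_primitive habs mU tU).
  pose I : set (line R) := `]t, (t + 3 ^+ n * t)%R[%classic.
  have K0 : (0 < 3 ^+ n :> R)%R by rewrite exprn_gt0.
  have <- : lam I = (3 ^+ n * t)%:E.
    rewrite lebesgue_lineE lebesgue_measure_itv/= lte_fin ltrDl mulr_gt0// -EFinB.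
    by congr EFin; rewrite addrC addKr.
  apply: le_measure; rewrite ?inE.
  - by apply: line_measurable; exact: measurable_itv.
  - exact: (measurable_levelset mP c hh.1).
  move=> s; rewrite /I /= in_itv/= => /andP[ts sK].
  have s0 : (0 < s)%R by exact: lt_trans ts.
  split; first by apply/positivesE.
  have h1 : (s `^ (al - 1) * (c * t `^ (1 - al)))%:E <= hardy al e s.
    rewrite /hardy EFinM; apply: lee_pmul; rewrite ?lee_fin ?powR_ge0//.
      by rewrite mulr_ge0// ?(ltW c0)// powR_ge0.
    exact: le_trans cU (primitive_ndecr e (ltW ts)).
  have h2 : (((3 ^+ n + 1) * t) `^ (al - 1) <= s `^ (al - 1))%R.
    by apply: powR_nincr => //; rewrite mulrDl mul1r addrC ltW.
  apply: (@lt_le_trans _ _ (2 * c)%:E); first by rewrite lte_fin; lra.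
  apply: (@le_trans _ _ (maximal_constant * (s `^ (al - 1) * (c * t `^ (1 - al))))%:E); last first.
    by rewrite EFinM lee_pmul2l// lte_fin maximal_constant_gt0.
  rewrite lee_fin.
  apply: (@le_trans _ _ (maximal_constant *
      (((3 ^+ n + 1) * t) `^ (al - 1) * (c * t `^ (1 - al))))%R); last first.
    by rewrite ler_pM2l ?maximal_constant_gt0// ler_wpM2r// mulr_ge0 ?(ltW c0)// powR_ge0.
  rewrite /maximal_constant; set K := (3 ^+ n + 1)%R.
  have K1 : (0 < K)%R by rewrite ltr_wpDl// ltW.
  rewrite powRM ?(ltW K1) ?(ltW t0)//.
  rewrite [leRHS](_ : _ = (2 * c * (K `^ (1 - al) * K `^ (al - 1)) *
    (t `^ (1 - al) * t `^ (al - 1)))%R); last by ring.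
  have cancel (x : R) : (0 < x)%R -> (x `^ (1 - al) * x `^ (al - 1) = 1)%R.
    move=> x0; rewrite -powRD; last by rewrite (lt0r_neq0 x0) implybT.
    by rewrite addrC subrKA subrr powRr0.
  by rewrite !cancel// !mulr1.
rewrite {1}/dist setTI (maximal_levelset mf (ltW c0)) -bigcup_bigsetU_bigcup.
have mU m : measurable (\big[setU/set0]_(k < m) maximal_cubes f c k).
  by apply: bigsetU_measurable => k _; exact: measurable_maximal_cubes.
pose F m := \big[setU/set0]_(k < m.+1) maximal_cubes f c k.
have mF m : measurable (F m) by exact: mU.
have nU : nondecreasing_seq F.
  by move=> a b ab; apply/subsetPset; exact: subset_bigsetU.
have mUF : measurable (\bigcup_m F m) by exact: bigcupT_measurable.
have /cvg_lim muF := nondecreasing_cvg_mu (mu := mu) mF mUF nU.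
rewrite -/F -muF//.
apply: lime_le; last by apply: nearW => m; exact: fin.
apply: ereal_nondecreasing_is_cvgn => a b ab; apply: le_measure; rewrite ?inE//.
exact: subset_bigsetU.
Qed.

(** The centred cube of volume [s] contains [x]. *)
Lemma hardy_le_maximal e s x : is_dist e -> (0 < s)%R -> (cube_volume x <= s)%R ->
  hardy al e s <= fractional_maximal gamma (fun y : Rn R n => rea e (cube_volume y)) x.
Proof.
move=> de s0 xs; have l0 : (0 < 2 * half_side n s)%R by rewrite mulr_gt0// half_side_gt0.
have Qs := cube_volume_le_cube n0 (ltW s0).
have Qx : cube [tuple of nseq n (- half_side n s)%R] (2 * half_side n s)%R x by rewrite -Qs.
apply: le_trans (cube_mean_le_maximal _ l0 Qx).
rewrite /cube_mean -Qs (_ : cube_weight _ = s `^ (1 - al))%R; last first.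
  by rewrite /cube_weight half_sideK// ltW.
rewrite /hardy -powRN opprB.
rewrite -(integral_rea_cube de (ltW s0)); apply: lee_wpmul2l; first by rewrite lee_fin powR_ge0.
rewrite le_eqVlt; apply/orP; left; apply/eqP; apply: eq_integral => y _.
by rewrite gee0_abs// rea_ge0.
Qed.

(** If the Hardy transform exceeds [c] at [s], the centred cube of volume [s]
    lies in the level set of the maximal function, so that [s] is at most the
    measure of this set. *)
Lemma dist_hardy_le e c : is_dist e -> (0 < c)%R ->
  dist lam D (hardy al e) c <=
  dist mu setT (fractional_maximal gamma (fun y : Rn R n => rea e (cube_volume y))) c.
Proof.
move=> de c0; set F := fun y => _.
have mF : measurable_fun setT F by exact: (nonneg_measurable_rea mT hT e).1.
have mM := measurable_fractional_maximal mF.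
rewrite [leRHS]/dist; set m := mu _; have m0 : 0 <= m by exact: measure_ge0.
case m_ : m m0 => [r| |]//; last by move=> _; rewrite leey.
rewrite lee_fin => r0; pose I : set (line R) := `]0%R, r]%classic.
have <- : lam I = r%:E.
  rewrite lebesgue_lineE lebesgue_measure_itv/= lte_fin -EFinB subr0.
  by case: ifPn => //; rewrite -leNgt => t0'; congr EFin; apply/eqP; rewrite eq_le r0.
apply: le_measure; rewrite ?inE.
- exact: (measurable_levelset mP c (nonneg_measurable_hardy al e).1).
- by apply: line_measurable; exact: measurable_itv.
move=> s [/positivesE s0 /= cs]; rewrite /I /= in_itv/= s0 /= -lee_fin -m_.
rewrite -(ucoord_le mT hT (ltW s0)); apply: le_measure; rewrite ?inE.
- exact: (measurable_ucoord_le mT hT).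
- exact: (measurable_levelset mT c mM).
move=> x [_ /= xs]; split => //=; apply: (lt_le_trans cs).
exact: hardy_le_maximal.
Qed.

End maximal_operator.

(** * Boundedness of the maximal operator *)

(** Resonance reduces the claim to integrals. *)
Lemma le_pairingZ (R : realType) (d : R -> \bar R) (c : R) (phi psi : line R -> \bar R) :
  is_dist d -> (0 <= c)%R ->
  nonneg_measurable (@positives R) phi -> nonneg_measurable (@positives R) psi ->
  (forall s, @positives R s -> phi s <= c%:E * psi s) ->
  pairing d (dist (lebesgue_line R) (@positives R) phi) <=
  c%:E * pairing d (dist (lebesgue_line R) (@positives R) psi).
Proof.
move=> dd c0 hphi hpsi le; have mP := @measurable_positives R; have hP := ucoord_line R.
rewrite -(resonance mP hP dd hphi); apply: ge_ereal_sup => _ [h [hh hd] <-].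
apply: (@le_trans _ _ (\int[lebesgue_line R]_(x in @positives R) (c%:E * (h x * psi x)))).
  apply: ge0_le_integral.
  - exact: mP.
  - by move=> x Dx; rewrite mule_ge0//; [exact: hh.2|exact: hphi.2].
  - exact: (nonneg_measurableM hh hphi).1.
  - exact: (nonneg_measurableZ c0 (nonneg_measurableM hh hpsi)).1.
  - move=> x Dx; rewrite muleCA; apply: lee_wpmul2l; first exact: hh.2.
    exact: le.
rewrite [leLHS]ge0_integralZl.
- apply: lee_wpmul2l; first by rewrite lee_fin.
  apply: (le_trans (integral_le_pairing _ mP hh hpsi)).
  by apply: le_pairing => // a a0; rewrite hd// ltW.
- exact: mP.
- exact: (nonneg_measurableM hh hpsi).1.
- exact: (nonneg_measurableM hh hpsi).2.
- by rewrite lee_fin.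
Qed.

Lemma dist_scale d (T : measurableType d) (R : realType) (mu : {measure set T -> \bar R})
    (D : set T) (f : T -> \bar R) (c a : R) : (0 < c)%R ->
  dist mu D (fun x => c^-1%:E * f x) a = dist mu D f (c * a)%R.
Proof.
move=> c0; congr (mu (_ `&` _)); apply/seteqP; split => x /=;
  by rewrite EFinM lte_pdivlMl.
Qed.

Lemma rea_le_scale d (T : measurableType d) (R : realType) (mu : {measure set T -> \bar R})
    (D : set T) (f : T -> \bar R) (c t : R) : (0 < c)%R ->
  rea (dist mu D f) t <= c%:E * rea (dist mu D (fun x => c^-1%:E * f x)) t.
Proof.
move=> c0; rewrite -lee_pdivrMl//; apply: le_ereal_inf_tmp => _ [l [l0 le] <-].
rewrite lee_pdivrMl// -EFinM; apply: ereal_inf_lbound; exists (c * l)%R => //.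
by split; [rewrite mulr_gt0|move: le; rewrite dist_scale].
Qed.

Section boundedness.
Context (R : realType) (n : nat).
Hypothesis n0 : (0 < n)%N.
Local Notation mu := (lebesgue_Rn R n).
Local Notation D := (@positives R).
Local Notation lam := (lebesgue_line R).
Variable rhoX : (Rn R n -> \bar R) -> \bar R.
Hypothesis hX : ri_norm_Rn rhoX.
Implicit Types (f k : Rn R n -> \bar R) (s t c : R).
Let mT : measurable (setT : set (Rn R n)) := measurableT.
Let hT := ucoord_Rn R n0.
Let mP := @measurable_positives R.
Let hP := ucoord_line R.
Variable gamma : R.
Let al := (gamma / n%:R)%R.
Hypotheses (al0 : (0 < al)%R) (al1 : (al < 1)%R).

Lemma hardy_le_scale f c s : nonneg_measurable setT f -> (0 < c)%R ->
  hardy al (dist mu setT f) s <=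
  c%:E * hardy al (dist mu setT (fun x => c^-1%:E * f x)) s.
Proof.
move=> hf c0; rewrite /hardy muleCA; apply: lee_wpmul2l; first by rewrite lee_fin powR_ge0.
have mI : measurable (`]0%R, s[%classic : set (line R)).
  by apply: line_measurable; exact: measurable_itv.
have hw e : measurable_fun (`]0%R, s[%classic : set (line R)) (rea e : line R -> \bar R).
  apply: measurable_funS (nonneg_measurable_line_rea e).1 => //; exact: subset_positives.
have cE : (0 <= c)%R by exact: ltW.
rewrite /primitive -[leRHS]ge0_integralZl.
- apply: ge0_le_integral.
  + exact: mI.
  + by move=> x _; exact: rea_ge0.
  + exact: hw.
  + by apply: emeasurable_funM; [exact: measurable_cst|exact: hw].
  + by move=> x _; exact: rea_le_scale.
- exact: mI.
- exact: hw.
- by move=> x _; exact: rea_ge0.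
- by rewrite lee_fin.
Qed.

(** The function is normalised by a bound [c > 0] of its norm instead of the
    norm itself, which could be 0. *)
Lemma integral_maximal_le f k c : measurable_fun setT f -> nonneg_measurable setT k ->
  (0 < c)%R -> rhoX (fun x => `|f x|) <= c%:E ->
  \int[mu]_x (k x * fractional_maximal gamma f x) <=
  (maximal_constant n gamma * c)%:E * pairing_norm mu setT (hardy_dists rhoX gamma) k.
Proof.
move=> mf hk c0 fc; have hM : nonneg_measurable setT (fractional_maximal gamma f).
  split=> [|x _]; last exact: fractional_maximal_ge0.
  exact: measurable_fractional_maximal.
have K0 := maximal_constant_gt0 n gamma.
have habs := nonneg_measurable_abs mf.
set e := dist mu setT (fun x => `|f x|).
pose g x := c^-1%:E * `|f x|; pose w := dist mu setT g.
have c'0 : (0 <= c^-1)%R by rewrite invr_ge0 ltW.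
have hg : nonneg_measurable setT g by exact: nonneg_measurableZ.
have Ww : unit_dists mu setT rhoX w.
  exists g => //; split => //; rewrite (ri_normZ hX c'0 habs) lee_pdivrMl//.
  by rewrite mule1.
have dk := dist_is_dist mu mT hk.1.
apply: (le_trans (integral_le_pairing mu mT hk hM)).
apply: (@le_trans _ _ (pairing (dist mu setT k)
    (dist lam D (fun s => (maximal_constant n gamma)%:E * hardy al e s)))).
  by apply: le_pairing => // a a0; exact: dist_maximal_le.
apply: (@le_trans _ _ ((maximal_constant n gamma * c)%:E *
    pairing (dist mu setT k) (dist lam D (hardy al w)))).
  have Kc0 : (0 <= maximal_constant n gamma * c)%R by rewrite mulr_ge0// ltW.
  have hh := nonneg_measurable_hardy al.
  apply: (le_pairingZ dk Kc0 (nonneg_measurableZ (ltW K0) (hh e)) (hh w)).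
  move=> s _; rewrite [(_ * c)%:E]EFinM -muleA; apply: lee_wpmul2l; first by rewrite lee_fin ltW.
  exact: hardy_le_scale.
apply: lee_wpmul2l; first by rewrite lee_fin mulr_ge0// ltW.
by apply: ereal_sup_ubound; exists (dist lam D (hardy al w)) => //; exists w.
Qed.

Lemma bounded_maximal : bounded_operator setT rhoX (fractional_maximal gamma)
  (associate_norm mu setT (sigma_norm gamma rhoX)).
Proof.
have K0 := maximal_constant_gt0 n gamma.
exists (maximal_constant n gamma); first exact: K0.
move=> f [mf foo].
have mM := measurable_fractional_maximal n0 al1 mf.
have absM : (fun x => `|fractional_maximal gamma f x|) = fractional_maximal gamma f.
  by apply/funext => x; rewrite gee0_abs// fractional_maximal_ge0.
have N0 : 0 <= space_norm rhoX f by exact: (ri_norm_ge0 hX (nonneg_measurable_abs mf)).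
have bound : space_norm (associate_norm mu setT (sigma_norm gamma rhoX))
    (fractional_maximal gamma f) <= (maximal_constant n gamma)%:E * space_norm rhoX f.
  rewrite /space_norm absM; apply: ge_ereal_sup => _ [k [hk sk] <-].
  move: foo N0; rewrite /space_norm; set N := rhoX _; case N_ : N => [r| |]// _.
  rewrite lee_fin => r0; rewrite -EFinM; apply/lee_addgt0Pr => eps eps0.
  pose c := (r + eps / maximal_constant n gamma)%R.
  have c0 : (0 < c)%R by rewrite ltr_wpDl// divr_gt0.
  have fc : rhoX (fun x => `|f x|) <= c%:E.
    by rewrite -/N N_ lee_fin lerDl divr_ge0// ltW.
  apply: (le_trans (integral_maximal_le mf hk c0 fc)).
  rewrite -(sigma_normE n0 hX)//.
  apply: (@le_trans _ _ ((maximal_constant n gamma * c)%:E * 1)).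
    by apply: lee_wpmul2l => //; rewrite lee_fin mulr_ge0// ltW.
  by rewrite mule1 -EFinD lee_fin /c mulrDr mulrCA divff ?mulr1// gt_eqF.
split=> //; split=> //; apply: le_lt_trans bound _.
by apply: lte_mul_pinfty; rewrite ?lee_fin ?ltW.
Qed.

End boundedness.

(** * The Hahn-Banach theorem in finite dimension *)

Section sublinear.
Context (R : realType) (V : lmodType R).
Implicit Types (q : V -> R) (x y u : V).

Definition sublinear q := (forall x y, q (x + y) <= q x + q y)%R /\
  forall (c : R) x, (0 < c)%R -> (q (c *: x) <= c * q x)%R.

Lemma sublinear0 q : sublinear q -> q 0%R = 0%R.
Proof.
move=> [qD qZ]; apply/eqP; rewrite eq_le; apply/andP; split.
  have h2 : (0 < 2^-1 :> R)%R by rewrite invr_gt0.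
  by have := qZ _ 0%R h2; rewrite scaler0 => h; lra.
by have := qD 0%R 0%R; rewrite addr0 => h; lra.
Qed.

Lemma sublinear_opp q x : sublinear q -> (- q (- x) <= q x)%R.
Proof.
move=> hq; have := hq.1 x (- x)%R; rewrite subrr sublinear0// => h; lra.
Qed.

Lemma sublinearZ q (c : R) x : sublinear q -> (0 <= c)%R -> (c * q x <= q (c *: x))%R.
Proof.
move=> hq; rewrite le_eqVlt => /predU1P[<-|c0]; first by rewrite scale0r mul0r sublinear0.
have ci0 : (0 < c^-1)%R by rewrite invr_gt0.
have := hq.2 _ (c *: x)%R ci0; rewrite scalerA mulVf ?gt_eqF// scale1r.
by rewrite ler_pdivlMl.
Qed.

(** The largest sublinear functional below [q] whose value at [- u] is at most
    [- q u]. *)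
Definition lowering q u x : R :=
  inf [set (q (x + t *: u) - t * q u)%R | t in [set t : R | (0 <= t)%R]].

Lemma lowering_lb q u x : sublinear q ->
  lbound [set (q (x + t *: u) - t * q u)%R | t in [set t : R | (0 <= t)%R]] (- q (- x))%R.
Proof.
move=> hq _ [t /= t0 <-]; have h1 := sublinearZ u hq t0.
have := hq.1 (x + t *: u)%R (- x)%R; rewrite addrAC subrr add0r => h2; lra.
Qed.

Lemma lowering_le q u x (t : R) : sublinear q -> (0 <= t)%R ->
  (lowering q u x <= q (x + t *: u) - t * q u)%R.
Proof.
move=> hq t0; apply: ge_inf; last by exists t.
exists (- q (- x))%R; exact: lowering_lb.
Qed.

Lemma le_flatten q u x (b : R) :
  (forall t : R, (0 <= t)%R -> (b <= q (x + t *: u) - t * q u)%R) -> (b <= lowering q u x)%R.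
Proof.
move=> h; apply: lb_le_inf; first by exists (q (x + 0 *: u) - 0 * q u)%R, 0%R => /=.
by move=> _ [t t0 <-]; exact: h.
Qed.

Lemma lowering_sublinear q u : sublinear q -> sublinear (lowering q u).
Proof.
move=> hq; split=> [x y|c x c0].
  rewrite -lerBlDr; apply: le_flatten => s s0; rewrite lerBlDr -lerBlDl.
  apply: le_flatten => t t0; rewrite lerBlDl.
  apply: (le_trans (lowering_le u (x + y)%R hq (addr_ge0 s0 t0))).
  have := hq.1 (x + s *: u)%R (y + t *: u)%R.
  by rewrite addrACA -scalerDl mulrDl => h; lra.
rewrite -ler_pdivrMl//; apply: le_flatten => t t0; rewrite ler_pdivrMl//.
apply: (le_trans (lowering_le u (c *: x)%R hq (mulr_ge0 (ltW c0) t0))).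
have := hq.2 _ (x + t *: u)%R c0; rewrite scalerDr scalerA => h.
by rewrite mulrBr mulrA lerD2r.
Qed.

Lemma lowering_le_self q u x : sublinear q -> (lowering q u x <= q x)%R.
Proof.
by move=> hq; apply: (le_trans (lowering_le u x hq (lexx 0%R))); rewrite scale0r addr0 mul0r subr0.
Qed.

Lemma lowering_direction q u : sublinear q -> (lowering q u (- u) <= - q u)%R.
Proof.
move=> hq; apply: (le_trans (lowering_le u (- u)%R hq ler01)).
by rewrite scale1r addNr sublinear0// mul1r sub0r.
Qed.

(** What has been gained along one direction is kept by all smaller sublinear
    functionals. *)
Lemma lowering_seq q (us : seq V) : sublinear q -> exists q',
  [/\ sublinear q', forall x, (q' x <= q x)%R &
      forall u, u \in us -> (q' (- u) <= - q' u)%R].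
Proof.
elim: us q => [|u us IH] q hq; first by exists q; split.
have [q' [hq' q'q q'us]] := IH _ (lowering_sublinear u hq).
exists q'; split=> // [x|z]; first exact: le_trans (q'q x) (lowering_le_self u x hq).
rewrite inE => /predU1P[->|]; last exact: q'us.
apply: (le_trans (q'q _)); apply: (le_trans (lowering_direction u hq)).
rewrite lerN2; exact: le_trans (q'q u) (lowering_le_self u u hq).
Qed.

End sublinear.

(** Lowering [p] along [v] and then along the basis vectors yields a linear
    functional; since it is at most [- p v] at [- v], it agrees with [p] at
    [v]. *)
Lemma supporting_functional (R : realType) (N : nat) (p : 'rV[R]_N -> R) (v : 'rV[R]_N) :
  sublinear p -> exists w : 'I_N -> R,
  (forall x : 'rV[R]_N, (\sum_(i < N) w i * x 0%R i <= p x)%R) /\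
  (\sum_(i < N) w i * v 0%R i = p v)%R.
Proof.
move=> hp; have hq := lowering_sublinear v hp.
have [q [hq' qle qdir]] := lowering_seq [seq delta_mx 0%R i | i : 'I_N] hq.
pose w i := q (delta_mx 0%R i : 'rV[R]_N).
have up (x : 'rV[R]_N) : (q x <= \sum_(i < N) w i * x 0%R i)%R.
  rewrite {1}(row_sum_delta x).
  elim/big_ind2 : _ => [|a b c d ab cd|i _]; first by rewrite (sublinear0 hq').
    exact: le_trans (hq'.1 _ _) (lerD ab cd).
  have di : (q (- delta_mx 0%R i) <= - w i)%R.
    by apply: qdir; apply/mapP; exists i; rewrite ?mem_enum.
  have [xi|xi|->] := ltgtP (x 0%R i) 0%R.
  - have h0 : (0 < - x 0%R i)%R by rewrite oppr_gt0.
    have := hq'.2 _ (- delta_mx 0%R i)%R h0; rewrite scalerN scaleNr opprK => h.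
    apply: (le_trans h); apply: (@le_trans _ _ (- x 0 i * - w i)%R); first by rewrite ler_pM2l.
    by rewrite mulrNN mulrC.
  - by rewrite mulrC; exact: hq'.2.
  - by rewrite scale0r mulr0 (sublinear0 hq').
have low (x : 'rV[R]_N) : (\sum_(i < N) w i * x 0%R i <= q x)%R.
  apply: le_trans (sublinear_opp x hq'); rewrite lerNr; apply: (le_trans (up _)).
  rewrite -sumrN; apply: ler_sum => i _; by rewrite mxE mulrN.
exists w; split=> [x|].
  apply: (le_trans (low x)); apply: (le_trans (qle x)); exact: lowering_le_self.
apply/eqP; rewrite eq_le; apply/andP; split.
  apply: (le_trans (low v)); apply: (le_trans (qle v)); exact: lowering_le_self.
apply: le_trans (up v); apply: le_trans (sublinear_opp v hq'); rewrite lerNr.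
by apply: (le_trans (qle _)); exact: lowering_direction.
Qed.

Lemma sorting_perm (R : realType) (N : nat) (w : 'I_N -> R) :
  exists s : {perm 'I_N}, forall i j : 'I_N, (i <= j)%N -> (w (s j) <= w (s i))%R.
Proof.
pose t := [tuple w i | i < N]; pose ge_rel := (fun a b : R => (b <= a)%R).
have ge_total : total ge_rel by move=> a b; rewrite /ge_rel le_total.
have ge_trans : transitive ge_rel by move=> a b c ab bc; exact: le_trans bc ab.
have /tuple_permP[s ts] : perm_eq (sort_tuple ge_rel t) t by rewrite perm_sort.
have sorted_t : sorted ge_rel (sort_tuple ge_rel t) by exact: sort_sorted.
exists s => i j ij; have nthE (k : 'I_N) : nth 0%R (sort_tuple ge_rel t) k = w (s k).
  by rewrite ts -(tnth_nth _ [tuple tnth t (s i) | i < N] k) !tnth_mktuple.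
rewrite -!nthE; apply: (sorted_leq_nth ge_trans _ 0%R sorted_t) => //.
- by move=> a; exact: lexx.
- by rewrite inE size_tuple.
- by rewrite inE size_tuple.
Qed.

(** * Norming functions for step functions *)

Section norming.
Context (R : realType) (n : nat).
Hypothesis n0 : (0 < n)%N.
Local Notation mu := (lebesgue_Rn R n).
Local Notation tau := (@cube_volume R n).
Variable rho : (Rn R n -> \bar R) -> \bar R.
Hypothesis hrho : ri_norm_Rn rho.
Let mT : measurable (setT : set (Rn R n)) := measurableT.
Let hT := ucoord_Rn R n0.
Variables (del : R) (N : nat).
Hypothesis del0 : (0 < del)%R.
Implicit Types (v w : 'I_N -> R) (u : Rn R n -> \bar R).

Local Notation S v := (fun x : Rn R n => (step tau del v x)%:E).

Lemma le_step v w x : (forall i, (v i <= w i)%R) -> (step tau del v x <= step tau del w x)%R.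
Proof. by move=> vw; rewrite /step; case: insub => //=. Qed.

Lemma stepD v w x :
  step tau del (fun i => v i + w i)%R x = (step tau del v x + step tau del w x)%R.
Proof. by rewrite /step; case: insub => //=; rewrite addr0. Qed.

Lemma stepZ (c : R) v x : step tau del (fun i => c * v i)%R x = (c * step tau del v x)%R.
Proof. by rewrite /step; case: insub => //=; rewrite mulr0. Qed.

Lemma step_nincr v : (forall i, 0 <= v i)%R ->
  (forall i j : 'I_N, (i <= j)%N -> (v j <= v i)%R) ->
  forall x y, (tau x <= tau y)%R -> (step tau del v y <= step tau del v x)%R.
Proof.
move=> v0 vN x y xy.
have [[j cj ->]|[_ ->]] := stepP hT del0 v (x := y) I; last exact: step_ge0.
have [[i ci ->]|[Nx _]] := stepP hT del0 v (x := x) I.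
  have [_ /= /andP[_ h1]] := cj; have [_ /= /andP[h2 _]] := ci.
  apply: vN; rewrite -ltnS -(ltr_nat R) -(ltr_pM2r del0).
  exact: le_lt_trans h2 (le_lt_trans xy h1).
exfalso; have [_ /= /andP[_ h1]] := cj.
have : (N%:R * del < j.+1%:R * del)%R by exact: le_lt_trans Nx (le_lt_trans xy h1).
by rewrite ltr_pM2r// ltr_nat ltnS leqNgt ltn_ord.
Qed.

Let hS v : (forall i, 0 <= v i)%R -> nonneg_measurable setT (S v).
Proof. exact: (nonneg_measurable_step mT hT del0). Qed.

Lemma ri_norm_step_fin v : (forall i, 0 <= v i)%R -> rho (S v) \is a fin_num.
Proof.
move=> v0; rewrite ge0_fin_numE; last exact: (ri_norm_ge0 hrho (hS v0)).
pose M := (\sum_i v i)%R; have M0 : (0 <= M)%R by exact: sumr_ge0.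
pose E := setT `&` [set x : Rn R n | (tau x < N%:R * del)%R].
have mE : measurable E by exact: (measurable_ucoord_lt mT hT).
have hE : nonneg_measurable setT (fun x => (\1_E x : R)%:E) by exact: nonneg_measurable_indic.
apply: (@le_lt_trans _ _ (rho (fun x => M%:E * (\1_E x)%:E))).
  apply: (ri_norm_le hrho (hS v0) (nonneg_measurableZ M0 hE)).
  apply: aeW => x _.
  have [[i ci ->]|[_ ->]] := stepP hT del0 v (x := x) I; last first.
    by rewrite mule_ge0// lee_fin.
  rewrite indicE mem_set; last first.
    split=> //=; have [_ /= /andP[_ h]] := ci; apply: (lt_le_trans h).
    by rewrite ler_pM2r// ler_nat.
  by rewrite mulr1n mule1 lee_fin /M (bigD1 i)//= lerDl sumr_ge0.
rewrite (ri_normZ hrho)//; apply: lte_mul_pinfty; rewrite ?lee_fin//.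
apply: (ri_norm_indic hrho) => //.
by rewrite (ucoordE hT) ?ltry// mulr_ge0// ltW.
Qed.

(** Because of the positive parts a functional below it has nonnegative
    coefficients. *)
Definition positive_part_norm (x : 'rV[R]_N) : R :=
  fine (rho (S (fun i => Num.max (x 0%R i) 0%R))).

Let max0 (x : 'rV[R]_N) i : (0 <= Num.max (x 0%R i) 0)%R.
Proof. by rewrite le_max lexx orbT. Qed.

Lemma sublinear_positive_part_norm : sublinear positive_part_norm.
Proof.
split=> [x y|c x c0]; rewrite /positive_part_norm.
  rewrite -fineD ?ri_norm_step_fin//; apply: fine_le.
  - exact: ri_norm_step_fin.
  - by rewrite fin_numD !ri_norm_step_fin.
  apply: le_trans (ri_normD hrho (hS (max0 x)) (hS (max0 y))).
  apply: (ri_norm_le hrho (hS (max0 _)) (nonneg_measurableD (hS (max0 x)) (hS (max0 y)))).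
  apply: aeW => z _; rewrite -EFinD -stepD lee_fin; apply: le_step => i.
  rewrite mxE ge_max; apply/andP; split; last by rewrite addr_ge0.
  by rewrite lerD// le_max lexx.
have -> : S (fun i => Num.max ((c *: x)%R 0%R i) 0) =
    (fun z => c%:E * (S (fun i => Num.max (x 0%R i) 0)) z).
  apply/funext => z; rewrite -EFinM -stepZ; congr ((step tau del _ z)%:E).
  by apply/funext => i; rewrite mxE maxr_pMr ?(ltW c0)// mulr0.
by rewrite (ri_normZ hrho (ltW c0) (hS (max0 x))) fineM// ri_norm_step_fin.
Qed.

Lemma ri_norm_step_perm v (s : 'I_N -> 'I_N) : (forall i, 0 <= v i)%R -> injective s ->
  rho (S (v \o s)) = rho (S v).
Proof.
move=> v0 sinj; apply: (ri_norm_eq_dist mT hrho); first by apply: hS => i /=.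
  exact: hS.
by move=> a a0; exact: (dist_step_perm mT hT del0 v sinj a0).
Qed.

Definition cell_mean u (i : 'I_N) : R :=
  (del^-1 * fine (\int[mu]_(x in cell setT tau del i) rea (dist mu setT u) (tau x)))%R.

Section cell_means.
Variable u : Rn R n -> \bar R.
Hypotheses (hu : nonneg_measurable setT u) (ufin : rho u < +oo).
Let e := dist mu setT u.
Let de : is_dist e := dist_is_dist mu mT hu.1.
Let hr : nonneg_measurable setT (fun x : Rn R n => rea e (tau x)) := nonneg_measurable_rea mT hT e.
Let mcell (i : 'I_N) : measurable (cell setT tau del i) := measurable_cell mT hT del i.

Let cell_integral_ge0 i : 0 <= \int[mu]_(x in cell setT tau del i) rea e (tau x).
Proof. by apply: integral_ge0 => x _; exact: rea_ge0. Qed.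

Lemma cell_integral_le (i : 'I_N) :
  \int[mu]_(x in cell setT tau del i) rea e (tau x) <= primitive e del.
Proof.
apply: (le_trans (integral_le_primitive hr (mcell i) (measure_cell mT hT del0 i))).
rewrite /primitive (@eq_rea _ _ e)// => a a0.
by rewrite (dist_rea mT hT de (ltW a0)).
Qed.

Lemma primitive_lty : primitive e del < +oo.
Proof.
have := average_le mT hT hrho hu del0; rewrite ltey => h; apply/eqP => poo.
move: h; rewrite poo gt0_muley ?(sublevel_norm_gt0 mT hT hrho del0)// leNgt => /negP; apply.
by apply: lte_mul_pinfty => //; rewrite lee_fin ltW.
Qed.

Lemma cell_integral_fin (i : 'I_N) :
  \int[mu]_(x in cell setT tau del i) rea e (tau x) \is a fin_num.
Proof.
rewrite ge0_fin_numE//; apply: le_lt_trans (cell_integral_le i) primitive_lty.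
Qed.

Lemma cell_mean_ge0 i : (0 <= cell_mean u i)%R.
Proof. by rewrite mulr_ge0// ?invr_ge0 ?(ltW del0)// fine_ge0. Qed.

Lemma cell_meanE (i : 'I_N) :
  \int[mu]_(x in cell setT tau del i) rea e (tau x) = (cell_mean u i * del)%:E.
Proof. by rewrite /cell_mean mulrAC mulVf ?gt_eqF// mul1r fineK// cell_integral_fin. Qed.

Lemma cell_mean_le (i : 'I_N) : (cell_mean u i)%:E <= rea e (i%:R * del).
Proof.
rewrite -(@lee_pmul2r _ del%:E)//.
rewrite -EFinM -cell_meanE.
apply: (@le_trans _ _ (\int[mu]_(x in cell setT tau del i) rea e (i%:R * del))).
  apply: ge0_le_integral.
  - exact: mcell.
  - by move=> x _; exact: rea_ge0.
  - by apply: measurable_funS hr.1.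
  - exact: measurable_cst.
  - by move=> x [_ /= /andP[h _]]; exact: rea_nincr.
by rewrite [leLHS]integral_cst// (measure_cell mT hT del0 i).
Qed.

(** The mean over the first cell is covered by [average_le]. Any other mean is
    at most the value at the left end of its cell, hence lies below the
    rearrangement after a shift by one cell. *)
Lemma ri_norm_cell_mean : rho (S (cell_mean u)) <= 2%:E * rho u.
Proof.
pose z (i : 'I_N) := if i == 0%N :> nat then 0%R else cell_mean u i.
pose f (i : 'I_N) := if i == 0%N :> nat then cell_mean u i else 0%R.
have z0 i : (0 <= z i)%R by rewrite /z; case: ifP => // _; exact: cell_mean_ge0.
have f0 i : (0 <= f i)%R by rewrite /f; case: ifP => // _; exact: cell_mean_ge0.
have split_ : S (cell_mean u) = (fun x => S f x + S z x).
  apply/funext => x; rewrite -EFinD -stepD; congr ((step tau del _ x)%:E).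
  by apply/funext => i; rewrite /f /z; case: ifP; rewrite ?addr0 ?add0r.
rewrite split_; apply: (le_trans (ri_normD hrho (hS f0) (hS z0))).
have -> : 2%:E * rho u = rho u + rho u.
  by rewrite -mule2n mule_natl.
apply: leeD.
  have E0 := nonneg_measurable_indic R setT (measurable_sublevel mT hT del).
  case: (ltnP 0 N) => [Npos|]; last first.
    rewrite leqn0 => /eqP Nz; apply: (@le_trans _ _ 0).
      have <- : rho (fun=> 0) = 0 by exact: ri_norm0 hrho.
      rewrite le_eqVlt; apply/orP; left; apply/eqP; congr rho; apply/funext => x.
      rewrite /step; case: insubP => // i _ _; exfalso.
      have : (0 < N)%N by exact: leq_ltn_trans (leq0n _) (ltn_ord i).
      by rewrite Nz.
    exact: (ri_norm_ge0 hrho hu).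
  pose o := Ordinal Npos.
  apply: (@le_trans _ _ (rho (fun x => (cell_mean u o)%:E * (\1_(sublevel setT tau del) x)%:E))).
    apply: (ri_norm_le hrho); [exact: hS|exact: (nonneg_measurableZ (cell_mean_ge0 o) E0)|].
    apply: aeW => x _; have [[i ci ->]|[_ ->]] := stepP hT del0 f (x := x) I; last first.
      by rewrite mule_ge0// lee_fin// cell_mean_ge0.
    rewrite /f; case: ifPn => [/eqP i0|_]; last by rewrite mule_ge0// lee_fin// cell_mean_ge0.
    have -> : i = o by exact/val_inj.
    have xs : sublevel setT tau del x.
      by have [_ /= /andP[_]] := ci; rewrite i0 mul1r => h; split.
    by rewrite indicE mem_set// mulr1n mule1.
  rewrite (ri_normZ hrho (cell_mean_ge0 o) E0).
  rewrite -(@lee_pmul2l _ del%:E) ?lte_fin//.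
  apply: le_trans (average_le mT hT hrho hu del0).
  rewrite muleA -EFinM [X in X%:E * _]mulrC -cell_meanE muleC.
  apply: lee_wpmul2l; first exact: (sublevel_norm_ge0 mT hT hrho).
  exact: cell_integral_le.
have sinj : injective (@ordS N) by exact: ordS_inj.
rewrite -(ri_norm_step_perm z0 sinj) -[leRHS](ri_norm_rea mT hT hrho hu).
apply: (ri_norm_le hrho); [by apply: hS => i /=|exact: hr|].
apply: aeW => x _; have [[i ci ->]|[_ ->]] := stepP hT del0 (z \o @ordS N) (x := x) I; last first.
  exact: rea_ge0.
rewrite /= /z; case: ifPn => [_|ii]; first exact: rea_ge0.
have [iN|iN] := ltnP i.+1 N; last first.
  exfalso; move/eqP: ii; apply => /=.
  by have -> : i.+1 = N; [apply/eqP; rewrite eqn_leq ltn_ord|rewrite modnn].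
apply: (le_trans (cell_mean_le _)); apply: rea_nincr; rewrite /= modn_small//.
by have [_ /= /andP[_ h]] := ci; exact: ltW.
Qed.

End cell_means.

(** The coefficients [w] of a supporting functional at [v] are the integrals
    of [k] over the cells. Sorted, they turn the pairing of [k] with [u] into
    a sum of products with the cell means of the rearrangement of [u], and
    this sum is bounded by the functional. *)
Lemma norming_step v : (forall i, 0 <= v i)%R ->
  exists2 k, nonneg_measurable setT k &
    \int[mu]_x ((step tau del v x)%:E * k x) = rho (S v) /\
    forall u, nonneg_measurable setT u ->
      pairing (dist mu setT k) (dist mu setT u) <= 2%:E * rho u.
Proof.
move=> v0.
have [w [wp wv]] := supporting_functional (\row_i v i)%R sublinear_positive_part_norm.
have rowmax (y : 'I_N -> R) : (forall i, 0 <= y i)%R ->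
    (positive_part_norm (\row_i y i))%:E = rho (S y).
  move=> y0; rewrite /positive_part_norm fineK ?ri_norm_step_fin//.
  congr (rho _); apply/funext => z; congr ((step tau del _ z)%:E).
  by apply/funext => i; rewrite mxE max_l.
have w0 i : (0 <= w i)%R.
  have := wp (- delta_mx 0%R i)%R; rewrite (bigD1 i)//= big1 => [|j ji]; last first.
    by rewrite !mxE eqxx /= (negbTE ji) oppr0 mulr0.
  rewrite !mxE !eqxx addr0 mulrN1 => h; rewrite -oppr_le0; apply: (le_trans h).
  rewrite /positive_part_norm (_ : S _ = fun=> 0) ?(ri_norm0 hrho)//.
  apply/funext => z; congr (_%:E); rewrite /step; case: insub => //= j.
  by rewrite !mxE max_r// oppr_le0 ler0n.
have wd0 i : (0 <= w i / del)%R by rewrite divr_ge0// ltW.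
pose k := S (fun i => w i / del)%R.
have mcell (i : 'I_N) : measurable (cell setT tau del i) by exact: (measurable_cell mT hT del i).
exists k; first exact: hS.
split.
  rewrite (integral_stepM mT hT del0 v0 (hS wd0)) -(rowmax _ v0) -wv -sumEFin.
  apply: eq_bigr => i _; rewrite mxE mulrC EFinM; congr (_ * _).
  rewrite (eq_integral (fun=> (w i / del)%:E)); last first.
    by move=> x; rewrite inE => ci; rewrite (step_cell hT del0 _ ci).
  rewrite [LHS]integral_cst; last exact: mcell.
  by rewrite (measure_cell mT hT del0 i) -EFinM divfK// gt_eqF.
move=> u hu; have [ufin|] := ltP (rho u) +oo; last first.
  by rewrite leye_eq => /eqP ->; rewrite gt0_muley ?lte_fin// leey.
have [s sw] := sorting_perm w.
have de := dist_is_dist mu mT hu.1.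
set e := dist mu setT u in de *.
have hr := nonneg_measurable_rea mT hT e.
have ws0 i : (0 <= w (s i) / del)%R by exact: wd0.
rewrite (_ : pairing _ _ = pairing (dist mu setT (S (fun i => w (s i) / del)%R))
    (dist mu setT (fun x => rea e (tau x)))); last first.
  apply: eq_pairing => a a0; last by rewrite (dist_rea mT hT de (ltW a0)).
  apply/esym.
  exact: (dist_step_perm mT hT del0 (fun i => w i / del)%R (perm_inj (s := s)) (ltW a0)).
rewrite -(integral_comonotone mu mT (hS ws0) hr); last first.
  apply: (comonotone_along (tau := tau)) => x y _ _ xy; last exact: rea_nincr.
  rewrite lee_fin; apply: step_nincr xy => // i j ij.
  by rewrite ler_pM2r ?invr_gt0//; exact: sw.
rewrite (integral_stepM mT hT del0 ws0 hr).
have y0 := cell_mean_ge0 u.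
apply: le_trans (ri_norm_cell_mean hu ufin).
pose y i := cell_mean u ((s^-1)%g i).
have yn0 i : (0 <= y i)%R by exact: y0.
have <- : rho (S y) = rho (S (cell_mean u)).
  exact: (ri_norm_step_perm y0 (perm_inj (s := s^-1%g))).
rewrite -(rowmax _ yn0); apply: le_trans (wp _ : (_%:E <= _%:E)).
rewrite [X in (_ <= X%:E)](reindex_inj (perm_inj (s := s))) -sumEFin.
rewrite le_eqVlt; apply/orP; left; apply/eqP; apply: eq_bigr => i _.
rewrite (cell_meanE hu ufin) -EFinM mxE /y permK.
by rewrite mulrCA divfK ?gt_eqF// mulrC.
Qed.

End norming.

(** * Optimality *)

Section step_approximation.
Context (R : realType) (n : nat).
Hypothesis n0 : (0 < n)%N.
Local Notation mu := (lebesgue_Rn R n).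
Local Notation tau := (@cube_volume R n).
Let mT : measurable (setT : set (Rn R n)) := measurableT.
Let hT := ucoord_Rn R n0.
Variable e : R -> \bar R.
Hypothesis de : is_dist e.

(** Dyadic, so that the cells of successive step functions are nested. *)
Definition mesh (j : nat) : R := ((2 ^ j)%N%:R^-1)%R.

Lemma mesh_gt0 j : (0 < mesh j)%R.
Proof. by rewrite invr_gt0 ltr0n expn_gt0. Qed.

Lemma meshS j : (mesh j = 2 * mesh j.+1)%R.
Proof. by rewrite /mesh expnS natrM invfM mulrA divff ?mul1r// pnatr_eq0. Qed.

Lemma mesh_range j : ((4 ^ j)%N%:R * mesh j = (2 ^ j)%N%:R)%R.
Proof.
rewrite /mesh (_ : 4 ^ j = 2 ^ j * 2 ^ j)%N; last by rewrite -expnMn.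
by rewrite natrM mulfK// pnatr_eq0 -lt0n expn_gt0.
Qed.

(** The value at the right end of the cell keeps the step function below a
    decreasing function; the bound [j] keeps it finite. *)
Definition rea_value (j i : nat) : \bar R := mine (rea e (i.+1%:R * mesh j)) j%:R%:E.

Definition rea_step (j : nat) (i : 'I_(4 ^ j)) : R := fine (rea_value j i).

Lemma rea_stepE j (i : 'I_(4 ^ j)) : (rea_step i)%:E = rea_value j i.
Proof.
rewrite fineK// ge0_fin_numE; first by rewrite gt_min ltry orbT.
by rewrite le_min rea_ge0 lee_fin ler0n.
Qed.

Lemma rea_step_ge0 j (i : 'I_(4 ^ j)) : (0 <= rea_step i)%R.
Proof. by rewrite fine_ge0// le_min rea_ge0 lee_fin ler0n. Qed.

Local Notation P j := (fun x : Rn R n => (step tau (mesh j) (@rea_step j) x)%:E).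

Lemma rea_step_le j x : P j x <= rea e (tau x).
Proof.
have [[i [_ /= /andP[_ h]] ->]|[_ ->]] := stepP hT (mesh_gt0 j) (@rea_step j) (x := x) I.
  by rewrite rea_stepE ge_min rea_nincr// ltW.
exact: rea_ge0.
Qed.

Lemma rea_step_ndecr j x : P j x <= P j.+1 x.
Proof.
have d0 := mesh_gt0 j.+1.
have [[i [_ /= /andP[_ h]] ->]|[_ ->]] := stepP hT (mesh_gt0 j) (@rea_step j) (x := x) I;
  last first.
  by rewrite lee_fin step_ge0// => k; exact: rea_step_ge0.
have h' : (tau x < (2 * i.+1)%N%:R * mesh j.+1)%R.
  have -> : ((2 * i.+1)%N%:R * mesh j.+1 = i.+1%:R * mesh j)%R; last exact: h.
  by rewrite (meshS j) natrM; ring.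
have [[k [_ /= /andP[hk _]] ->]|[xN _]] := stepP hT d0 (@rea_step j.+1) (x := x) I.
  rewrite !rea_stepE /rea_value le_min !ge_min; apply/andP; split; last first.
    by rewrite lee_fin ler_nat leqnSn orbT.
  rewrite rea_nincr// (meshS j).
  have -> : (i.+1%:R * (2 * mesh j.+1) = (2 * i.+1)%N%:R * mesh j.+1)%R by rewrite natrM; ring.
  rewrite ler_pM2r// ler_nat.
  by move: (le_lt_trans hk h'); rewrite ltr_pM2r// ltr_nat.
exfalso; move: (le_lt_trans xN h'); rewrite ltr_pM2r// ltr_nat expnS.
have h3 : (2 * i.+1 <= 2 * 4 ^ j)%N by rewrite leq_mul2l ltn_ord.
by rewrite ltnNge (leq_trans h3)// leq_mul2r orbT.
Qed.

(** The right continuity of [rea e] is used in the form of [rea_lt]. *)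
Lemma rea_step_cvg x : P j x @[j --> \oo] --> rea e (tau x).
Proof.
have nd : nondecreasing_seq (fun j => P j x).
  by apply/nondecreasing_seqP => j; exact: rea_step_ndecr.
have := ereal_nondecreasing_cvgn nd; set l := ereal_sup _ => hl.
suff -> : rea e (tau x) = l by [].
apply/eqP; rewrite eq_le; apply/andP; split; last first.
  by apply: ge_ereal_sup => _ [j _ <-]; exact: rea_step_le.
rewrite leNgt; apply/negP => lr.
have l0 : 0 <= l.
  apply: (@le_trans _ _ (P 0%N x)); last by apply: ereal_sup_ubound; exists 0%N.
  by rewrite lee_fin step_ge0// => i; exact: rea_step_ge0.
have [a a0 /andP[la ar]] := lte_real_between l0 lr.
move: (ar); rewrite (rea_lt _ de (ltW a0)) => tea.
have [eps eps0 epse] : exists2 eps : R, (0 < eps)%R & (tau x + eps)%:E < e a.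
  case: (e a) tea => [r| |]//; last by exists 1%R => //; exact: ltry.
  by rewrite lte_fin => h; exists ((r - tau x) / 2)%R; [|rewrite lte_fin]; lra.
have t0 : (0 <= tau x)%R by exact: cube_volume_ge0.
have b0 : (0 <= eps^-1)%R by rewrite invr_ge0 ltW.
(* the mesh is then below eps, the point in range and the level below the cap *)
pose j := (Num.truncn (eps^-1 + tau x + a)).+1.
have jbig : (eps^-1 + tau x + a < j%:R)%R by exact: truncnS_gt.
have j2 : (j%:R < (2 ^ j)%N%:R :> R)%R by rewrite ltr_nat ltn_expl.
have meps : (mesh j <= eps)%R.
  rewrite /mesh -(invrK eps) lef_pV2 ?posrE ?invr_gt0// ?ltr0n ?expn_gt0//.
  by move: jbig j2; lra.
have xin : (tau x < (4 ^ j)%N%:R * mesh j)%R by rewrite mesh_range; move: jbig j2; lra.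
have : a%:E < P j x.
  have [[i [_ /= /andP[h _]] ->]|[xN _]] := stepP hT (mesh_gt0 j) (@rea_step j) (x := x) I;
    last first.
    by move: (le_lt_trans xN xin); rewrite ltxx.
  rewrite rea_stepE lt_min lte_fin; apply/andP; split; last by move: jbig; lra.
  rewrite (rea_lt _ de (ltW a0)); apply: le_lt_trans epse.
  by rewrite lee_fin -natr1 mulrDl mul1r lerD.
rewrite ltNge => /negP; apply; apply: le_trans la.
by apply: ereal_sup_ubound; exists j.
Qed.

End step_approximation.

Section optimality.
Context (R : realType) (n : nat).
Hypothesis n0 : (0 < n)%N.
Local Notation mu := (lebesgue_Rn R n).
Local Notation D := (@positives R).
Local Notation lam := (lebesgue_line R).
Local Notation tau := (@cube_volume R n).
Variable rhoX : (Rn R n -> \bar R) -> \bar R.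
Hypothesis hX : ri_norm_Rn rhoX.
Let mT : measurable (setT : set (Rn R n)) := measurableT.
Let hT := ucoord_Rn R n0.
Variable gamma : R.
Let al := (gamma / n%:R)%R.
Hypothesis al1 : (al < 1)%R.
Let sigma := sigma_norm gamma rhoX.
Let sigma' := associate_norm mu setT sigma.
Hypotheses (hS : ri_norm_Rn sigma) (hS' : ri_norm_Rn sigma').
Variable rhoZ : (Rn R n -> \bar R) -> \bar R.
Hypothesis hZ : ri_norm_Rn rhoZ.
Variable C : R.
Hypothesis C0 : (0 < C)%R.
Hypothesis hMZ : forall f, in_space setT rhoX f ->
  in_space setT rhoZ (fractional_maximal gamma f) /\
  space_norm rhoZ (fractional_maximal gamma f) <= C%:E * space_norm rhoX f.

Let abs_ge0 (f : Rn R n -> \bar R) : (forall x, 0 <= f x) -> (fun x => `|f x|) = f.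
Proof. by move=> f0; apply/funext => x; rewrite gee0_abs. Qed.

(** The hypothesis on the maximal operator is applied to decreasing functions
    of the coordinate, for which [dist_hardy_le] holds. *)
Lemma sigma_le_of_pairing (k : Rn R n -> \bar R) : nonneg_measurable setT k ->
  (forall u, nonneg_measurable setT u ->
    pairing (dist mu setT k) (dist mu setT u) <= 2%:E * rhoZ u) ->
  sigma k <= (2 * C)%:E.
Proof.
move=> hk kZ; rewrite /sigma (sigma_normE n0 hX _ hk).
apply: ge_ereal_sup => _ [_ [? [f [hf f1] <-] <-] <-].
set e := dist mu setT f; have de : is_dist e := dist_is_dist mu mT hf.1.
pose F (x : Rn R n) := rea e (tau x).
have hF : nonneg_measurable setT F := nonneg_measurable_rea mT hT e.
have rF : space_norm rhoX F = rhoX f.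
  rewrite /space_norm abs_ge0; last by move=> x; exact: rea_ge0.
  exact: (ri_norm_rea mT hT hX hf).
have [|[mM _] MF] := @hMZ F.
  by split; [exact: hF.1|rewrite rF; exact: le_lt_trans f1 (ltry 1)].
have M0 : nonneg_measurable setT (fractional_maximal gamma F).
  by split=> // x _; exact: fractional_maximal_ge0.
apply: (@le_trans _ _ (pairing (dist mu setT k) (dist mu setT (fractional_maximal gamma F)))).
  by apply: le_pairing => // a a0; exact: dist_hardy_le.
apply: (le_trans (kZ _ M0)); rewrite EFinM; apply: lee_wpmul2l => //.
move: MF; rewrite {1}/space_norm abs_ge0 => [MF|x]; last exact: fractional_maximal_ge0.
apply: (le_trans MF); rewrite -[leRHS]mule1; apply: lee_wpmul2l; first by rewrite lee_fin ltW.
by rewrite rF.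
Qed.

(** A multiple of the norming function is admissible in the definition of
    [sigma']. *)
Lemma step_norm_le del N (v : 'I_N -> R) : (0 < del)%R -> (forall i, 0 <= v i)%R ->
  rhoZ (fun x => (step tau del v x)%:E) <=
  (2 * C)%:E * sigma' (fun x => (step tau del v x)%:E).
Proof.
move=> del0 v0; have [k hk [<- kZ]] := norming_step n0 hZ del0 v0.
have CC : (0 < 2 * C)%R by rewrite mulr_gt0.
have hv := nonneg_measurable_step mT hT del0 v0.
have ci0 : (0 <= (2 * C)^-1)%R by rewrite invr_ge0 ltW.
rewrite -lee_pdivrMl//; apply: ereal_sup_ubound.
exists (fun x => (2 * C)^-1%:E * k x).
  split; first exact: nonneg_measurableZ.
  by rewrite (ri_normZ hS ci0 hk) lee_pdivrMl// mule1 sigma_le_of_pairing.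
have hvk := nonneg_measurableM hv hk.
rewrite -[RHS]ge0_integralZl.
- by apply: eq_integral => x _; rewrite -muleA [k x * _]muleC.
- exact: mT.
- exact: hvk.1.
- exact: hvk.2.
- by rewrite lee_fin.
Qed.

Lemma embedded_optimal : embedded setT sigma' rhoZ.
Proof.
have CC : (0 < 2 * C)%R by rewrite mulr_gt0.
have main g : nonneg_measurable setT g -> rhoZ g <= (2 * C)%:E * sigma' g.
  move=> hg; set e := dist mu setT g; have de : is_dist e := dist_is_dist mu mT hg.1.
  have hr := nonneg_measurable_rea mT hT e.
  rewrite -(ri_norm_rea mT hT hZ hg) -(ri_norm_rea mT hT hS' hg) -/e.
  pose P j (x : Rn R n) := (step tau (mesh R j) (@rea_step R e j) x)%:E.
  have hP j : nonneg_measurable setT (P j).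
    by apply: (nonneg_measurable_step mT hT (mesh_gt0 R j)) => i; exact: rea_step_ge0.
  have [|nd /cvg_lim <-//] := ri_norm_fatou hZ hP hr.
    apply: aeW => x _; split; last exact: rea_step_cvg.
    by apply/nondecreasing_seqP => j; exact: rea_step_ndecr.
  apply: lime_le; first by apply: ereal_nondecreasing_is_cvgn; exact: nd.
  apply: nearW => j.
  apply: (@le_trans _ _ ((2 * C)%:E * sigma' (P j))).
    by apply: step_norm_le; [exact: mesh_gt0|move=> i; exact: rea_step_ge0].
  apply: lee_wpmul2l; first by rewrite lee_fin ltW.
  by apply: (ri_norm_le hS' (hP j) hr); apply: aeW => x _; exact: rea_step_le.
exists (2 * C)%R; first exact: CC.
move=> f [mf ff].
have hf := nonneg_measurable_abs mf; have h := main _ hf.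
split; last exact: h.
split=> //; apply: le_lt_trans h _; apply: lte_mul_pinfty => //.
by rewrite lee_fin ltW.
Qed.

End optimality.

(** * Necessity of the growth condition *)

Section converse.
Context (R : realType) (n : nat).
Hypothesis n0 : (0 < n)%N.
Local Notation mu := (lebesgue_Rn R n).
Local Notation tau := (@cube_volume R n).
Let mT : measurable (setT : set (Rn R n)) := measurableT.
Let hT := ucoord_Rn R n0.
Variable gamma : R.
Let al := (gamma / n%:R)%R.
Hypothesis al1 : (al < 1)%R.

Let indic_sublevel s (x : Rn R n) : \bar R := (\1_(sublevel setT tau s) x : R)%:E.

Let h1 s : nonneg_measurable setT (indic_sublevel s).
Proof. apply: nonneg_measurable_indic; exact: (measurable_sublevel mT hT). Qed.

(** The cube itself is admissible. *)
Lemma maximal_indic_ge t x : (0 < t)%R -> sublevel setT tau t x ->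
  (t `^ al)%:E <= fractional_maximal gamma (indic_sublevel t) x.
Proof.
move=> t0 [_ /= xt]; have l0 : (0 < 2 * half_side n t)%R by rewrite mulr_gt0// half_side_gt0.
have Qt := cube_volume_le_cube (R := R) n0 (ltW t0).
set a := [tuple of _] in Qt; set l := (2 * _)%R in Qt l0.
have Qx : cube a l x by rewrite -Qt; exact: ltW.
apply: le_trans (cube_mean_le_maximal gamma _ l0 Qx).
rewrite /cube_mean /cube_weight half_sideK ?(ltW t0)//.
have sQ : sublevel setT tau t `<=` cube a l by rewrite -Qt => y [_ /= /ltW].
have -> : \int[mu]_(y in cube a l) `|indic_sublevel t y| = t%:E.
  rewrite -(measure_sublevel hT (ltW t0)).
  rewrite (eq_integral (fun y => (\1_(sublevel setT tau t) y)%:E)); last first.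
    by move=> y _; rewrite gee0_abs// lee_fin.
  rewrite integral_indic; [|exact: measurable_cube|exact: (measurable_sublevel mT hT)].
  by congr (mu _); exact: setIidl.
rewrite -/al -powRN opprB -EFinM lee_fin -{3}(powRr1 (ltW t0)) -powRD; last first.
  by rewrite (lt0r_neq0 t0) implybT.
by rewrite subrK.
Qed.

(** The maximal function of the indicator of a cube of volume [t >= 1] is at
    least [t `^ al] on the centred unit cube. *)
Lemma growth_of_bounded_maximal rhoX rhoY : ri_norm_Rn rhoX -> ri_norm_Rn rhoY ->
  bounded_operator setT rhoX (@fractional_maximal R n gamma) rhoY ->
  0 < ereal_inf [set fundamental_function mu setT rhoX t * (t `^ (- al))%:E
                | t in `[1%R, +oo[%classic].
Proof.
move=> hX hY [C C0 hC].
have gY0 := sublevel_norm_gt0 mT hT hY ltr01.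
have fY : sublevel_norm setT tau rhoY 1 \is a fin_num by exact: (sublevel_norm_fin mT hT hY).
apply: (@lt_le_trans _ _ (C^-1%:E * sublevel_norm setT tau rhoY 1)).
  by rewrite mule_gt0// lte_fin invr_gt0.
apply: le_ereal_inf_tmp => _ [t /= t1 <-].
move: t1; rewrite in_itv/= andbT => t1; have t0 : (0 < t)%R by exact: lt_le_trans t1.
rewrite (fundamental_functionE n0 hX (ltW t0)) powRN lee_pdivlMr ?powR_gt0//.
rewrite -muleA lee_pdivrMl//.
have absI : (fun x => `|indic_sublevel t x|) = indic_sublevel t.
  by apply/funext => x; rewrite gee0_abs// lee_fin.
have nX : space_norm rhoX (indic_sublevel t) = sublevel_norm setT tau rhoX t.
  by rewrite /space_norm absI.
have [|[mM _]] := hC (indic_sublevel t).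
  split; first exact: (h1 t).1.
  by rewrite nX -ge0_fin_numE ?(sublevel_norm_fin mT hT hX) ?(sublevel_norm_ge0 mT hT hX) ?ltW.
rewrite nX; apply: le_trans; rewrite /space_norm.
have p0 : (0 <= t `^ al)%R by exact: powR_ge0.
rewrite muleC -(ri_normZ hY p0 (h1 1)).
apply: (ri_norm_le hY (nonneg_measurableZ p0 (h1 1)) (nonneg_measurable_abs mM)).
apply: aeW => x _; rewrite gee0_abs; last exact: fractional_maximal_ge0.
rewrite /indic_sublevel indicE; have [x1|_] := boolP (x \in sublevel setT tau 1).
  rewrite mulr1n mule1; apply: maximal_indic_ge => //.
  by move: x1; rewrite inE => -[_ /= x1]; split => //=; exact: lt_le_trans t1.
by rewrite mulr0n mule0; exact: fractional_maximal_ge0.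
Qed.

End converse.

(** * The theorem *)

Theorem theorem4p1 (R : realType) (n : nat)
    (rhoX : (Rn R n -> \bar R) -> \bar R) (hX : ri_norm_Rn rhoX)
    (gamma : R) (hgamma0 : (0 < gamma)%R) (hgamman : (gamma < n%:R)%R) :
  let condA := 0 < ereal_inf
    [set fundamental_function (lebesgue_Rn R n) setT rhoX t *
         (t `^ (- (gamma / n%:R)))%:E | t in `[1%R, +oo[%classic] in
  let M := @fractional_maximal R n gamma in
  let sigma := sigma_norm gamma rhoX in
  let sigma' := associate_norm (lebesgue_Rn R n) setT sigma in
  (condA ->
    [/\ ri_norm_Rn sigma,
        ri_norm_Rn sigma',
        bounded_operator setT rhoX M sigma'
      & forall rhoZ : (Rn R n -> \bar R) -> \bar R, ri_norm_Rn rhoZ ->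
          bounded_operator setT rhoX M rhoZ -> embedded setT sigma' rhoZ]) /\
  (~ condA ->
    ~ exists rhoY : (Rn R n -> \bar R) -> \bar R,
        ri_norm_Rn rhoY /\ bounded_operator setT rhoX M rhoY).
Proof.
move=> condA M sigma sigma'.
have n0 : (0 < n)%N by rewrite -(ltr_nat R); exact: lt_trans hgamman.
have nR0 : (0 < n%:R :> R)%R by rewrite ltr0n.
have al0 : (0 < gamma / n%:R)%R by rewrite divr_gt0.
have al1 : (gamma / n%:R < 1)%R by rewrite ltr_pdivrMr// mul1r.
split=> [hA|nA [rhoY [hY hM]]]; last by apply: nA; exact: growth_of_bounded_maximal hM.
have [c c0 /andP[_ /ltW cinf]] := lte_real_between (lexx 0) hA.
have lowA t : (1 <= t)%R ->
    (c * t `^ (gamma / n%:R))%:E <= sublevel_norm setT (@cube_volume R n) rhoX t.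
  move=> t1; have t0 : (0 < t)%R by exact: lt_le_trans t1.
  rewrite -(fundamental_functionE n0 hX (ltW t0)) EFinM -lee_pdivlMr ?powR_gt0// -powRN.
  by apply: (le_trans cinf); apply: ereal_inf_lbound; exists t => //=; rewrite in_itv/= t1.
have hS : ri_norm_Rn sigma by exact: (ri_norm_sigma n0 hX al0 al1 c0 lowA).
have hS' : ri_norm_Rn sigma' by exact: (ri_norm_associate measurableT (ucoord_Rn R n0) hS).
split=> //; first exact: bounded_maximal.
by move=> rhoZ hZ [C C0 hC]; exact: (embedded_optimal n0 hX al1 hS hS' hZ C0 hC).
Qed.
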